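(* Let $(X,\theta,\mu,\alpha)$ be a Markov map with $\theta$-invariant probability measure $\mu$ and embedded Gibbs-Markov structure $(\Omega,\beta,\eta)$ with induced map $\sigma:\Omega\to\Omega$, let $(Y,T,\kappa)$ be a graph extension of $(X,\theta,\mu,\alpha)$ by a graph $\mathcal{G}=(\mathbf{V},\mathbf{E})$, and suppose that the induced graph extension $S(x,g)=T^{\eta(x)}(x,g)=(\sigma(x),\hat\kappa_x(g))$ on $\Omega\times\mathbf{V}$ is topologically transitive and has uniform loops. Fix $\mathbf{o}\in\mathbf{V}$ and put $$R_\Omega(T)=\limsup_{n\to\infty}\sqrt[n]{\mu(\{x\in\Omega\cap\theta^{-n}(\Omega):\kappa_x^n(\mathbf{o})=\mathbf{o}\})}.$$ Then the following holds. (i) If $\mathcal{G}$ is $\mu$-amenable and the induced extension $S$ over $(\Omega,\sigma,\nu)$ is symmetric, then $R_\Omega(T)=1$. (ii) Suppose that $T$ is topologically transitive, $\hat\kappa$ finitely covers $\kappa$, and the embedding is adequate and has exponential tails. Then $R_\Omega(T)=1$ implies that $\mathcal{G}$ is $\mu$-amenable.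
   Context: Markov map. $(X,\theta,\mu,\alpha)$ consists of a standard probability space $(X,\mathcal{B},\mu)$, an at most countable partition $\alpha$ of $X$ into measurable sets of positive measure, and $\theta:X\to X$ such that for all $a,b\in\alpha$: $\theta|_a:a\to\theta(a)$ is invertible, bimeasurable and non-singular; and either $\mu(a\cap\theta(b))=0$ or $\mu(a\cap\theta(b)^c)=0$; moreover the sets $[w_1\ldots w_n]=\bigcap_{k=1}^n\theta^{-k+1}(w_k)$, $w_i\in\alpha$, $n\ge1$, generate $\mathcal{B}$ mod $\mu$. $\mathcal{W}^1=\alpha$; $\mathcal{W}^n$ is the set of admissible words $w=(w_1\ldots w_n)$, $w_i\in\alpha$, i.e. $\theta(w_i)\supset w_{i+1}$ (mod $\mu$); $\mathcal{W}^\infty=\bigcup_{n\ge1}\mathcal{W}^n$. For $w\in\mathcal{W}^n$, $\tau_w:\theta^n([w])\to[w]$ is the inverse of $\theta^n|_{[w]}$ and $\varphi_w=\frac{d\mu\circ\tau_w}{d\mu}$. Gibbs-Markov map with full branches: a Markov map such that $\theta([w])=X$ mod $\mu$ for all $w\in\mathcal{W}^1$ and there are $C>0$, $r\in(0,1)$ with $|\log\varphi_w(x)-\log\varphi_w(y)|\le C\,d_r(x,y)$ for all $w\in\mathcal{W}^\infty$ and a.e. $x,y$, where $d_r(x,y)=r^{\min\{i:x_i\ne y_i\}}$ and $(x_i),(y_i)$ are the itineraries of $x,y$ with respect to the partition. Embedded Gibbs-Markov structure $(\Omega,\beta,\eta)$: $\Omega\subset X$ is a finite union of elements of $\alpha$,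 $\beta\subset\mathcal{W}^\infty$, $\eta:\beta\to\mathbb{N}$, $\{[u]:u\in\beta\}$ is a partition of $\Omega$ mod $\mu$, and, with $\eta(x):=\eta(u)$ and $\sigma(x):=\theta^{\eta(u)}(x)$ for $x\in[u]$, $u\in\beta$, and $\nu:=\mu(\Omega)^{-1}\mu|_\Omega$, $(\Omega,\sigma,\nu,\beta)$ is a Gibbs-Markov map with full branches. It is adequate if (a) there is a sequence $(C_n)$ with $\lim_n C_n/n=0$ and $|\log\varphi_w(x)-\log\varphi_w(y)|\le C_n\,d_\sigma(x,y)$ for all $w\in\mathcal{W}^n$, $a\in\alpha$ with $[wa]\ne\emptyset$, $[w],[a]\subset\Omega$, and all $x,y\in[a]$, where $d_\sigma$ is the metric $d_r$ with respect to $(\Omega,\sigma)$ and the partition $\beta$; (b) there is an almost surely finite function $\eta^\dagger:\Omega\to\mathbb{N}$ such that for a.e. $x\in\Omega$ and all $l=0,\ldots,\eta(x)-1$ with $\theta^l(x)\in\Omega$ one has $\eta(x)-l\le\eta^\dagger(\theta^l(x))$. It has exponential tails if $\limsup_{n\to\infty}\sqrt[n]{\mu(\{x\in\Omega:\eta(x)=n\})}<1$. Graph extension. A graph is directed, $\mathbf{V}$ at most countable, $\mathbf{E}\subset\mathbf{V}\times\mathbf{V}$, $s(e),t(e)$ denote source and target of $e$. A nearest neighbour cocycle is $\kappa:X\times\mathbf{V}\to\mathbf{V}$, $(x,g)\mapsto\kappa_x(g)$, such that each $\kappa_x$ is a bijection of $\mathbf{V}$, $(g,\kappa_x(g))\in\mathbf{E}$,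 and $\kappa_x=\kappa_y$ whenever $x,y$ lie in the same element of $\alpha$. The graph extension $(Y,T,\kappa)$ is $Y=X\times\mathbf{V}$, $T(x,g)=(\theta(x),\kappa_x(g))$. For $w\in\mathcal{W}^n$, $x\in[w]$: $\kappa_w=\kappa_x^n=\kappa_{\theta^{n-1}(x)}\circ\cdots\circ\kappa_x$. For $x\in\Omega$, $\hat\kappa_x:=\kappa_x^{\eta(x)}$ and $\hat\kappa_x^n=\hat\kappa_{\sigma^{n-1}(x)}\circ\cdots\circ\hat\kappa_x$; $S$ is regarded as an extension of $(\Omega,\sigma,\nu,\beta)$ by $\hat\kappa$ (so $\hat\kappa_x$ is constant on each $[u]$, $u\in\beta$). $\hat{\mathcal{W}}^\infty$ denotes the finite words over $\beta$, with $\hat\kappa_w$ for $w\in\hat{\mathcal{W}}^\infty$ defined as $\kappa_w$, with $(\theta,\kappa)$ replaced by $(\sigma,\hat\kappa)$. $T$ is topologically transitive if for all $a,b\in\alpha$, $g,h\in\mathbf{V}$ there is $n\ge1$ such that $T^n(a\times\{g\})\cap(b\times\{h\})$ has positive measure with respect to the product of $\mu$ and counting measure; analogously for $S$, with $\beta,\nu$ in place of $\alpha,\mu$. $S$ has uniform loops if there is a finite set $\mathcal{J}\subset\Omega$ with $g\in\{\hat\kappa_x(g):x\in\mathcal{J}\}$ for all $g\in\mathbf{V}$. $\hat\kappa$ finitely covers $\kappa$ if there is a finite set $\mathcal{K}\subset\hat{\mathcal{W}}^\infty$ such that for all $v\in\mathcal{W}^1$ and $g\in\mathbf{V}$ there is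 $w\in\mathcal{K}$ with $\kappa_v(g)=\hat\kappa_w(g)$. $S$ is symmetric if there are sequences $(C_n)$, $(N_n)$ with $\lim_n C_n^{1/n}=1$, $\lim_n N_n/n=0$ and, for all $v,w\in\mathbf{V}$ and $n$, $\nu(\{x\in\Omega:\hat\kappa_x^n(v)=w\})\le C_n\sum_{k=n-N_n}^{n+N_n}\nu(\{x\in\Omega:\hat\kappa_x^k(w)=v\})$. $\mu$-amenability: with $p(e)=\mu(\{x\in X:\kappa_x(s(e))=t(e)\})$ and $\partial^\epsilon K=\{v\in K:\exists e\in\mathbf{E}, s(e)=v, t(e)\notin K, p(e)>\epsilon\}$, $\mathcal{G}$ is $\mu$-amenable if $\lim_{\epsilon\to0}\inf\{|\partial^\epsilon K|/|K|:K\subset\mathbf{V},0<|K|<\infty\}=0$. *)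

(* Defs.v *)
From HB Require Import structures.
From mathcomp Require Import all_boot all_order all_algebra finmap.
From mathcomp Require Import all_classical all_reals all_analysis.

Set Implicit Arguments.
Unset Strict Implicit.
Unset Printing Implicit Defensive.

Import Order.TTheory GRing.Theory Num.Theory.
Import numFieldNormedType.Exports.

Local Open Scope classical_set_scope.
Local Open Scope ring_scope.

Section MarkovMaps.
Context {d : measure_display} {X : measurableType d} {R : realType}.

(* Measures are taken as plain set functions so that the definitions apply
   both to mu and to the normalized restriction [cond_measure mu Omega]. *)
Implicit Types (mu : set X -> \bar R) (D : set X) (theta : X -> X).
Implicit Types (alpha : set (set X)) (w : seq (set X)).

Definition polish (P : metricType R) : Prop :=
  (exists2 Q : set P, countable Q & dense Q) /\
  (forall F : set_system P, ProperFilter F -> cauchy F -> exists p : P, F --> p).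

Definition borel (P : metricType R) (B : set P) : Prop :=
  <<s [set U : set P | open U] >> B.

(* Isomorphic mod 0 to a Borel probability on a Polish space.  The last clause
   allows the sigma-algebra of X to be the Borel one, its completion, or
   anything in between. *)
Definition standard_probability mu : Prop :=
  mu [set: X] = 1%E /\
  exists (P : metricType R) (f : X -> P) (X0 : set X),
    [/\ polish P, measurable X0 /\ mu (~` X0) = 0%E,
        set_inj X0 f /\ borel (f @` X0),
        forall B : set P, borel B -> measurable (X0 `&` f @^-1` B) &
        forall A : set X, measurable A -> A `<=` X0 ->
          exists2 B : set P, borel B &
            B `<=` f @` A /\ mu.-negligible (A `\` f @^-1` B)].

Definition eq_mod mu (A B : set X) : Prop :=
  mu (A `\` B) = 0%E /\ mu (B `\` A) = 0%E.

Definition partition_mod (I : Type) mu D (J : set I) (F : I -> set X) : Prop :=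
  [/\ forall i, J i -> measurable (F i),
      forall i, J i -> mu (F i `\` D) = 0%E,
      forall i j, J i -> J j -> i <> j -> mu (F i `&` F j) = 0%E &
      mu (D `\` \bigcup_(i in J) F i) = 0%E].

(* [w_1 ... w_n]; letters are numbered from 0. *)
Definition cylinder theta w : set X :=
  [set x | forall k, (k < size w)%N -> nth set0 w k (iter k theta x)].

(* W^n *)
Definition words mu theta alpha (n : nat) : set (seq (set X)) :=
  [set w | [/\ (0 < n)%N, size w = n,
      forall k, (k < n)%N -> alpha (nth set0 w k) &
      forall k, (k.+1 < n)%N ->
        mu (nth set0 w k.+1 `\` theta @` nth set0 w k) = 0%E]].

(* W^infinity *)
Definition finite_words mu theta alpha : set (seq (set X)) :=
  \bigcup_n words mu theta alpha n.

(* Markov map on the probability space (D, mu), everything being understood up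
   to null sets; D is a measurable subset of X so that induced systems are
   covered as well. *)
Record markov_on D theta mu alpha : Prop := MarkovOn {
  mo_measurable : measurable D ;
  mo_mass : mu D = 1%E ;
  mo_self : {ae mu, forall x, D x -> D (theta x)} ;
  mo_countable : countable alpha ;
  mo_partition : partition_mod mu D alpha id ;
  mo_positive : forall a, alpha a -> (0 < mu a)%E ;
  mo_invertible : forall a, alpha a -> set_inj a theta ;
  mo_preimage : forall a, alpha a -> measurable_fun a theta ;
  mo_image : forall a A, alpha a -> measurable A -> A `<=` a ->
    measurable (theta @` A) ;
  mo_nonsingular : forall a A, alpha a -> measurable A -> A `<=` a ->
    (mu A = 0%E <-> mu (theta @` A) = 0%E) ;
  mo_markov : forall a b, alpha a -> alpha b ->
    mu (a `&` theta @` b) = 0%E \/ mu (a `&` ~` (theta @` b)) = 0%E ;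
  mo_generate : forall A, measurable A -> A `<=` D ->
    exists2 B, <<s [set cylinder theta w | w in
                     [set w | w <> [::] /\
                        forall k, (k < size w)%N -> alpha (nth set0 w k)]] >> B
             & eq_mod mu A (B `&` D)
}.

Definition markov_map theta mu alpha : Prop :=
  [/\ standard_probability mu, partition alpha id [set: X] &
      markov_on [set: X] theta mu alpha].

Definition invariant_measure mu theta : Prop :=
  forall A, measurable A -> mu (theta @^-1` A) = mu A.

(* phi is a version of phi_w = d(mu o tau_w)/dmu on theta^n([w]), where tau_w is
   the inverse of theta^n on [w]; for B included in theta^n([w]),
   tau_w(B) = [w] `&` theta^-n(B). *)
Definition branch_dom theta w : set X := iter (size w) theta @` cylinder theta w.

Definition is_jacobian mu theta w (phi : X -> R) : Prop :=
  [/\ measurable_fun (branch_dom theta w) phi,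
      forall y, branch_dom theta w y -> 0 <= phi y &
      forall B, measurable B -> B `<=` branch_dom theta w ->
        mu (cylinder theta w `&` iter (size w) theta @^-1` B) =
        (\int[mu]_(y in B) (phi y)%:E)%E].

(* |log phi_w(x) - log phi_w(y)| <= K dist(x, y) for a.e. x, y in A at which
   phi_w is defined. *)
Definition distortion_le mu theta w (A : set X) (K : R) (dist : X -> X -> R) :
    Prop :=
  exists phi : X -> R, is_jacobian mu theta w phi /\
    exists2 N, mu.-negligible N &
      forall x y, (A `&` branch_dom theta w `\` N) x ->
                  (A `&` branch_dom theta w `\` N) y ->
        `|ln (phi x) - ln (phi y)| <= K * dist x y.

(* x_i <> y_i *)
Definition itinerary_neq theta alpha (x y : X) (i : nat) : Prop :=
  ~ exists2 a, alpha a & a (iter i theta x) /\ a (iter i theta y).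

Definition dist_r theta alpha (r : R) (x y : X) : R :=
  if pselect (exists i, `[< itinerary_neq theta alpha x y i >]) is left e
  then r ^+ ex_minn e else 0.

Record gibbs_markov_full D theta mu alpha (r : R) : Prop := GibbsMarkovFull {
  gm_markov : markov_on D theta mu alpha ;
  gm_full : forall a, alpha a -> eq_mod mu (theta @` a) D ;
  gm_r : 0 < r < 1 ;
  gm_distortion : exists2 C : R, 0 < C &
    forall w, finite_words mu theta alpha w ->
      distortion_le mu theta w D C (dist_r theta alpha r)
}.

Definition cond_measure mu D : set X -> \bar R :=
  fun A => ((fine (mu D))^-1%:E * mu (A `&` D))%E.

Section Induced.
Variables (theta : X -> X) (beta : set (seq (set X))) (eta : seq (set X) -> nat).

(* The value 0 is taken outside the union of the [u], u in beta. *)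
Definition return_time (x : X) : nat :=
  if pselect (exists2 u, beta u & cylinder theta u x) is left e
  then eta (s2val (cid2 e)) else 0%N.

Definition induced_map (x : X) : X := iter (return_time x) theta x.

Definition induced_partition : set (set X) := [set cylinder theta u | u in beta].

End Induced.

Record embedded_gibbs_markov theta mu alpha (Omega : set X)
    (beta : set (seq (set X))) (eta : seq (set X) -> nat) (r : R) : Prop :=
  EmbeddedGibbsMarkov {
  eg_union : exists A0 : set (set X),
    [/\ finite_set A0, A0 `<=` alpha & Omega = \bigcup_(a in A0) a] ;
  eg_words : beta `<=` finite_words mu theta alpha ;
  eg_partition : partition_mod mu Omega beta (cylinder theta) ;
  eg_gibbs_markov :
    gibbs_markov_full Omega (induced_map theta beta eta) (cond_measure mu Omega)
      (induced_partition theta beta) r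
}.

Record adequate theta mu alpha (Omega : set X)
    (beta : set (seq (set X))) (eta : seq (set X) -> nat) (r : R) : Prop :=
  Adequate {
  ad_distortion : exists2 C : nat -> R, C n / n%:R @[n --> \oo] --> (0 : R) &
    forall n w a, words mu theta alpha n w -> alpha a ->
      cylinder theta (rcons w a) !=set0 ->
      cylinder theta w `<=` Omega -> a `<=` Omega ->
      distortion_le mu theta w a (C n)
        (dist_r (induced_map theta beta eta) (induced_partition theta beta) r) ;
  ad_return : exists etad : X -> nat,
    {ae mu, forall x, Omega x ->
       forall l, (l < return_time theta beta eta x)%N -> Omega (iter l theta x) ->
         (return_time theta beta eta x - l <= etad (iter l theta x))%N}
}.

(* n-th root; only used for n >= 1, a >= 0 *)
Definition nth_root (n : nat) (a : R) : R := a `^ (n%:R^-1).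

Definition exponential_tails theta mu (Omega : set X)
    (beta : set (seq (set X))) (eta : seq (set X) -> nat) : Prop :=
  (limn_esup (fun n => (nth_root n (fine (mu (Omega `&`
     [set x | return_time theta beta eta x = n]))))%:E) < 1)%E.

Section GraphExtensions.
Variable V : countType.
Implicit Types (kappa : X -> V -> V) (E : set (V * V)).

Definition locally_constant alpha kappa : Prop :=
  forall a x y, alpha a -> a x -> a y -> kappa x =1 kappa y.

Record nearest_neighbour_cocycle E alpha kappa : Prop :=
  NearestNeighbourCocycle {
  nn_bijective : forall x, bijective (kappa x) ;
  nn_edge : forall x g, E (g, kappa x g) ;
  nn_locally_constant : locally_constant alpha kappa
}.

Definition graph_extension theta kappa (z : X * V) : X * V :=
  (theta z.1, kappa z.1 z.2).

(* kappa_x^n *)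
Fixpoint cocycle_iter theta kappa (n : nat) (x : X) (g : V) : V :=
  if n is m.+1 then kappa (iter m theta x) (cocycle_iter theta kappa m x g)
  else g.

(* kappa_w(g) = h *)
Definition word_cocycle theta kappa w (g h : V) : Prop :=
  exists2 x, cylinder theta w x & cocycle_iter theta kappa (size w) x g = h.

Definition induced_cocycle theta kappa beta eta (x : X) : V -> V :=
  cocycle_iter theta kappa (return_time theta beta eta x) x.

(* product of mu and the counting measure on V *)
Definition prod_counting mu (A : set (X * V)) : \bar R :=
  \esum_(g in [set: V]) mu [set x | A (x, g)].

Definition topologically_transitive mu alpha (T : X * V -> X * V) : Prop :=
  forall a b g h, alpha a -> alpha b ->
    exists2 n, (0 < n)%N &
      (0 < prod_counting mu
             ((iter n T @` (a `*` [set g])) `&` (b `*` [set h])))%E.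

(* The finite set consists of points lying in some element of alpha: the
   cocycle of the induced system is only meaningful there. *)
Definition uniform_loops alpha kappa : Prop :=
  exists J : set X, [/\ finite_set J, J `<=` \bigcup_(a in alpha) a &
    forall g, exists2 x, J x & kappa x g = g].

Definition finitely_covers theta alpha kappa mu' theta' alpha' kappa' : Prop :=
  exists K : set (seq (set X)),
    [/\ finite_set K, K `<=` finite_words mu' theta' alpha' &
        forall v g, alpha v -> exists w h,
          [/\ K w, word_cocycle theta kappa [:: v] g h &
              word_cocycle theta' kappa' w g h]].

Definition symmetric_extension D theta mu kappa : Prop :=
  exists (C : nat -> R) (N : nat -> nat),
    [/\ forall n, 0 < C n, nth_root n (C n) @[n --> \oo] --> (1 : R),
        (N n)%:R / n%:R @[n --> \oo] --> (0 : R) &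
        forall g h n, (0 < n)%N ->
          (mu (D `&` [set x | cocycle_iter theta kappa n x g = h]) <=
           (C n)%:E * \sum_(n - N n <= k < (n + N n).+1)
             mu (D `&` [set x | cocycle_iter theta kappa k x h = g]))%E].

(* p(e) *)
Definition edge_weight mu kappa (e : V * V) : \bar R :=
  mu [set x | kappa x e.1 = e.2].

Definition eps_boundary E mu kappa (eps : R) (K : {fset V}) : {fset V} :=
  [fset v in K | `[< exists e, [/\ E e, e.1 = v, e.2 \notin K &
                                (eps%:E < edge_weight mu kappa e)%E] >]]%fset.

Definition mu_amenable E mu kappa : Prop :=
  inf [set ((#|` eps_boundary E mu kappa eps K|)%:R / (#|` K|)%:R : R)
      | K in [set K : {fset V} | (0 < #|` K|)%N]]
    @[eps --> (0 : R)^'+] --> (0 : R).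

(* R_Omega(T) *)
Definition return_rate theta mu kappa (Omega : set X) (o : V) : \bar R :=
  limn_esup (fun n => (nth_root n (fine (mu (Omega `&`
    (iter n theta @^-1` Omega) `&`
    [set x | cocycle_iter theta kappa n x o = o]))))%:E).

End GraphExtensions.
End MarkovMaps.

(* Main.v *)
(** Write [m w] for the [nu]-mass of the cylinder of a word [w] over [beta] and
    [k_w] for the permutation of [V] attached to it.  Bounded distortion gives
    [m (u v w) m v <= (1 + O(r^|v|)) m (u v) m (v w)], so that return
    probabilities [p_n g h] of [S] are supermultiplicative up to a constant.

    (i) By invariance of [mu] and injectivity of the [kappa_x^j], the mass leaving
    a finite set within bounded time is controlled by the mass leaving it in one
    step; hence amenability yields, for every [n], finite sets [K] with
    [sum_(g, h in K) p_n g h >= |K| / 2].  If [R_Omega(T) < 1], then [p_n] decays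
    like [rho^n] on [K].  Symmetry bounds the powers of the positive matrix
    [A = P^T P], [P] the restriction of [p_n] to [K], by return probabilities,
    so [1^T A^j 1] decays at a rate which is small for large [n]; log-convexity of
    [j |-> 1^T A^j 1] contradicts the choice of [K].

    (ii) If the graph is not amenable, finite covering and uniform loops provide
    a finite set of words of one length [N] that expands every finite set, and a
    Cheeger-type argument gives [l^2]-norm [< sum m u] for the operator
    [sum_u m u (f o k_u)].  A word is cut into blocks [u v] with [|u| = N] and [v]
    long: given [v], past and future are almost independent and the law of [u] has
    a fixed proportion of [m], so each block contracts the [l^2]-norm.  By the
    exponential tails this survives a weight [s^eta] with [s > 1] close to 1, and
    adequacy transfers the resulting decay from [S] to [T]. *)
Require Import Defs.
From HB Require Import structures.
From mathcomp Require Import all_boot all_order all_algebra finmap.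
From mathcomp Require Import all_classical all_reals all_analysis.
From mathcomp Require Import measurable_realfun.
From mathcomp Require Import ring lra zify.

Set Implicit Arguments.
Unset Strict Implicit.
Unset Printing Implicit Defensive.

Import Order.TTheory GRing.Theory Num.Theory.
Import numFieldNormedType.Exports.

Local Open Scope classical_set_scope.
Local Open Scope ring_scope.

(** * Expanding families of permutations have a spectral gap *)

(** The measure [nu] is only quasi-Bernoulli: successive words are independent up to a fixed
    constant [D = Dk 0]. A factor [D] lost in every block would swallow any spectral gap. This
    shapes (ii): the spacer [v] lowers the loss per block to [Dk l], close to 1, while the
    proportion gained, [c / (2 * D ^+ 2)], does not depend on [l]. Hence the order of choices: the
    gap, then [l], then [s]. In (i) the loss is harmless because [n] is chosen large enough to beat
    it, and the constants depending on the finite set [K] are paid only once, while the power of [A]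
    tends to infinity with [n] and [K] fixed. The alphabet may be infinite. Estimates on words are
    made over finite lists of letters, with constants independent of the list, and norms are tested
    on finite sets of vertices; measure theory enters only when the lists exhaust the alphabet.
    Return times are known to be positive only if there are two vertices. The graph with one vertex
    is therefore treated apart: there (i) amounts to recurrence, and (ii) is trivial because a
    single vertex has no boundary. *)

Lemma seq_argmin (R : realDomainType) (V : eqType) (H : V -> R) (K : seq V) :
  K != [::] -> exists2 x, x \in K & forall y, y \in K -> H x <= H y.
Proof.
elim: K => [//|a [|b K] IH] _.
  by exists a; rewrite ?mem_head// => y; rewrite inE => /eqP->.
have [x xK xmin] := IH isT.
have [axle|xalt] := leP (H a) (H x).
  exists a; rewrite ?mem_head// => y; rewrite inE => /orP[/eqP->//|yK].
  exact: le_trans axle (xmin _ yK).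
exists x; first by rewrite inE xK orbT.
by move=> y; rewrite inE => /orP[/eqP->|/xmin//]; apply: ltW.
Qed.

Lemma sumr_const_seq_nat (R : pzSemiRingType) (I : Type) (s : seq I) (c : R) :
  \sum_(i <- s) c = (size s)%:R * c.
Proof. by rewrite big_const_seq iter_addr_0 count_predT mulr_natl. Qed.

Section SeqSums.
Context {R : realFieldType}.

(** Lagrange's identity: the deficit is half the sum of the squared 2 by 2 minors. *)
Lemma cauchy_schwarz_seq (I : Type) (s : seq I) (f g : I -> R) :
  (\sum_(i <- s) f i * g i) ^+ 2 <=
  (\sum_(i <- s) f i ^+ 2) * (\sum_(i <- s) g i ^+ 2).
Proof.
have E : \sum_(i <- s) \sum_(j <- s) (f i * g j - f j * g i) ^+ 2 =
    2 * ((\sum_(i <- s) f i ^+ 2) * (\sum_(i <- s) g i ^+ 2) -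
         (\sum_(i <- s) f i * g i) ^+ 2).
  rewrite expr2 !big_distrlr/=.
  transitivity (\sum_(i <- s) \sum_(j <- s) (f i ^+ 2 * g j ^+ 2) +
     \sum_(i <- s) \sum_(j <- s) (f j ^+ 2 * g i ^+ 2) -
     2 * \sum_(i <- s) \sum_(j <- s) (f i * g i * (f j * g j))).
    rewrite mulr_sumr -big_split -sumrB/=; apply: eq_bigr => i _.
    rewrite mulr_sumr -big_split -sumrB/=; apply: eq_bigr => j _.
    ring.
  rewrite [X in _ + X - _]exchange_big/=; ring.
have: 0 <= \sum_(i <- s) \sum_(j <- s) (f i * g j - f j * g i) ^+ 2.
  by do 2!apply: sumr_ge0 => ? _; rewrite sqr_ge0.
by rewrite E pmulr_rge0// subr_ge0.
Qed.

Lemma ler_sum_seq (V : eqType) (s : seq V) (f g : V -> R) :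
  (forall x, x \in s -> f x <= g x) -> \sum_(x <- s) f x <= \sum_(x <- s) g x.
Proof.
by move=> fg; rewrite big_seq [leRHS]big_seq; apply: ler_sum => x; apply: fg.
Qed.

Lemma ler_sum_subset (V : eqType) (s t : seq V) (f : V -> R) :
  uniq s -> {subset s <= t} -> (forall x, 0 <= f x) ->
  \sum_(x <- s) f x <= \sum_(x <- t) f x.
Proof.
elim: s t => [|a s IH] t /=; first by rewrite big_nil => _ _ f0; apply: sumr_ge0.
move=> /andP[as_ us] st f0; rewrite big_cons.
have at_ : a \in t by apply: st; rewrite mem_head.
rewrite (perm_big _ (perm_to_rem at_)) big_cons lerD2l; apply: IH => // x xs.
have := st x; rewrite inE xs orbT => /(_ isT).
rewrite (perm_mem (perm_to_rem at_)) inE => /orP[/eqP xa|//].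
by rewrite -xa xs in as_.
Qed.

End SeqSums.

(** For [A >= 0] this bounds the l2-norm of [f] by [A]. Testing on finite sets avoids infinite sums
    and square roots. *)
Definition l2_le (R : realFieldType) (V : eqType) (f : V -> R) (A : R) : Prop :=
  forall K : seq V, uniq K -> \sum_(g <- K) f g ^+ 2 <= A ^+ 2.

Section SquareSummable.
Context {R : realFieldType} {V : eqType}.
Implicit Types (f g : V -> R) (A B : R).

Lemma l2_le_mono f g A B : (forall x, 0 <= f x <= g x) -> 0 <= A <= B ->
  l2_le g A -> l2_le f B.
Proof.
move=> fg /andP[A0 AB] gA K uK; apply: le_trans (le_trans (gA K uK) _).
  apply: ler_sum => x _; have /andP[f0 fgx] := fg x.
  by rewrite ler_pXn2r ?nnegrE// (le_trans f0).
by rewrite ler_pXn2r ?nnegrE// (le_trans A0).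
Qed.

Lemma l2_leD f g A B : 0 <= A -> 0 <= B -> l2_le f A -> l2_le g B ->
  l2_le (fun x => f x + g x) (A + B).
Proof.
move=> A0 B0 fA gB K uK.
have fg : \sum_(x <- K) f x * g x <= A * B.
  rewrite leNgt; apply/negP => lt_AB.
  have := cauchy_schwarz_seq K f g; rewrite leNgt => /negP; apply.
  apply: (@le_lt_trans _ _ ((A * B) ^+ 2)).
    rewrite exprMn; apply: ler_pM; [| |exact: fA|exact: gB];
    by apply: sumr_ge0 => ? _; rewrite sqr_ge0.
  by rewrite ltr_pXn2r ?nnegrE ?mulr_ge0// ltW// (le_lt_trans _ lt_AB)// mulr_ge0.
have -> : \sum_(x <- K) (f x + g x) ^+ 2 = \sum_(x <- K) f x ^+ 2 +
    \sum_(x <- K) g x ^+ 2 + 2 * \sum_(x <- K) f x * g x.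
  by rewrite mulr_sumr -!big_split/=; apply: eq_bigr => x _; ring.
have := fA K uK; have := gB K uK; lra.
Qed.

Lemma l2_leZ f A c : l2_le f A -> l2_le (fun x => c * f x) (c * A).
Proof.
move=> fA K uK; rewrite exprMn; under eq_bigr do rewrite exprMn.
by rewrite -mulr_sumr ler_wpM2l ?sqr_ge0// fA.
Qed.

Lemma l2_le_sum (I : eqType) (s : seq I) (f : I -> V -> R) (A : I -> R) :
  (forall i, i \in s -> 0 <= A i) -> (forall i, i \in s -> l2_le (f i) (A i)) ->
  l2_le (fun x => \sum_(i <- s) f i x) (\sum_(i <- s) A i).
Proof.
elim: s => [|i s IH] A0 fA.
  by move=> K uK; rewrite big1 ?big_nil ?expr0n// => x _; rewrite big_nil expr0n.
move=> K uK; rewrite [in leRHS]big_cons.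
under [leLHS]eq_bigr do rewrite big_cons.
have sI j : j \in s -> j \in i :: s by rewrite inE orbC => ->.
apply: l2_leD => //.
- by apply: A0; rewrite mem_head.
- by rewrite big_seq; apply: sumr_ge0 => j js; apply/A0/sI.
- by apply: fA; rewrite mem_head.
- by apply: IH => j /sI; [apply: A0|apply: fA].
Qed.

Lemma l2_le_comp f A (k : V -> V) : injective k -> l2_le f A ->
  l2_le (f \o k) A.
Proof.
move=> kI fA K uK; have := fA (map k K); rewrite big_map; apply.
by rewrite map_inj_uniq.
Qed.

End SquareSummable.

(** * Coarea and the Cheeger inequality for a weighted family of permutations *)

Section ExpansionGap.
Context {R : realFieldType} {V I : eqType}.
Variables (F : seq I) (k : I -> V -> V) (delta : R).
Hypothesis k_inj : forall u, injective (k u).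

(** One member of [F] must keep the vertex in [K] and another must move it out: only then is the
    vertex seen by a difference [H (k u g) - H (k u' g)]. Leaving alone is not enough, since a
    single permutation may move [K] off itself without contracting anything. *)
Definition split_vertices (K : seq V) : seq V :=
  [seq g <- K | has (fun u => k u g \in K) F && has (fun u => k u g \notin K) F].

Hypothesis expansion : forall K, uniq K ->
  delta * (size K)%:R <= (size (split_vertices K))%:R.

Lemma sum_indicator_split (K W : seq V) : uniq K -> {subset K <= W} ->
  (size (split_vertices K))%:R <=
  \sum_(u <- F) \sum_(u' <- F) \sum_(g <- W)
    `|(k u g \in K)%:R - (k u' g \in K)%:R| :> R.
Proof.
move=> uK KW; under eq_bigr do rewrite exchange_big.
rewrite exchange_big/= -sum1_size natr_sum.
apply: (@le_trans _ _ (\sum_(g <- split_vertices K) \sum_(u <- F) \sum_(u' <- F)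
    `|(k u g \in K)%:R - (k u' g \in K)%:R|)).
  apply: ler_sum_seq => g; rewrite mem_filter => /andP[/andP[]].
  move=> /hasP[u uF ugK] /hasP[u' u'F u'gK] _.
  rewrite (perm_big _ (perm_to_rem uF)) big_cons/=.
  rewrite (perm_big _ (perm_to_rem u'F)) big_cons/= ugK (negbTE u'gK).
  rewrite subr0 normr1 -addrA lerDl addr_ge0// sumr_ge0// => *.
  exact: sumr_ge0.
apply: ler_sum_subset; first by rewrite filter_uniq.
  by move=> x; rewrite mem_filter => /andP[_ /KW].
by move=> x; apply: sumr_ge0 => ? _; apply: sumr_ge0.
Qed.

(* Coarea inequality: peel off the lowest level set [t * 1_K] of [H], along
   which the differences [|H a - H b|] are exactly additive. *)
Lemma coarea (H : V -> R) (K W : seq V) : uniq K -> {subset K <= W} ->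
  (forall g, 0 <= H g) -> (forall g, g \notin K -> H g = 0) ->
  delta * \sum_(g <- K) H g <=
  \sum_(u <- F) \sum_(u' <- F) \sum_(g <- W) `|H (k u g) - H (k u' g)|.
Proof.
have [n] := ubnP (size K); elim: n K H => // n IH K H.
rewrite ltnS => sK uK KW H0 HK.
have [->|K0] := eqVneq K [::].
  rewrite big_nil mulr0; do 2!apply: sumr_ge0 => ? _; exact: sumr_ge0.
have [x0 x0K x0min] := seq_argmin H K0.
pose t := H x0; pose H' g := H g - t * (g \in K)%:R.
have H'0 g : 0 <= H' g.
  rewrite /H'; have [gK|gK] := boolP (g \in K).
    by rewrite mulr1 subr_ge0 x0min.
  by rewrite mulr0 subr0.
have HE a b : `|H a - H b| = t * `|(a \in K)%:R - (b \in K)%:R| + `|H' a - H' b|.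
  have t0 : 0 <= t by exact: H0.
  rewrite /H'; have [aK|aK] := boolP (a \in K); have [bK|bK] := boolP (b \in K) => /=.
  - by rewrite subrr normr0 mulr0 add0r; congr `|_|; ring.
  - have := x0min a aK; rewrite -/t => ta; rewrite (HK b)//.
    by rewrite !subr0 mulr0 normr1 !mulr1 subr0 !ger0_norm; lra.
  - have := x0min b bK; rewrite -/t => tb; rewrite distrC.
    rewrite [X in _ = _ * X + _]distrC [X in _ = _ + X]distrC (HK a)//.
    by rewrite !subr0 mulr0 normr1 !mulr1 subr0 !ger0_norm; lra.
  - by rewrite !mulr0 !subr0 normr0 mulr0 add0r.
have -> : \sum_(u <- F) \sum_(u' <- F) \sum_(g <- W) `|H (k u g) - H (k u' g)| =
   t * (\sum_(u <- F) \sum_(u' <- F) \sum_(g <- W)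
    `|(k u g \in K)%:R - (k u' g \in K)%:R|) +
   \sum_(u <- F) \sum_(u' <- F) \sum_(g <- W) `|H' (k u g) - H' (k u' g)|.
  rewrite mulr_sumr -big_split; apply: eq_bigr => u _.
  rewrite mulr_sumr -big_split; apply: eq_bigr => u' _.
  by rewrite mulr_sumr -big_split; apply: eq_bigr => g _; rewrite HE.
have sub g : g \in rem x0 K -> g \in K by exact: mem_rem.
have HS : \sum_(g <- K) H g = t * (size K)%:R + \sum_(g <- rem x0 K) H' g.
  have -> : \sum_(g <- rem x0 K) H' g = \sum_(g <- K) H' g.
    rewrite [RHS](perm_big _ (perm_to_rem x0K)) big_cons/=.
    by rewrite /H' x0K mulr1 subrr add0r.
  rewrite sumrB -mulr_sumr addrC -addrA [X in _ + (- (t * X) + _)](_ : _ = (size K)%:R).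
    by rewrite addrC; ring.
  by rewrite -sum1_size natr_sum; apply: eq_big_seq => g ->.
rewrite HS mulrDr; apply: lerD; last first.
  apply: IH => //.
  - by rewrite size_rem// prednK// lt0n size_eq0.
  - exact: rem_uniq.
  - by move=> g /sub/KW.
  - move=> g; rewrite mem_rem_uniq// inE negb_and negbK => /orP[/eqP->|gK].
      by rewrite /H' x0K mulr1 subrr.
    by rewrite /H' HK// (negbTE gK) mulr0 subrr.
rewrite mulrCA; apply: ler_wpM2l; first exact: H0.
exact: le_trans (expansion uK) (sum_indicator_split uK KW).
Qed.

Variables (w : I -> R) (wmin : R).
Hypotheses (wmin_gt0 : 0 < wmin) (w_ge : forall u, u \in F -> wmin <= w u).
Hypotheses (F_neq0 : F != [::]) (delta_gt0 : 0 < delta) (delta_le1 : delta <= 1).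

Let q : R := (size F)%:R.
Let M := \sum_(u <- F) w u.
(** The loss in the squared norm: half of [wmin ^+ 2] from [variance_identity], times
    [delta ^+ 2 / (4 * q ^+ 2)] from [sum_sq_diff_ge]. *)
Let t := wmin ^+ 2 * delta ^+ 2 / (8 * q ^+ 2).

Let q_ge1 : 1 <= q.
Proof. by rewrite /q ler1n lt0n size_eq0. Qed.

Let M_ge : wmin <= M.
Proof.
rewrite /M; case: F F_neq0 w_ge => [//|u s] _ wge.
rewrite big_cons ler_wpDr ?wge ?mem_head// big_seq sumr_ge0// => i iS.
by rewrite ltW// (lt_le_trans wmin_gt0)// wge// inE iS orbT.
Qed.

Let M_gt0 : 0 < M. Proof. exact: lt_le_trans M_ge. Qed.

Let t_gt0 : 0 < t.
Proof. by rewrite divr_gt0 ?mulr_gt0 ?exprn_gt0// (lt_le_trans _ q_ge1). Qed.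

Let t_le : t <= M ^+ 2.
Proof.
have d2 : delta ^+ 2 <= 1 by rewrite expr_le1// ltW.
have q2 : 1 <= q ^+ 2 by rewrite -(expr1n _ 2) ler_pXn2r ?nnegrE// ltW// (lt_le_trans _ q_ge1).
have m2 : wmin ^+ 2 <= M ^+ 2 by rewrite ler_pXn2r ?nnegrE// ltW.
have w0 : 0 < wmin ^+ 2 by rewrite exprn_gt0.
rewrite /t ler_pdivrMr; last by nra.
nra.
Qed.

(** The defect in Jensen's inequality is written as a sum over pairs, the form that the coarea
    inequality bounds from below. *)
Lemma variance_identity (x : I -> R) :
  (\sum_(u <- F) w u * x u) ^+ 2 = M * \sum_(u <- F) w u * x u ^+ 2 -
  2^-1 * \sum_(u <- F) \sum_(u' <- F) w u * w u' * (x u - x u') ^+ 2.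
Proof.
have -> : \sum_(u <- F) \sum_(u' <- F) w u * w u' * (x u - x u') ^+ 2 =
   \sum_(u <- F) \sum_(u' <- F) (w u * x u ^+ 2) * w u' +
   \sum_(u <- F) \sum_(u' <- F) w u * (w u' * x u' ^+ 2) -
   2 * \sum_(u <- F) \sum_(u' <- F) (w u * x u) * (w u' * x u').
  rewrite mulr_sumr -big_split -sumrB/=; apply: eq_bigr => u _.
  rewrite mulr_sumr -big_split -sumrB/=; apply: eq_bigr => u' _.
  ring.
rewrite -!big_distrlr/= -/M.
by field.
Qed.

Lemma sum_comp_sq_le (G : V -> R) (S2 : R) (u : I) (W : seq V) : uniq W ->
  (forall K, uniq K -> \sum_(g <- K) G g ^+ 2 <= S2) ->
  \sum_(g <- W) G (k u g) ^+ 2 <= S2.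
Proof.
move=> uW GS; have := GS (map (k u) W); rewrite big_map; apply.
by rewrite map_inj_uniq//; exact: k_inj.
Qed.

(** Cheeger's argument: apply [coarea] to the square of [G], factor [a ^+ 2 - b ^+ 2] as
    [(a - b) * (a + b)] and use Cauchy-Schwarz. The sum of the [(a + b) ^+ 2] is at most
    [4 * q ^+ 2] times the squared norm because each [k u] is injective. *)
Lemma sum_sq_diff_ge (G : V -> R) (K W : seq V) : uniq K -> uniq W ->
  {subset K <= W} ->
  (forall g, 0 <= G g) -> (forall g, g \notin K -> G g = 0) ->
  delta ^+ 2 * (\sum_(g <- K) G g ^+ 2) <= 4 * q ^+ 2 *
   \sum_(u <- F) \sum_(u' <- F) \sum_(g <- W) (G (k u g) - G (k u' g)) ^+ 2.
Proof.
move=> uK uW KW G0 GK; set S2 := \sum_(g <- K) _; set Df := (X in _ <= _ * X).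
have S20 : 0 <= S2 by apply: sumr_ge0 => ? _; rewrite sqr_ge0.
have Df0 : 0 <= Df by do 3!apply: sumr_ge0 => ? _; rewrite sqr_ge0.
have GS K' : uniq K' -> \sum_(g <- K') G g ^+ 2 <= S2.
  move=> uK'; rewrite (bigID (mem K))/= [X in _ + X]big1 ?addr0.
    rewrite -big_filter; apply: ler_sum_subset; first exact: filter_uniq.
      by move=> x; rewrite mem_filter => /andP[].
    by move=> x; rewrite sqr_ge0.
  by move=> g gK; rewrite GK ?expr0n.
have CA := @coarea (fun g => G g ^+ 2) K W uK KW (fun g => sqr_ge0 _) _.
have {}CA := CA (fun g gK => etrans (congr1 (fun x => x ^+ 2) (GK g gK)) (expr0n _ _)).
rewrite -/S2 in CA.
(* The triple sum is flattened so that Cauchy-Schwarz is applied once, over all triples. *)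
pose X3 := [seq (p, g) | p <- [seq (u, u') | u <- F, u' <- F], g <- W].
have X3E (f : I -> I -> V -> R) : \sum_(u <- F) \sum_(u' <- F) \sum_(g <- W) f u u' g =
   \sum_(p <- X3) f p.1.1 p.1.2 p.2.
  by rewrite big_allpairs big_allpairs.
have CS := cauchy_schwarz_seq X3
   (fun p => `|G (k p.1.1 p.2) - G (k p.1.2 p.2)|)
   (fun p => (G (k p.1.1 p.2) + G (k p.1.2 p.2))).
rewrite -(X3E (fun u u' g => `|G (k u g) - G (k u' g)| * (G (k u g) + G (k u' g)))) in CS.
rewrite -(X3E (fun u u' g => `|G (k u g) - G (k u' g)| ^+ 2)) in CS.
rewrite -(X3E (fun u u' g => (G (k u g) + G (k u' g)) ^+ 2)) in CS.
rewrite [X in X ^+ 2 <= _](_ : _ = \sum_(u <- F) \sum_(u' <- F) \sum_(g <- W)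
    `|G (k u g) ^+ 2 - G (k u' g) ^+ 2|) in CS; last first.
  do 3!apply: eq_bigr => ? _.
  rewrite subr_sqr normrM; congr (_ * _).
  by rewrite ger0_norm// addr_ge0.
rewrite [X in _ <= X * _](_ : _ = Df) in CS; last first.
  by do 3!apply: eq_bigr => ? _; rewrite real_normK// num_real.
have SP : \sum_(u <- F) \sum_(u' <- F) \sum_(g <- W) (G (k u g) + G (k u' g)) ^+ 2
   <= 4 * q ^+ 2 * S2.
  apply: (@le_trans _ _ (\sum_(u <- F) \sum_(u' <- F) (4 * S2))).
    apply: ler_sum => u _; apply: ler_sum => u' _.
    apply: (@le_trans _ _ (\sum_(g <- W) (2 * G (k u g) ^+ 2 + 2 * G (k u' g) ^+ 2))).
      apply: ler_sum => g _; have := sqr_ge0 (G (k u g) - G (k u' g)).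
      rewrite sqrrB sqrrD; lra.
    rewrite big_split/= -!mulr_sumr.
    have := sum_comp_sq_le u uW GS; have := sum_comp_sq_le u' uW GS; lra.
  rewrite !sumr_const_seq_nat -/q.
  by rewrite (_ : q * _ = 4 * q ^+ 2 * S2)//; ring.
have {SP}CS := le_trans CS (ler_wpM2l Df0 SP).
have d0 : 0 <= delta * S2 by rewrite mulr_ge0// ltW.
have CA2 : (delta * S2) ^+ 2 <= (4 * q ^+ 2 * Df) * S2.
  apply: le_trans (le_trans CS _).
    by rewrite ler_pXn2r ?nnegrE// (le_trans d0).
  by rewrite (_ : Df * _ = 4 * q ^+ 2 * Df * S2)//; ring.
have [S2e|S2n] := eqVneq S2 0.
  by rewrite S2e mulr0 mulr_ge0// mulr_ge0// sqr_ge0.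
have S2p : 0 < S2 by rewrite lt_def S2n.
by rewrite -(ler_pM2r S2p); apply: le_trans CA2; rewrite exprMn; lra.
Qed.

Lemma expansion_gap : exists2 c : R, 0 < c <= M &
  forall (G : V -> R) (A : R), (forall g, 0 <= G g) -> 0 <= A -> l2_le G A ->
    l2_le (fun g => \sum_(u <- F) w u * G (k u g)) ((M - c) * A).
Proof.
(* Since [(M - t / (2 * M)) ^+ 2 >= M ^+ 2 - t], a loss [t] in the square gives this loss in the
   norm. *)
exists (t / (2 * M)).
  apply/andP; split; first by rewrite divr_gt0// mulr_gt0.
  have M20 : 0 < 2 * M by rewrite mulr_gt0.
  rewrite (ler_pdivrMr _ _ M20).
  have := sqr_ge0 M; have := t_le; nra.
move=> G A G0 A0 GA K uK.
(* The coarea inequality needs finite support. On the test set [K] only the values of [G] on the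
   images [K'] of [K] matter, so [G] is cut off outside [K']. *)
pose K' := undup (flatten [seq [seq k u g | g <- K] | u <- F]).
pose W := undup (K ++ K').
pose G' g := if g \in K' then G g else 0.
have uK' : uniq K' by exact: undup_uniq.
have uW : uniq W by exact: undup_uniq.
have KW : {subset K <= W} by move=> g gK; rewrite mem_undup mem_cat gK.
have K'W : {subset K' <= W} by move=> g gK; rewrite mem_undup mem_cat gK orbT.
have G'0 g : 0 <= G' g by rewrite /G'; case: ifP.
have G'K g : g \notin K' -> G' g = 0 by rewrite /G' => /negbTE->.
set S2 := \sum_(g <- K') G' g ^+ 2.
have S2A : S2 <= A ^+ 2.
  rewrite /S2 big_seq; apply: le_trans (GA K' uK').
  by rewrite [leRHS]big_seq; apply: ler_sum => g gK; rewrite /G' gK.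
have GS X : uniq X -> \sum_(g <- X) G' g ^+ 2 <= S2.
  move=> uX; rewrite (bigID (mem K'))/= [X in _ + X]big1 ?addr0.
    rewrite -big_filter; apply: ler_sum_subset; first exact: filter_uniq.
      by move=> x; rewrite mem_filter => /andP[].
    by move=> x; rewrite sqr_ge0.
  by move=> g gK; rewrite G'K ?expr0n.
have := sum_sq_diff_ge uK' uW K'W G'0 G'K; rewrite -/S2.
set Df := (X in _ <= _ * X) => DfS.
apply: (@le_trans _ _ (\sum_(g <- W) (\sum_(u <- F) w u * G' (k u g)) ^+ 2)).
  apply: le_trans (@ler_sum_subset _ _ K W
     (fun g => (\sum_(u <- F) w u * G' (k u g)) ^+ 2) uK KW _); last first.
    by move=> x; rewrite sqr_ge0.
  apply: ler_sum_seq => g gK; rewrite le_eqVlt; apply/orP; left; apply/eqP.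
  congr (_ ^+ 2); rewrite big_seq [RHS]big_seq; apply: eq_bigr => u uF.
  congr (_ * _); rewrite /G' ifT// mem_undup; apply/flattenP.
  by exists [seq k u g | g <- K]; apply: map_f.
have wE u : u \in F -> 0 <= w u by move=> /w_ge/(lt_le_trans wmin_gt0)/ltW.
apply: (@le_trans _ _ ((M ^+ 2 - t) * S2)); last first.
  rewrite exprMn; apply: ler_pM => //.
  - by rewrite subr_ge0 t_le.
  - by apply: sumr_ge0 => ? _; rewrite sqr_ge0.
  - rewrite (_ : (M - t / (2 * M)) ^+ 2 = M ^+ 2 - t + (t / (2 * M)) ^+ 2).
      by rewrite lerDl sqr_ge0.
    by field; rewrite ?gt_eqF.
under eq_bigr do rewrite variance_identity.
rewrite sumrB -!mulr_sumr mulrBl lerB//.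
  rewrite expr2 -mulrA (ler_wpM2l (ltW M_gt0))// exchange_big/= /M mulr_suml.
  apply: ler_sum_seq => u uF; rewrite -mulr_sumr ler_wpM2l ?wE//.
  exact: sum_comp_sq_le.
apply: (@le_trans _ _ (2^-1 * (wmin ^+ 2 * Df))).
  have q0 : 0 < q by exact: lt_le_trans q_ge1.
  have -> : t * S2 = 2^-1 * (wmin ^+ 2 * ((delta ^+ 2 * S2) / (4 * q ^+ 2))).
    by rewrite /t; field; rewrite gt_eqF.
  have q4 : 0 < 4 * q ^+ 2 by rewrite mulr_gt0// exprn_gt0.
  apply: ler_wpM2l; first by rewrite invr_ge0.
  apply: ler_wpM2l; first by rewrite sqr_ge0.
  rewrite (ler_pdivrMr _ _ q4).
  by rewrite [leRHS]mulrC.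
apply: ler_wpM2l; first by rewrite invr_ge0.
rewrite /Df mulr_sumr exchange_big/=; apply: ler_sum_seq => u uF.
rewrite mulr_sumr exchange_big/=; apply: ler_sum_seq => u' u'F.
rewrite mulr_sumr; apply: ler_sum => g _.
rewrite ler_wpM2r ?sqr_ge0// expr2.
by apply: ler_pM; rewrite ?w_ge// ltW.
Qed.

End ExpansionGap.

(** * Quasi-Bernoulli weights on words *)

Section WordsOverList.
Context {B : eqType}.
Implicit Types (L : seq B) (n : nat) (z : seq B).

Fixpoint words_over L n : seq (seq B) :=
  if n is n'.+1 then [seq b :: z | b <- L, z <- words_over L n'] else [:: [::]].

Lemma mem_words_over L n z :
  (z \in words_over L n) = (size z == n) && all (mem L) z.
Proof.
elim: n z => [|n IH] [|b z] //=.
  by apply/negbTE/negP => /allpairsP[p []].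
rewrite eqSS; apply/allpairsP/idP => [[[b' z']/= [b'L]]|/and3P[sz bL zL]].
  by rewrite IH => /andP[sz zL] [-> ->]; rewrite sz b'L.
by exists (b, z); rewrite /= IH sz.
Qed.

Lemma words_over_uniq L n : uniq L -> uniq (words_over L n).
Proof.
move=> uL; elim: n => // n IH /=; apply: allpairs_uniq => //.
by move=> [b z] [b' z'] _ _ /= [-> ->].
Qed.

Lemma words_over_subset L L' n : {subset L <= L'} ->
  {subset words_over L n <= words_over L' n}.
Proof.
move=> LL z; rewrite !mem_words_over => /andP[-> /allP zL] /=.
by apply/allP => b /zL; apply: LL.
Qed.

Lemma sum_words_overS (R : nmodType) L n (f : seq B -> R) :
  \sum_(z <- words_over L n.+1) f z =
  \sum_(b <- L) \sum_(z <- words_over L n) f (b :: z).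
Proof. by rewrite /= big_allpairs_dep. Qed.

Lemma sum_words_overD (R : nmodType) L n n' (f : seq B -> R) :
  \sum_(z <- words_over L (n + n')) f z =
  \sum_(u <- words_over L n) \sum_(v <- words_over L n') f (u ++ v).
Proof.
elim: n f => [|n IH] f; first by rewrite big_seq1.
by rewrite addSn !sum_words_overS; apply: eq_bigr => b _; rewrite IH.
Qed.

Definition word_map (V : Type) (k : B -> V -> V) z (g : V) : V :=
  foldl (fun h b => k b h) g z.

Lemma word_map_cat V (k : B -> V -> V) u v g :
  word_map k (u ++ v) g = word_map k v (word_map k u g).
Proof. exact: foldl_cat. Qed.

Lemma word_map_inj V (k : B -> V -> V) u :
  (forall b, injective (k b)) -> injective (word_map k u).
Proof. by move=> kI; elim: u => [|b u IH] //= x y /IH/kI. Qed.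

Definition word_time (e : B -> nat) z : nat := sumn (map e z).

Lemma word_time_cat e u v : word_time e (u ++ v) = (word_time e u + word_time e v)%N.
Proof. by rewrite /word_time map_cat sumn_cat. Qed.

End WordsOverList.

Lemma sum_mem_subset (R : pzSemiRingType) (I : eqType) (s t : seq I) (f : I -> R) :
  uniq s -> uniq t -> {subset s <= t} ->
  \sum_(x <- t) (x \in s)%:R * f x = \sum_(x <- s) f x.
Proof.
move=> us ut st; rewrite (bigID (mem s))/= [X in _ + X]big1 ?addr0; last first.
  by move=> x /negbTE->; rewrite mul0r.
rewrite -big_filter (perm_big s); last first.
  apply: uniq_perm => //; first exact: filter_uniq.
  by move=> x; rewrite mem_filter; apply/andP/idP => [[]//|xs]; split=> //; apply: st.
by apply: eq_big_seq => x ->; rewrite mul1r.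
Qed.

(** A crude bound linear in [x] suffices: the exponent is fixed before [x] is chosen. *)
Lemma exprD1_le (R : realFieldType) (x : R) n : 0 <= x <= 1 ->
  (1 + x) ^+ n <= 1 + 3 ^+ n * x.
Proof.
move=> /andP[x0 x1]; elim: n => [|n IH]; first by rewrite !expr0; lra.
rewrite !exprS; apply: le_trans (ler_wpM2l _ IH) _; first lra.
have : 1 <= 3 ^+ n :> R by apply: exprn_ege1; lra.
set t := 3 ^+ n => t1.
have xt : x <= t * x by rewrite ler_peMl.
have txx : t * x * x <= t * x by rewrite ler_piMr// mulr_ge0//; lra.
by rewrite mulrDl mul1r mulrDr mulr1; lra.
Qed.

Section QuasiBernoulli.
Context {R : realFieldType} {B V : eqType}.
Variables (k : B -> V -> V) (e : B -> nat) (m : seq B -> R) (Dk : nat -> R).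
Hypotheses (k_inj : forall b, injective (k b)) (m_gt0 : forall w, 0 < m w).
Hypotheses (m_nil : m [::] = 1) (Dk0_ge1 : 1 <= Dk 0).
Hypothesis Dk_gt0 : forall i, 0 < Dk i.
Hypothesis m_sum : forall L w, uniq L -> \sum_(b <- L) m (rcons w b) <= m w.
Hypothesis m_quasi : forall a v b,
  m (a ++ v ++ b) * m v <= Dk (size v) * (m (a ++ v) * m (v ++ b)).
(** The reverse bound is used with an empty middle word only: it gives the law of a block a fixed
    proportion of [m], for which a constant far from 1 is good enough. *)
Hypothesis m_quasi' : forall a b, m a * m b <= Dk 0 * m (a ++ b).

Local Notation D := (Dk 0).

Lemma m_cat_le a b : m (a ++ b) <= D * (m a * m b).
Proof. by have := m_quasi a [::] b; rewrite /= m_nil mulr1 cats0. Qed.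

Lemma sum_words_le L n w : uniq L ->
  \sum_(z <- words_over L n) m (w ++ z) <= m w.
Proof.
move=> uL; elim: n w => [|n IH] w; first by rewrite big_seq1 cats0.
rewrite sum_words_overS; apply: le_trans (m_sum w uL); apply: ler_sum => b _.
by under eq_bigr do rewrite -cat_rcons; apply: IH.
Qed.

(** * Time weights and contraction along blocks *)

Section Moments.
Variables (L : seq B) (s eps : R).
Hypotheses (uL : uniq L) (s_ge1 : 1 <= s) (eps_ge0 : 0 <= eps).
Hypothesis tail : \sum_(b <- L) m [:: b] * (s ^+ e b - 1) <= eps.

Let s_pow n : 1 <= s ^+ n. Proof. exact: exprn_ege1. Qed.

Let D_ge0 : 0 <= D. Proof. exact: ltW. Qed.

(** In [s ^+ e b = 1 + (s ^+ e b - 1)] only the second summand pays the constant [D]. The factor per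
    letter thus tends to 1 with [eps]. *)
Lemma word_moment_le n w :
  \sum_(z <- words_over L n) m (w ++ z) * s ^+ word_time e z <=
  m w * (1 + D * eps) ^+ n.
Proof.
elim: n w => [|n IH] w; first by rewrite big_seq1 cats0.
rewrite sum_words_overS.
apply: (@le_trans _ _ (\sum_(b <- L) m (rcons w b) * s ^+ e b * (1 + D * eps) ^+ n)).
  apply: ler_sum => b _; rewrite mulrAC.
  under eq_bigr do rewrite -cat_rcons [word_time _ _]/= exprD mulrCA mulrC.
  rewrite -mulr_suml.
  by rewrite ler_wpM2r// (le_trans ler01)//.
rewrite -mulr_suml exprS mulrA ler_wpM2r//.
  by rewrite exprn_ge0// addr_ge0// mulr_ge0.
under eq_bigr do rewrite -[s ^+ _](subrK 1) mulrDr mulr1.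
rewrite big_split/= addrC mulrDr mulr1 lerD ?m_sum//.
rewrite mulrCA.
apply: (@le_trans _ _ (D * (m w * \sum_(b <- L) m [:: b] * (s ^+ e b - 1)))).
  rewrite !mulr_sumr; apply: ler_sum => b _.
  rewrite 2!mulrA ler_wpM2r ?subr_ge0// -cats1.
  by rewrite -mulrA; apply: m_cat_le.
by rewrite ler_wpM2l// ler_wpM2l// ltW.
Qed.

Variable h : V.

(** The past [w] is carried along because [m] is not multiplicative; all bounds are relative to
    [m w] and uniform in [w]. *)
Definition weighted_return n w (g : V) : R :=
  \sum_(z <- words_over L n)
    m (w ++ z) * s ^+ word_time e z * (word_map k z g == h)%:R.

Lemma weighted_return_ge0 n w g : 0 <= weighted_return n w g.
Proof.
apply: sumr_ge0 => z _; rewrite mulr_ge0// mulr_ge0 1?ltW//.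
exact: lt_le_trans (s_pow _).
Qed.

(** For a single [z] the indicator of [word_map z g = h] has norm at most 1, by injectivity; the
    triangle inequality then leaves the moment. This bound is used for words shorter than one
    block. *)
Lemma weighted_return_base n w :
  l2_le (weighted_return n w) ((1 + D * eps) ^+ n * m w).
Proof.
have c0 z : 0 <= m (w ++ z) * s ^+ word_time e z.
  by rewrite mulr_ge0 1?ltW// (lt_le_trans _ (s_pow _)).
have : l2_le (weighted_return n w)
    (\sum_(z <- words_over L n) m (w ++ z) * s ^+ word_time e z * 1).
  apply: l2_le_sum => z _; first by rewrite mulr1.
  apply: l2_leZ => K uK; rewrite expr1n.
  rewrite (eq_bigr (fun g => (word_map k z g == h)%:R)); last first.
    by move=> g _; case: eqP; rewrite ?expr1n ?expr0n.
  rewrite -natr_sum lern1.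
  rewrite (_ : (\sum_(g <- K) _)%N = count (fun g => word_map k z g == h) K);
    last first.
    by rewrite -sum1_count [RHS]big_mkcond; apply: eq_bigr => g _; case: (_ == _).
  have -> : count (fun g => word_map k z g == h) K = count_mem h (map (word_map k z) K).
    by rewrite count_map.
  rewrite count_uniq_mem ?leq_b1// map_inj_uniq//.
  exact: word_map_inj.
apply: l2_le_mono => [g|].
  rewrite weighted_return_ge0/= le_eqVlt; apply/orP; left; apply/eqP.
  by rewrite /weighted_return.
apply/andP; split; first by apply: sumr_ge0 => z _; rewrite mulr1.
by rewrite mulrC; under eq_bigr do rewrite mulr1; apply: word_moment_le.
Qed.

Section Step.
Variables (L0 : seq B) (N l : nat) (c : R).
Let M := \sum_(u <- words_over L0 N) m u.
Hypotheses (uL0 : uniq L0) (sub0 : {subset L0 <= L}) (c_gt0 : 0 < c) (c_le : c <= M).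
Hypothesis gap : forall (G : V -> R) (A : R), (forall g, 0 <= G g) -> 0 <= A ->
  l2_le G A ->
  l2_le (fun g => \sum_(u <- words_over L0 N) m u * G (word_map k u g)) ((M - c) * A).
Hypothesis half : 2^-1 <= \sum_(v <- words_over L l) m v.
Hypothesis small : Dk l * ((1 + D * eps) ^+ (N + l) - c / (2 * D ^+ 2)) <= 1.

Let D_gt0 : 0 < D. Proof. exact: lt_le_trans Dk0_ge1. Qed.

(** Quasi-independence gives [m (w ++ u ++ v) >= a * m u] with [a = m w * m v / D ^+ 2]. Removing
    this multiple of the contracting family leaves nonnegative weights [b u], to which the triangle
    inequality is applied. *)
Lemma block_gap (w v : seq B) (X := \sum_(u <- words_over L N)
      m (w ++ u ++ v) * s ^+ word_time e u - m w * m v * c / D ^+ 2) :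
  0 <= X /\ forall (G : V -> R) (A : R),
  (forall g, 0 <= G g) -> 0 <= A -> l2_le G A ->
  l2_le (fun g => \sum_(u <- words_over L N)
           m (w ++ u ++ v) * s ^+ word_time e u * G (word_map k u g)) (X * A).
Proof.
rewrite {}/X; set F := words_over L0 N; set F' := words_over L N.
have uF : uniq F by exact: words_over_uniq.
have uF' : uniq F' by exact: words_over_uniq.
have FF' : {subset F <= F'} by exact: words_over_subset.
pose a := m w * m v / D ^+ 2.
have a_ge0 : 0 <= a by rewrite divr_ge0 ?sqr_ge0// mulr_ge0// ltW.
have m_ge u : a * m u <= m (w ++ u ++ v) * s ^+ word_time e u.
  apply: (@le_trans _ _ (m (w ++ u ++ v))); last by rewrite ler_peMr// ltW.
  rewrite /a mulrAC ler_pdivrMr ?exprn_gt0//.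
  have h1 := m_quasi' w (u ++ v); have h2 := m_quasi' u v.
  apply: (@le_trans _ _ (m w * (D * m (u ++ v)))).
    by rewrite -mulrA ler_wpM2l ?(ltW (m_gt0 _))// mulrC.
  by rewrite mulrCA [leRHS]mulrC expr2 -mulrA ler_wpM2l// ltW.
pose b u := m (w ++ u ++ v) * s ^+ word_time e u - (u \in F)%:R * (a * m u).
have b0 u : 0 <= b u.
  rewrite /b; case: (u \in F); rewrite ?mul1r ?mul0r subr_ge0//.
  by apply: le_trans (m_ge u); rewrite mulr_ge0// ltW.
have XE : \sum_(u <- F') m (w ++ u ++ v) * s ^+ word_time e u -
   m w * m v * c / D ^+ 2 = \sum_(u <- F') b u + a * (M - c).
  rewrite /b sumrB (sum_mem_subset _ uF uF' FF') -mulr_sumr -/M /a.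
  by field; rewrite gt_eqF.
split=> [|G A G0 A0 GA].
  by rewrite XE addr_ge0 ?sumr_ge0// mulr_ge0// subr_ge0.
have := @l2_leD _ _ (fun g => \sum_(u <- F') b u * G (word_map k u g))
   (fun g => a * \sum_(u <- F) m u * G (word_map k u g))
   (\sum_(u <- F') b u * A) (a * ((M - c) * A)).
have Ma0 : 0 <= (M - c) * A by rewrite mulr_ge0// subr_ge0.
move=> /(_ _ _ _ _)H.
have {H} := H (sumr_ge0 _ (fun u _ => mulr_ge0 (b0 u) A0)) (mulr_ge0 a_ge0 Ma0).
have H1 : l2_le (fun g => \sum_(u <- F') b u * G (word_map k u g)) (\sum_(u <- F') b u * A).
  apply: l2_le_sum => u _; first by rewrite mulr_ge0.
  apply: l2_leZ; apply: (@l2_le_comp _ _ G A (word_map k u)) => //.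
  exact: word_map_inj.
move=> /(_ H1 (l2_leZ (a) (gap G0 A0 GA))) H2.
have {H2} : l2_le (fun g => \sum_(u <- F')
           m (w ++ u ++ v) * s ^+ word_time e u * G (word_map k u g))
   (\sum_(u <- F') b u * A + a * ((M - c) * A)).
  move=> K uK; apply: le_trans (H2 K uK); apply: ler_sum => g _.
  rewrite le_eqVlt; apply/orP; left; apply/eqP; congr (_ ^+ 2).
  rewrite mulr_sumr -(sum_mem_subset _ uF uF' FF') -big_split/=.
  by apply: eq_bigr => u _; rewrite /b; ring.
by rewrite XE (mulrDl _ (a * _)) mulr_suml mulrA.
Qed.

(* Cut a word into [u v z] with [|u| = N] and [|v| = l].  Up to the factor [Dk l]
   the weight of [z] depends on [v] only, so that the sum over [u] is the
   contraction of [block_gap] applied to a vector depending on [v] only. *)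
Lemma weighted_return_step n (A : R) : 0 <= A ->
  (forall w, l2_le (weighted_return n w) (A * m w)) ->
  forall w, l2_le (weighted_return (N + l + n) w) (A * m w).
Proof.
move=> A0 IH w.
set F := words_over L N; set F' := words_over L l.
pose G v g := weighted_return n v (word_map k v g).
pose f v g := Dk l * s ^+ word_time e v / m v * \sum_(u <- F)
  m (w ++ u ++ v) * s ^+ word_time e u * G v (word_map k u g).
pose cf v := Dk l * s ^+ word_time e v / m v * ((\sum_(u <- F) m (w ++ u ++ v) * s ^+ word_time e u
      - m w * m v * c / D ^+ 2) * (A * m v)).
have le_f g : weighted_return (N + l + n) w g <= \sum_(v <- F') f v g.
  rewrite /weighted_return sum_words_overD sum_words_overD exchange_big/=.
  apply: ler_sum_seq => v; rewrite mem_words_over => /andP[/eqP sv _].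
  rewrite /f mulr_sumr; apply: ler_sum => u _.
  rewrite /G /weighted_return !mulr_sumr; apply: ler_sum => z _.
  rewrite !word_map_cat !mulrA; apply: ler_wpM2r; first by [].
  rewrite !word_time_cat !exprD.
  have := m_quasi (w ++ u) v z; rewrite sv -!catA => qz.
  have s0 i : 0 <= s ^+ i := le_trans ler01 (s_pow i).
  rewrite [leLHS](_ : _ = m (w ++ u ++ v ++ z) * m v / m v *
     (s ^+ word_time e u * s ^+ word_time e v * s ^+ word_time e z)); last first.
    by rewrite mulfK ?gt_eqF// -!catA !mulrA.
  rewrite [leRHS](_ : _ = Dk l * (m (w ++ u ++ v) * m (v ++ z)) / m v *
     (s ^+ word_time e u * s ^+ word_time e v * s ^+ word_time e z)); last by ring.
  apply: ler_wpM2r; first by rewrite !mulr_ge0.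
  by apply: ler_wpM2r => //; rewrite invr_ge0 ltW.
have pos v : 0 <= Dk l * s ^+ word_time e v / m v.
  by rewrite divr_ge0 ?(ltW (m_gt0 _))// mulr_ge0 ?(ltW (Dk_gt0 _))// (le_trans ler01).
have G0 v g : 0 <= G v g by exact: weighted_return_ge0.
have GA v : l2_le (G v) (A * m v).
  apply: (@l2_le_comp _ _ (weighted_return n v) _ (word_map k v)) => //.
  exact: word_map_inj.
have Am0 v : 0 <= A * m v by rewrite mulr_ge0// ltW.
have bd0 v : 0 <= \sum_(u <- F) m (w ++ u ++ v) * s ^+ word_time e u
      - m w * m v * c / D ^+ 2.
  by have [] := block_gap w v.
have cf0 v : 0 <= cf v by rewrite /cf mulr_ge0// mulr_ge0.
have : l2_le (weighted_return (N + l + n) w) (\sum_(v <- F') cf v).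
  apply: (@l2_le_mono _ _ _ (fun g => \sum_(v <- F') f v g) (\sum_(v <- F') cf v)).
  - by move=> g; rewrite weighted_return_ge0 le_f.
  - by rewrite lexx andbT sumr_ge0.
  apply: l2_le_sum => v _; first exact: cf0.
  apply: l2_leZ; have [_] := block_gap w v; exact.
apply: l2_le_mono => [g|]; first by rewrite weighted_return_ge0 /=.
apply/andP; split; first by rewrite sumr_ge0.
have -> : \sum_(v <- F') cf v = A * (Dk l * (\sum_(v <- F') \sum_(u <- F)
   m (w ++ u ++ v) * s ^+ word_time e (u ++ v) -
     m w * (c / D ^+ 2) * \sum_(v <- F') s ^+ word_time e v * m v)).
  rewrite [_ * \sum_(v <- F') _]mulr_sumr -sumrB !mulr_sumr; apply: eq_bigr => v _.
  rewrite (eq_bigr (fun u => m (w ++ u ++ v) * s ^+ word_time e u * s ^+ word_time e v)).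
    rewrite -mulr_suml /cf; field.
    by rewrite !gt_eqF.
  by move=> u _; rewrite word_time_cat exprD mulrA.
apply: ler_wpM2l => //.
rewrite -[leRHS]mul1r; apply: le_trans (ler_wpM2r (ltW (m_gt0 w)) small).
rewrite -[leRHS]mulrA; apply: ler_wpM2l; first exact/ltW.
rewrite [leRHS]mulrBl lerB//.
  rewrite exchange_big/= [leRHS]mulrC; apply: le_trans (word_moment_le (N + l) w).
  by rewrite sum_words_overD.
(* The words [v] over [L] carry at least half of the mass and the powers of [s] are at least 1. This
   half is the 2 in [c / (2 * D ^+ 2)]. *)
rewrite [leLHS](_ : _ = m w * (c / D ^+ 2) * 2^-1); last first.
  by field; rewrite gt_eqF.
apply: ler_wpM2l.
  by rewrite mulr_ge0 ?(ltW (m_gt0 _))// divr_ge0 ?sqr_ge0// ltW.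
apply: le_trans half _; apply: ler_sum => v _.
by rewrite ler_peMl// ltW.
Qed.

End Step.

End Moments.

Section Decay.
Variables (L0 : seq B) (N : nat) (delta : R) (v0 : V).
Hypotheses (uL0 : uniq L0) (delta_gt0 : 0 < delta).
Hypothesis expansion : forall K, uniq K ->
  delta * (size K)%:R <=
  (size (split_vertices (words_over L0 N) (word_map k) K))%:R.
Hypothesis Dk_small : forall x : R, 0 < x ->
  exists2 l, (0 < l)%N & Dk l <= 1 + x.
Hypothesis words_exhaust : forall l (x : R), 0 < x ->
  exists2 L, uniq L & 1 - x <= \sum_(z <- words_over L l) m z.
Hypothesis time_tail : forall x : R, 0 < x -> exists2 s : R, 1 < s &
  forall L, uniq L -> \sum_(b <- L) m [:: b] * (s ^+ e b - 1) <= x.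

(** The block contraction makes the norm bound at length [N + l + n] no worse than at length [n], so
    the finitely many lengths below [N + l] decide. The constants are independent of the list [L],
    which is what allows [L] to exhaust the alphabet later. *)
Lemma weighted_return_bounded : exists s c : R, 1 < s /\
  forall L n h g, uniq L -> weighted_return L s h n [::] g <= c.
Proof.
have D_gt0 : 0 < D by exact: lt_le_trans Dk0_ge1.
pose F := words_over L0 N.
have uF : uniq F by exact: words_over_uniq.
(* Expansion of a single vertex shows that [delta <= 1] and that the family is nonempty. *)
have := expansion (isT : uniq [:: v0]); rewrite mulr1 => dle.
have delta_le1 : delta <= 1.
  apply: le_trans dle _; rewrite lern1 size_filter.
  exact: leq_trans (count_size _ _) _.
have F0 : F != [::].
  by apply/eqP => F0; move: dle; rewrite -/F F0/= leNgt delta_gt0.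
have [u0 u0F u0min] := seq_argmin m F0.
have kI u : injective (word_map k u) by exact: word_map_inj.
have [c1 /andP[c1_gt0 c1_le] gap] := expansion_gap kI expansion (m_gt0 u0) u0min
  F0 delta_gt0 delta_le1.
have c1_1 : c1 <= 1.
  apply: le_trans c1_le _; have := sum_words_le N [::] uL0; rewrite m_nil; exact.
pose c2 := c1 / (2 * D ^+ 2).
have c2_gt0 : 0 < c2 by rewrite divr_gt0// mulr_gt0// exprn_gt0.
have c2_le : c2 <= 2^-1.
  have D2 : 1 <= D ^+ 2 by exact: exprn_ege1.
  have D20 : 0 < 2 * D ^+ 2 by rewrite mulr_gt0// exprn_gt0.
  rewrite (ler_pdivrMr _ _ D20); lra.
have [l l_gt0 Dl] := Dk_small c2_gt0.
pose t := 3 ^+ (N + l) * D.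
have t_gt0 : 0 < t by rewrite mulr_gt0// exprn_gt0.
(* The admissible tail is chosen after [N + l], so that the moment of a whole block exceeds 1 by at
   most [c2 ^+ 2 / 2]. *)
pose x := Num.min (D^-1) (c2 ^+ 2 / 2 / t).
have x_gt0 : 0 < x by rewrite lt_min invr_gt0 D_gt0 !divr_gt0// exprn_gt0.
have Dx : (1 + D * x) ^+ (N + l) <= 1 + c2 ^+ 2 / 2.
  apply: le_trans (exprD1_le _ _) _.
    apply/andP; split; first by rewrite mulr_ge0// ltW.
    by rewrite -ler_pdivlMl// mulr1 ge_min lexx.
  by rewrite lerD2l mulrA -/t mulrC -ler_pdivlMr// ge_min lexx orbT.
have [s s_gt1 tail] := time_tail x_gt0.
have s_ge1 := ltW s_gt1.
have [Lc uLc Lc_half] := words_exhaust l (divr_gt0 ltr01 (ltr0n _ 2) : 0 < 1 / 2%:R).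
pose A := (1 + D * x) ^+ (N + l).
have Dx1 : 1 <= 1 + D * x by rewrite lerDl mulr_ge0 ?ltW.
have A0 : 0 <= A by rewrite exprn_ge0// (le_trans ler01).
exists s, A; split=> // L n h g uL.
(* The list is enlarged by [L0], which contracts, and by [Lc], which makes the spacers carry half of
   the mass. *)
pose L' := undup (L ++ L0 ++ Lc).
have uL' : uniq L' by exact: undup_uniq.
have LL' : {subset L <= L'} by move=> b bL; rewrite mem_undup mem_cat bL.
have L0L' : {subset L0 <= L'} by move=> b bL; rewrite mem_undup !mem_cat bL orbT.
have LcL' : {subset Lc <= L'} by move=> b bL; rewrite mem_undup !mem_cat bL !orbT.
have s_pow i : 0 <= s ^+ i by rewrite exprn_ge0// (le_trans ler01).
apply: (@le_trans _ _ (weighted_return L' s h n [::] g)).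
  apply: ler_sum_subset; first exact: words_over_uniq.
    exact: words_over_subset.
  by move=> z; rewrite !mulr_ge0// ltW.
have half' : 2^-1 <= \sum_(v <- words_over L' l) m v.
  apply: le_trans (_ : \sum_(v <- words_over Lc l) m v <= _); first lra.
  apply: ler_sum_subset; first exact: words_over_uniq.
    exact: words_over_subset.
  by move=> z; rewrite ltW.
have small : Dk l * ((1 + D * x) ^+ (N + l) - c2) <= 1.
  (* The product equals [1 - c2 ^+ 2 * (1 - c2) / 2]: the first-order terms of the spacer loss and
     of the gap cancel. *)
  apply: le_trans (_ : (1 + c2) * (1 + c2 ^+ 2 / 2 - c2) <= 1); last by nra.
  apply: ler_pM => //; [exact: ltW| |lra].
  have : 1 <= (1 + D * x) ^+ (N + l) by exact: exprn_ege1.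
  lra.
have key w : l2_le (weighted_return L' s h n w) (A * m w).
  have [q] := ubnP n; elim: q n w => // q IH n w; rewrite ltnS => nq.
  have [nNl|Nln] := ltnP n (N + l).
    apply: (@l2_le_mono _ _ _ (weighted_return L' s h n w) ((1 + D * x) ^+ n * m w)).
    - by move=> y; rewrite lexx andbT; apply: weighted_return_ge0.
    - rewrite mulr_ge0 ?(ltW (m_gt0 _)) ?exprn_ge0 ?(le_trans ler01)//=.
      by rewrite ler_wpM2r ?(ltW (m_gt0 _))// ler_weXn2l// ltnW.
    - exact: weighted_return_base (ltW x_gt0) (tail _ uL') _ _ _.
  rewrite -(subnKC Nln).
  apply: (@weighted_return_step L' s x uL' s_ge1 (ltW x_gt0) (tail _ uL') h L0 N l c1) => //.
  move=> w'; apply: IH; rewrite (leq_trans _ nq)// ltn_subrL.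
  by rewrite addn_gt0 l_gt0 orbT (leq_trans _ Nln)// addn_gt0 l_gt0 orbT.
have := key [::] [:: g] isT; rewrite big_seq1 m_nil mulr1.
by rewrite ler_pXn2r// nnegrE weighted_return_ge0.
Qed.

End Decay.
End QuasiBernoulli.

(** * Exponential rates and amenability *)

Section Roots.
Context {R : realType}.
Implicit Types (u : nat -> R).

Lemma nth_root_le n (a x : R) : (0 < n)%N -> 0 <= a -> 0 <= x ->
  nth_root n a <= x -> a <= x ^+ n.
Proof.
move=> n0 a0 x0 h; rewrite -powR_mulrn//.
rewrite -[leLHS]powRr1// -[in leLHS](@mulVf _ n%:R); last by rewrite pnatr_eq0 -lt0n.
by rewrite powRrM ge0_ler_powR ?nnegrE ?powR_ge0 ?ler0n.
Qed.

Lemma nth_root_ge n (a x : R) : (0 < n)%N -> 0 <= a -> 0 <= x ->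
  a <= x ^+ n -> nth_root n a <= x.
Proof.
move=> n0 a0 x0 h; rewrite /nth_root.
apply: (@le_trans _ _ ((x ^+ n) `^ (n%:R^-1))).
  by rewrite ge0_ler_powR ?nnegrE ?exprn_ge0 ?invr_ge0 ?ler0n.
rewrite -powR_mulrn// -powRrM mulfV ?powRr1//.
by rewrite pnatr_eq0 -lt0n.
Qed.

Lemma limn_esup_root_decay u : (forall n, 0 <= u n <= 1) ->
  (limn_esup (fun n => (nth_root n (u n))%:E) < 1)%E ->
  exists rho c : R, [/\ 0 < rho, rho < 1, 0 <= c & forall n, u n <= c * rho ^+ n].
Proof.
move=> u01 /ereal_inf_lt[_ [W [n0 _ n0W] <-] supW].
have [q q1 supq] : exists2 q : R, q < 1 & forall n, (n0 <= n)%N -> nth_root n (u n) <= q.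
  case: (ereal_sup _) (@ereal_sup_ubound R ((fun n => (nth_root n (u n))%:E) @` W)) supW.
  - move=> q ub q1; exists q; first by rewrite -lte_fin.
    by move=> n n0n; rewrite -lee_fin; apply: ub; exists n => //; apply: n0W.
  - by move=> _.
  - move=> ub _; exists 0 => // n n0n; have := ub (nth_root n (u n))%:E.
    by rewrite leeNy_eq => h; have/eqP := h (ex_intro2 _ _ n (n0W n n0n) erefl).
(* The maximum keeps [rho] positive, so that the first [n0 + 1] terms, which are at most 1, are
   absorbed by a power of its inverse. *)
pose rho := Num.max q 2^-1.
have rho0 : 0 < rho by rewrite lt_max invr_gt0 ltr0n orbT.
have rho1 : rho < 1 by rewrite gt_max q1 invf_lt1// ltr1n.
exists rho, ((rho^-1) ^+ n0.+1); split => //.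
  by rewrite exprn_ge0// invr_ge0 ltW.
move=> n; have /andP[un0 un1] := u01 n.
have ri : 1 <= rho^-1 by rewrite invf_ge1// ltW.
have [nn0|n0n] := leqP n n0.
  apply: le_trans un1 _; apply: (@le_trans _ _ (rho^-1 ^+ n * rho ^+ n)).
    by rewrite -exprMn mulVf ?expr1n// gt_eqF.
  rewrite ler_wpM2r ?exprn_ge0 ?(ltW rho0)// ler_weXn2l//.
  exact: leq_trans nn0 _.
apply: (@le_trans _ _ (rho ^+ n)); last first.
  by rewrite ler_peMl ?exprn_ge0 ?exprn_ege1// ltW.
apply: nth_root_le => //; [exact: leq_trans n0n|exact: ltW|].
by apply: le_trans (supq n (ltnW n0n)) _; rewrite le_max lexx.
Qed.

Lemma limn_esup_root_le u (x : R) n0 : (forall n, 0 <= u n) -> 0 <= x ->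
  (forall n, (n0 <= n)%N -> u n <= x ^+ n) ->
  (limn_esup (fun n => (nth_root n (u n))%:E) <= x%:E)%E.
Proof.
move=> u0 x0 ux.
(* The tail starts at [n0.+1] to exclude [n = 0], where the root is a default value. *)
apply: (@le_trans _ _ (ereal_sup ((fun n => (nth_root n (u n))%:E) @`
    [set n | (n0.+1 <= n)%N]))).
  apply: ereal_inf_lbound; exists [set n | (n0.+1 <= n)%N] => //.
  by exists n0.+1.
apply: ge_ereal_sup => _ [n /= n0n <-]; rewrite lee_fin.
apply: nth_root_ge => //; [exact: leq_trans n0n|].
exact/ux/ltnW.
Qed.

Lemma geometric_sum_le (rho : R) n M : 0 < rho < 1 ->
  \sum_(n <= i < M) rho ^+ i <= rho ^+ n / (1 - rho).
Proof.
move=> /andP[rho0 rho1].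
have r1 : 0 < 1 - rho by lra.
have sumE k : (\sum_(n <= i < n + k) rho ^+ i) * (1 - rho) = rho ^+ n - rho ^+ (n + k).
  elim: k => [|k IH]; first by rewrite addn0 big_geq// mul0r subrr.
  rewrite addnS big_nat_recr ?leq_addr//= mulrDl IH exprS; ring.
have [nM|Mn] := leqP n M; last first.
  by rewrite big_geq ?(ltnW Mn)// divr_ge0 ?exprn_ge0 ?(ltW r1) ?(ltW rho0).
by rewrite ler_pdivlMr// -(subnKC nM) sumE gerBl exprn_ge0// ltW.
Qed.

(** The bound [T] is the fixed point of the recursion obtained by splitting off one factor
    [rho * s]. It is uniform in [Q] and tends to 0 as [s] tends to 1. *)
Lemma sum_expr_gap_le (rho s : R) Q : 0 < rho < 1 -> 1 <= s -> rho * s < 1 ->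
  \sum_(0 <= n < Q) (s ^+ n - 1) * rho ^+ n <=
  (s - 1) * rho / ((1 - rho) * (1 - rho * s)).
Proof.
move=> /[dup] rho01 /andP[rho0 rho1] s1 rs1.
have r1 : 0 < 1 - rho by lra.
have r2 : 0 < 1 - rho * s by lra.
set T := _ / _.
have T0 : 0 <= T by rewrite divr_ge0 ?mulr_ge0 ?subr_ge0// ?ltW.
elim: Q => [|Q IH]; first by rewrite big_geq.
rewrite big_nat_recl//= expr0 subrr mul0r add0r.
have -> : \sum_(0 <= i < Q) (s ^+ i.+1 - 1) * rho ^+ i.+1 =
    rho * s * \sum_(0 <= i < Q) (s ^+ i - 1) * rho ^+ i +
    (s - 1) * rho * \sum_(0 <= i < Q) rho ^+ i.
  rewrite !mulr_sumr -big_split/=; apply: eq_bigr => i _; rewrite !exprS; ring.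
have TE : T = rho * s * T + (s - 1) * rho * (rho ^+ 0 / (1 - rho)).
  by rewrite /T expr0; field; rewrite !gt_eqF.
rewrite TE; apply: lerD.
  by rewrite ler_wpM2l// mulr_ge0 ?(ltW rho0)//; lra.
rewrite ler_wpM2l ?geometric_sum_le//.
by rewrite mulr_ge0 ?(ltW rho0)// subr_ge0.
Qed.

End Roots.

(** * Amenability expressed at a fixed [eps] *)

Section Amenability.
Context {d : measure_display} {X : measurableType d} {R : realType} {V : countType}.
Variables (mu : probability X R) (E : set (V * V)) (kappa : X -> V -> V) (o : V).
Local Notation bd := (eps_boundary E mu kappa).

Let ratios (eps : R) : set R := [set ((#|` bd eps K|)%:R / (#|` K|)%:R : R)
      | K in [set K : {fset V} | (0 < #|` K|)%N]].

Let ratios_neq0 eps : ratios eps !=set0.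
Proof.
exists ((#|` bd eps [fset o]%fset|)%:R / (#|` [fset o]%fset|)%:R); exists [fset o]%fset => //=.
by rewrite cardfs1.
Qed.

Let ratios_ge0 eps : lbound (ratios eps) 0.
Proof. by move=> _ [K _ <-]; rewrite divr_ge0. Qed.

(** The boundary shrinks as [eps] grows, so a set found for some smaller value also serves for
    [eps]. *)
Lemma mu_amenable_small (eps delta : R) : mu_amenable E mu kappa -> 0 < eps -> 0 < delta ->
  exists2 K : {fset V}, (0 < #|` K|)%N &
    (#|` bd eps K|)%:R <= delta * (#|` K|)%:R.
Proof.
move=> am eps0 delta0.
have h1 : \forall e \near 0^'+, inf (ratios e) < delta by exact: (cvgr_lt 0 am).
have [e [e0 eeps einf]] : exists e, [/\ 0 < e, e < eps & inf (ratios e) < delta].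
  near (0 : R)^'+ => e; exists e; split; near: e => //.
    exact: nbhs_right_gt.
  exact: nbhs_right_lt.
have [_ [K K0 <-] Ke] := inf_lt (ratios_neq0 e) einf.
exists K => //; have K0R : 0 < (#|` K|)%:R :> R by rewrite ltr0n.
move: Ke; rewrite ltr_pdivrMr// => /ltW; apply: le_trans.
rewrite ler_nat; apply: fsubset_leq_card; apply/fsubsetP => v.
rewrite !inE => /andP[-> /asboolP[ed [h1' h2 h3 h4]]] /=; apply/asboolP.
by exists ed; split => //; apply: lt_trans h4; rewrite lte_fin.
Unshelve. all: by end_near.
Qed.

Lemma mu_amenable_of_small :
  (forall eps delta : R, 0 < eps -> 0 < delta -> exists2 K : {fset V}, (0 < #|` K|)%N &
    (#|` bd eps K|)%:R <= delta * (#|` K|)%:R) -> mu_amenable E mu kappa.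
Proof.
move=> h.
have inf0 e : 0 < e -> inf (ratios e) = 0.
  move=> e0; apply/eqP; rewrite eq_le; apply/andP; split; last first.
    exact: lb_le_inf (ratios_neq0 e) (@ratios_ge0 e).
  apply/ler_addgt0Pr => x x0; rewrite add0r.
  have [K K0 Kx] := h e x e0 x0.
  apply: (@le_trans _ _ ((#|` bd e K|)%:R / (#|` K|)%:R)).
    by apply: ge_inf; [exists 0; exact: ratios_ge0|exists K].
  by rewrite ler_pdivrMr// ltr0n.
apply: (@cvg_trans _ ((fun=> 0) @ (0 : R)^'+)); last exact: cvg_cst.
apply: near_eq_cvg; near=> e; rewrite [RHS](inf0 e)//.
Unshelve. all: by end_near.
Qed.

End Amenability.

(** * Decay of return probabilities and Folner sets *)

Lemma exists_expr_lt (R : realType) (x e : R) : 0 <= x < 1 -> 0 < e ->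
  exists n0, forall n, (n0 <= n)%N -> x ^+ n < e.
Proof.
move=> /andP[x0 x1] e0.
have : (GRing.exp x @ \oo --> (0 : R))%classic by apply: cvg_expr; rewrite ger0_norm.
move=> /cvgrPdist_lt/(_ e e0)[n0 _ n0P]; exists n0 => n /n0P/=.
by rewrite sub0r normrN ger0_norm// exprn_ge0.
Qed.

(** With [x = y ^+ 2], Bernoulli's inequality bounds [n * y ^+ n], and the remaining factor [y ^+ n]
    tends to 0. *)
Lemma natrM_expr_lt (R : realType) (x e : R) : 0 <= x < 1 -> 0 < e ->
  exists n0, forall n, (n0 <= n)%N -> n%:R * x ^+ n < e.
Proof.
move=> /andP[x0 x1] e0; have [->|xn0] := eqVneq x 0.
  by exists 1%N => -[//|n] _; rewrite expr0n mulr0.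
pose y := Num.sqrt x.
have y0 : 0 < y by rewrite sqrtr_gt0 lt_def xn0.
have y2 : y ^+ 2 = x by rewrite sqr_sqrtr.
have y1 : y < 1 by rewrite -sqrtr1 ltr_sqrt.
pose z := y^-1 - 1.
have z0 : 0 < z by rewrite subr_gt0 invf_gt1.
have bern n : 1 + n%:R * z <= (1 + z) ^+ n.
  elim: n => [|n IH]; first by rewrite mul0r addr0 expr0.
  rewrite exprS; apply: le_trans (ler_wpM2l _ IH); last by lra.
  rewrite mulrS; have : 0 <= n%:R * z * z by rewrite !mulr_ge0// ltW.
  nra.
have ny n : n%:R * y ^+ n <= z^-1.
  rewrite -[leRHS]mul1r ler_pdivlMr// mulrAC -ler_pdivlMr ?exprn_gt0// mul1r.
  rewrite -exprVn (_ : y^-1 = 1 + z); last by rewrite /z addrC subrK.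
  have := bern n; lra.
have y01 : 0 <= y < 1 by rewrite (ltW y0).
have [n0 n0P] := exists_expr_lt y01 (mulr_gt0 e0 z0).
exists n0 => n /n0P yn; rewrite -y2 exprAC expr2 mulrA.
apply: (@le_lt_trans _ _ (z^-1 * y ^+ n)).
  by rewrite ler_wpM2r// exprn_ge0// ltW.
by rewrite mulrC ltr_pdivrMr.
Qed.

Section NoDecay.
Context {R : realType} {V : eqType}.
Variables (p : nat -> V -> V -> R) (D : R) (C : nat -> R) (N : nat -> nat).
Variables (o : V) (rho c0 : R).
Hypotheses (p_ge0 : forall n g h, 0 <= p n g h) (D_gt0 : 0 < D).
Hypothesis p0 : forall g h, p 0 g h = (g == h)%:R.
Hypothesis p_super : forall n n' g h K, uniq K ->
  \sum_(k <- K) p n g k * p n' k h <= D * p (n + n') g h.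
Hypothesis p_sym : forall n g h, (0 < n)%N ->
  p n g h <= C n * \sum_(n - N n <= k < (n + N n).+1) p k h g.
Hypothesis C_gt0 : forall n, 0 < C n.
Hypothesis p_trans : forall g h, exists n, 0 < p n g h.
Hypothesis folner : forall n, exists K, [/\ uniq K, K != [::] &
  (size K)%:R / 2 <= \sum_(g <- K) \sum_(h <- K) p n g h].
Hypotheses (rho_gt0 : 0 < rho) (p_decay : forall n, p n o o <= c0 * rho ^+ n).

(** A path from [g] to [h] is extended to a loop at [o] by fixed connections. The constant depends
    on [K], which is harmless because [K] stays fixed while powers of [A] grow. *)
Lemma decay_finite_set (K : seq V) : exists2 c : R, 0 <= c &
  forall n g h, g \in K -> h \in K -> p n g h <= c * rho ^+ n.
Proof.
have one g h : exists2 c : R, 0 <= c & forall n, p n g h <= c * rho ^+ n.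
  have [a pa] := p_trans o g; have [b pb] := p_trans h o.
  have c00 : 0 <= c0.
    by have := p_decay 0; rewrite p0 eqxx expr0 mulr1; apply: le_trans.
  exists (D ^+ 2 * c0 * rho ^+ (a + b) / (p a o g * p b h o)).
    by rewrite !mulr_ge0 ?invr_ge0 ?mulr_ge0// ?exprn_ge0// ltW.
  move=> n; rewrite mulrAC ler_pdivlMr ?mulr_gt0//.
  have h1 := @p_super a n o h [:: g] isT; rewrite big_seq1 in h1.
  have h2 := @p_super (a + n) b o o [:: h] isT; rewrite big_seq1 in h2.
  rewrite mulrA [leLHS](_ : _ = (p a o g * p n g h) * p b h o); last by ring.
  apply: le_trans (ler_wpM2r (p_ge0 _ _ _) h1) _.
  rewrite -[leLHS]mulrA; apply: le_trans (ler_wpM2l (ltW D_gt0) h2) _.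
  rewrite [leLHS](_ : _ = D ^+ 2 * p (a + n + b) o o); last by ring.
  rewrite [leRHS](_ : _ = D ^+ 2 * (c0 * rho ^+ (a + n + b))); last first.
    by rewrite !exprD; ring.
  by rewrite ler_wpM2l ?sqr_ge0.
have two g (K' : seq V) : exists2 c : R, 0 <= c & forall n h, h \in K' -> p n g h <= c * rho ^+ n.
  elim: K' => [|h K' [c c_ge0 IH]]; first by exists 0.
  have [c' c'_ge0 cP] := one g h; exists (c + c'); first exact: addr_ge0.
  move=> n h'; rewrite inE mulrDl => /orP[/eqP->|h'K].
    by rewrite (le_trans (cP n))// lerDr mulr_ge0// exprn_ge0// ltW.
  by rewrite (le_trans (IH n h' h'K))// lerDl mulr_ge0// exprn_ge0// ltW.
suff gen (K1 : seq V) : exists2 c : R, 0 <= c &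
    forall n g h, g \in K1 -> h \in K -> p n g h <= c * rho ^+ n by exact: gen.
elim: K1 => [|g K' [c c_ge0 IH]]; first by exists 0.
have [c' c'_ge0 cP] := two g K; exists (c + c'); first exact: addr_ge0.
move=> n g' h; rewrite inE mulrDl => /orP[/eqP-> hK|g'K hK].
  by rewrite (le_trans (cP n h hK))// lerDr mulr_ge0// exprn_ge0// ltW.
by rewrite (le_trans (IH n g' h g'K hK))// lerDl mulr_ge0// exprn_ge0// ltW.
Qed.

Section FixedScale.
Variables (n : nat) (K : seq V).
Hypotheses (n_gt0 : (0 < n)%N) (uK : uniq K) (K_neq0 : K != [::]).

Let A g h := \sum_(k <- K) p n k g * p n k h.
(** The growth rate of the powers of [A]: one factor [D] comes from bounding [A] by return
    probabilities, the other from composing it with the preceding ones. *)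
Let E := D ^+ 2 * C n * \sum_(n - N n <= l < (n + N n).+1) rho ^+ (n + l).
Let AF (f : V -> R) g := \sum_(h <- K) A g h * f h.
Let x j := iter j AF (fun=> 1).

Let A_ge0 g h : 0 <= A g h.
Proof. by apply: sumr_ge0 => k _; rewrite mulr_ge0. Qed.

Let x_ge0 j g : 0 <= x j g.
Proof.
elim: j g => [|j IH] g /=; first exact: ler01.
by apply: sumr_ge0 => h _; rewrite mulr_ge0// IH.
Qed.

(** Symmetry reverses only the first factor [p n k g]; the sum over [k] then runs over the midpoints
    of paths from [g] to [h]. *)
Let A_le g h : A g h <= D * C n * \sum_(n - N n <= l < (n + N n).+1) p (l + n) g h.
Proof.
apply: (@le_trans _ _ (\sum_(k <- K) C n *
    \sum_(n - N n <= l < (n + N n).+1) p l g k * p n k h)).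
  apply: ler_sum => k _; rewrite -mulr_suml mulrA ler_wpM2r//; exact: p_sym.
rewrite -mulr_sumr exchange_big/= [D * _]mulrC -mulrA ler_wpM2l ?(ltW (C_gt0 _))//.
by rewrite mulr_sumr; apply: ler_sum => l _; apply: p_super.
Qed.

(** The prefix [p i] is what makes the induction work: each new [A] is merged into it as a longer
    return probability, and the constant [c] of the finite set is paid once at the end instead of
    once per step. *)
Let x_le c : 0 <= c ->
  (forall i g h, g \in K -> h \in K -> p i g h <= c * rho ^+ i) ->
  forall j i g, g \in K ->
  \sum_(k <- K) p i g k * x j k <= (size K)%:R * c * E ^+ j * rho ^+ i.
Proof.
move=> c_ge0 cP; elim=> [|j IH] i g gK.
  rewrite expr0 mulr1 -mulrA -sumr_const_seq_nat; apply: ler_sum_seq => k kK.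
  by rewrite /x/= mulr1 cP.
pose c' := (size K)%:R * c * E ^+ j.
apply: (@le_trans _ _ (D ^+ 2 * C n * \sum_(n - N n <= l < (n + N n).+1)
    \sum_(k' <- K) p (i + (l + n)) g k' * x j k')).
  apply: (@le_trans _ _ (\sum_(k <- K) \sum_(k' <- K) p i g k *
     ((D * C n * \sum_(n - N n <= l < (n + N n).+1) p (l + n) k k') * x j k'))).
    apply: ler_sum => k _; rewrite /x iterS -/(x j) /AF mulr_sumr.
    by apply: ler_sum => k' _; rewrite ler_wpM2l// ler_wpM2r// A_le.
  rewrite exchange_big/= [X in _ <= _ * X]exchange_big/= mulr_sumr.
  apply: ler_sum => k' _; rewrite -mulr_suml mulrA.
  under eq_bigr do rewrite mulrA; rewrite -mulr_suml ler_wpM2r//.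
  rewrite [leLHS](_ : _ = D * C n * \sum_(n - N n <= l < (n + N n).+1)
      \sum_(k <- K) p i g k * p (l + n) k k'); last first.
    rewrite [in RHS]exchange_big/= mulr_sumr; apply: eq_bigr => k _.
    by rewrite -mulr_sumr; ring.
  rewrite [leRHS](_ : _ = D * C n * \sum_(n - N n <= l < (n + N n).+1)
      D * p (i + (l + n)) g k'); last by rewrite -mulr_sumr; ring.
  rewrite ler_wpM2l ?mulr_ge0 ?(ltW D_gt0) ?(ltW (C_gt0 _))//.
  by apply: ler_sum => l _; apply: p_super.
apply: (@le_trans _ _ (D ^+ 2 * C n * \sum_(n - N n <= l < (n + N n).+1)
    c' * rho ^+ (i + (l + n)))).
  rewrite ler_wpM2l ?mulr_ge0 ?(ltW D_gt0) ?(ltW (C_gt0 _))//.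
  by apply: ler_sum => l _; apply: IH.
rewrite /c' -mulr_sumr le_eqVlt; apply/orP; left; apply/eqP.
under eq_bigr do rewrite exprD addnC.
by rewrite -mulr_sumr (exprS E); move: (E ^+ j) => Ej; rewrite /E; ring.
Qed.

Let S (f g : V -> R) := \sum_(k <- K) f k * g k.

Let AF_sym f g : S (AF f) g = S f (AF g).
Proof.
rewrite /S; under eq_bigr do rewrite mulr_suml.
rewrite exchange_big/=; apply: eq_bigr => h _.
rewrite mulr_sumr; apply: eq_bigr => k _.
have -> : A k h = A h k by rewrite /A; apply: eq_bigr => ? _; rewrite mulrC.
by rewrite [A h k * _]mulrC mulrA.
Qed.

Let S_x i j : S (x i) (x j) = S (x 0) (x (i + j)).
Proof.
have xS l : x l.+1 = AF (x l) by [].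
by elim: i j => // i IH j; rewrite xS AF_sym -xS IH addnS.
Qed.

(** With [a j] the normalized value of [1^T A^j 1], symmetry of [A] gives [a j ^+ 2 <= a (j + j)];
    doubling from [a 1 >= 1/4] yields [a (2 ^ i) >= 4^-1 ^+ (2 ^ i)], against
    [a j <= q * c * E ^+ j] with [E < 1/4]. *)
Lemma scale_contradiction : E < 4^-1 ->
  (size K)%:R / 2 <= \sum_(g <- K) \sum_(h <- K) p n g h -> False.
Proof.
move=> E4 fol.
pose q : R := (size K)%:R.
have q_gt0 : 0 < q by rewrite ltr0n lt0n size_eq0.
pose a j := S (x 0) (x j) / q.
have a_sqr j : a j ^+ 2 <= a (j + j)%N.
  have := cauchy_schwarz_seq K (x 0) (x j).
  rewrite (_ : \sum_(i <- K) x 0 i ^+ 2 = q); last first.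
    rewrite /q -[RHS]mulr1 -sumr_const_seq_nat.
    by apply: eq_bigr => g _; rewrite expr1n.
  rewrite (_ : \sum_(i <- K) x j i ^+ 2 = S (x j) (x j)); last first.
    by apply: eq_bigr => g _; rewrite expr2.
  rewrite S_x -/(S (x 0) (x j)) /a expr_div_n ler_pdivrMr ?exprn_gt0//.
  move/le_trans; apply; rewrite le_eqVlt; apply/orP; left; apply/eqP.
  by field; rewrite gt_eqF.
(* The value [1^T A 1] is the squared norm of the vector of row sums of [p n] on [K], whose mean is
   at least 1/2. *)
have a1 : 4^-1 <= a 1%N.
  have h2 : S (x 0) (x 1%N) = \sum_(k <- K) (\sum_(g <- K) p n k g) ^+ 2.
    rewrite /S /x/= /AF; under eq_bigr do rewrite mul1r.
    under eq_bigr do (under eq_bigr do rewrite mulr1 /A; rewrite exchange_big/=).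
    rewrite exchange_big/=; apply: eq_bigr => k _.
    by rewrite expr2 big_distrlr.
  have := cauchy_schwarz_seq K (fun=> 1) (fun k => \sum_(g <- K) p n k g).
  rewrite (_ : \sum_(i <- K) 1 ^+ 2 = q); last first.
    by rewrite /q -[RHS]mulr1 -sumr_const_seq_nat expr1n.
  under eq_bigr do rewrite mul1r.
  rewrite -h2 /a => h3.
  have : (q / 2) ^+ 2 <= q * S (x 0) (x 1%N).
    apply: le_trans h3; rewrite ler_pXn2r ?nnegrE//.
      by rewrite divr_ge0// ltW.
    by apply: sumr_ge0 => ? _; apply: sumr_ge0.
  move=> h4; rewrite ler_pdivlMr// -(ler_pM2l q_gt0); apply: le_trans h4.
  by rewrite le_eqVlt; apply/orP; left; apply/eqP; field.
have a_ge i : 4^-1 ^+ (2 ^ i) <= a (2 ^ i)%N.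
  elim: i => [|i IH]; first by rewrite expn0 expr1.
  rewrite expnS mul2n -addnn exprD -expr2; apply: le_trans (a_sqr _).
  by rewrite ler_pXn2r ?nnegrE// (le_trans _ IH)// exprn_ge0// invr_ge0.
have [c c_ge0 cP] := decay_finite_set K.
have x_leE j g : g \in K -> x j g <= q * c * E ^+ j.
  move=> gK; have := x_le c_ge0 cP j 0 gK; rewrite expr0 mulr1; apply: le_trans.
  rewrite (perm_big _ (perm_to_rem gK)) big_cons/= p0 eqxx mul1r lerDl.
  by apply: sumr_ge0 => k _; rewrite mulr_ge0.
have a_le j : a j <= q * c * E ^+ j.
  rewrite /a ler_pdivrMr// mulrC -sumr_const_seq_nat; apply: ler_sum_seq => g gK.
  by rewrite mul1r x_leE.
have E_ge0 : 0 <= E.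
  rewrite !mulr_ge0 ?(ltW D_gt0) ?(ltW (C_gt0 _))//; apply: sumr_ge0 => l _.
  by rewrite exprn_ge0// ltW.
have E1 : 0 <= 4 * E < 1 by rewrite mulr_ge0//=; lra.
have qc : 0 < (1 + q * c)^-1 by rewrite invr_gt0 ltr_wpDr// mulr_ge0// ltW.
have [n0 n0P] := exists_expr_lt E1 qc.
have := n0P _ (ltnW (ltn_expl n0 (ltnSn 1))).
rewrite -[(1 + _)^-1]mul1r ltr_pdivlMr; last by rewrite -invr_gt0.
have := le_trans (a_ge n0) (a_le _).
have p4 : 0 < 4 ^+ (2 ^ n0) :> R by rewrite exprn_gt0.
rewrite exprVn -(ler_pM2l p4) mulfV ?gt_eqF// mulrCA -exprMn => h1 h2.
have q0 : 0 <= q * c by rewrite mulr_ge0// ltW.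
have E0 : 0 <= (4 * E) ^+ (2 ^ n0) by rewrite exprn_ge0// mulr_ge0.
nra.
Qed.

End FixedScale.

Hypothesis rho_lt1 : rho < 1.
Hypothesis C_root : (nth_root n (C n) @[n --> \oo] --> (1 : R))%classic.
Hypothesis N_small : ((N n)%:R / n%:R @[n --> \oo] --> (0 : R))%classic.

Lemma no_exponential_decay : False.
Proof.
(* A number strictly between 1 and [rho^-1]: eventually [C n <= a ^+ n], and still [a * rho < 1]. *)
pose a := (1 + rho^-1) / 2.
have r1 : 1 < rho^-1 by rewrite invf_gt1.
have a_gt1 : 1 < a by rewrite /a; lra.
have a_lt : a * rho < 1.
  by rewrite -ltr_pdivlMr// mul1r /a; lra.
have a0 : 0 < a by lra.
have ar : 0 <= a * rho < 1 by rewrite mulr_ge0 ?(ltW a0) ?(ltW rho_gt0).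
have D2 : 0 < D ^+ 2 by rewrite exprn_gt0.
(* The sum has at most [3 * n] terms once [N n <= n], so that 16 leaves the rate below 3/16, hence
   below 1/4. *)
have [n1 n1P] := natrM_expr_lt ar (divr_gt0 (ltr01 : 0 < 1 :> R) (mulr_gt0 (ltr0n R 16) D2)).
have C_root' : \forall n \near \oo%classic, nth_root n (C n) < a.
  exact: (@cvgr_lt R nat eventually _ (fun n => nth_root n (C n)) 1 C_root a a_gt1).
have N_small' : \forall n \near \oo%classic, (N n)%:R / n%:R < (1 : R).
  exact: (@cvgr_lt R nat eventually _ (fun n => (N n)%:R / n%:R) 0 N_small 1 ltr01).
have [n2 _ n2P] := C_root'; have [n3 _ n3P] := N_small'.
have [n [n_gt0 n1n n2n n3n]] : exists n, [/\ 0 < n, n1 <= n, n2 <= n & n3 <= n]%N.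
  by exists (n1 + n2 + n3).+1; split; lia.
have n0R : 0 < n%:R :> R by rewrite ltr0n.
have Cn : C n <= a ^+ n.
  by apply: nth_root_le => //; [exact/ltW/C_gt0|exact: ltW|exact/ltW/n2P].
have Nn : (N n <= n)%N.
  have : (N n)%:R / n%:R < (1 : R) by exact: n3P.
  by rewrite ltr_pdivrMr// mul1r ltr_nat => /ltnW.
have [K [uK K0 fol]] := folner n.
apply: (@scale_contradiction n K n_gt0 uK K0 _ fol).
have nar : n%:R * (a * rho) ^+ n < 1 / (16 * D ^+ 2) by exact: n1P.
apply: (@le_lt_trans _ _ (D ^+ 2 * a ^+ n * (3 * n%:R * rho ^+ n))).
  apply: ler_pM => //.
  - by rewrite mulr_ge0 ?sqr_ge0// ltW.
  - by apply: sumr_ge0 => l _; rewrite exprn_ge0// ltW.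
  - by rewrite ler_wpM2l ?sqr_ge0.
  apply: (@le_trans _ _ (\sum_(n - N n <= l < (n + N n).+1) rho ^+ n)).
    apply: ler_sum => l _; rewrite exprD ler_piMr ?exprn_ge0 ?(ltW rho_gt0)//.
    by rewrite exprn_ile1// ltW.
  rewrite sumr_const_nat -[leLHS]mulr_natl ler_wpM2r ?exprn_ge0 ?(ltW rho_gt0)//.
  by rewrite -natrM ler_nat; move: (N n) Nn n_gt0 => b; clear; lia.
rewrite [ltLHS](_ : _ = 3 * D ^+ 2 * (n%:R * (a * rho) ^+ n)); last first.
  by rewrite (exprMn n a rho); move: (a ^+ n) (rho ^+ n) (n%:R) => y z u; ring.
apply: (@lt_trans _ _ (3 * D ^+ 2 * (1 / (16 * D ^+ 2)))).
  by rewrite ltr_pM2l// mulr_gt0.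
rewrite [ltLHS](_ : _ = 3 / 16); last by field; rewrite gt_eqF.
lra.
Qed.

End NoDecay.

(** * Markov systems and their Jacobians *)

Section RealProbability.
Context {d : measure_display} {X : measurableType d} {R : realType}.
Variable m : probability X R.
Implicit Types (A B N : set X).

Definition prob A : R := fine (m A).

Lemma probE A : measurable A -> m A = (prob A)%:E.
Proof. by move=> mA; rewrite /prob fineK// fin_num_measure. Qed.

Lemma prob_ge0 A : 0 <= prob A.
Proof. exact: fine_ge0. Qed.

Lemma prob_setT : prob setT = 1.
Proof. by rewrite /prob probability_setT. Qed.

Lemma prob_set0 : prob set0 = 0.
Proof. by rewrite /prob measure0. Qed.

Lemma prob_mono A B : measurable A -> measurable B -> A `<=` B -> prob A <= prob B.
Proof.
move=> mA mB AB; rewrite -lee_fin -!probE//.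
by apply: le_measure => //; rewrite inE.
Qed.

Lemma prob_le1 A : measurable A -> prob A <= 1.
Proof. by move=> mA; rewrite -prob_setT; apply: prob_mono. Qed.

Lemma probDI A B : measurable A -> measurable B ->
  prob A = prob (A `\` B) + prob (A `&` B).
Proof.
move=> mA mB; apply/EFin_inj; rewrite EFinD -!probE//; first exact: measureDI.
  exact: measurableI.
exact: measurableD.
Qed.

Lemma prob_setC A : measurable A -> prob (~` A) = 1 - prob A.
Proof.
move=> mA; rewrite -prob_setT (probDI measurableT mA) setTD setTI; ring.
Qed.

Lemma probU A B : measurable A -> measurable B -> A `&` B = set0 ->
  prob (A `|` B) = prob A + prob B.
Proof.
move=> mA mB AB0; apply/EFin_inj; rewrite EFinD -!probE//; first exact: measureU.
exact: measurableU.
Qed.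

Lemma prob0P A : measurable A -> m.-negligible A <-> prob A = 0.
Proof.
move=> mA; split=> [/(negligibleP m mA)|] A0; first by rewrite /prob A0.
by apply/(negligibleP m mA); apply: etrans (probE mA) _; rewrite A0.
Qed.

Lemma null_subset A B : measurable A -> m.-negligible B -> A `<=` B -> m A = 0%E.
Proof.
by move=> mA B0 AB; apply/(negligibleP m mA); apply: negligibleS B0.
Qed.

Lemma probU_le A B : measurable A -> measurable B ->
  prob (A `|` B) <= prob A + prob B.
Proof.
move=> mA mB; have mBA := measurableD mB mA.
have -> : A `|` B = A `|` (B `\` A).
  apply/seteqP; split=> x; last by case=> [|[]]; [left|right].
  by case=> [Ax|Bx]; [left|have [Ax|nAx] := pselect (A x); [left|right]].
rewrite probU//; last by rewrite setDE setICA setICr setI0.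
by rewrite lerD2l; apply: prob_mono => // x [].
Qed.

Lemma prob_le_ae A B : measurable A -> measurable B -> m.-negligible (A `\` B) ->
  prob A <= prob B.
Proof.
move=> mA mB /(prob0P (measurableD mA mB)) AB.
by rewrite (probDI mA mB) AB add0r; apply: prob_mono => //; apply: measurableI.
Qed.

Lemma prob_bigcup_seq (I : eqType) (s : seq I) (F : I -> set X) : uniq s ->
  (forall i, measurable (F i)) ->
  (forall i j x, i \in s -> j \in s -> F i x -> F j x -> i = j) ->
  measurable [set x | exists2 i, i \in s & F i x] /\
  prob [set x | exists2 i, i \in s & F i x] = \sum_(i <- s) prob (F i).
Proof.
move=> us mF; elim: s us => [|i s IH] /=.
  move=> _ _; rewrite big_nil (_ : [set _ | _] = set0); last first.
    by apply/seteqP; split => x // [].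
  by rewrite prob_set0.
move=> /andP[is_ us] triv; have [|mU PU] := IH us.
  by move=> j k x js ks; apply: triv; rewrite inE ?js ?ks orbT.
have -> : [set x | exists2 j, j \in i :: s & F j x] =
    F i `|` [set x | exists2 j, j \in s & F j x].
  apply/seteqP; split => x /=.
    by move=> [j]; rewrite inE => /orP[/eqP->|js] Fj; [left|right; exists j].
  case=> [Fi|[j js Fj]]; first by exists i; rewrite ?mem_head.
  by exists j => //; rewrite inE js orbT.
split; first exact: measurableU.
rewrite probU//; first by rewrite big_cons PU.
apply/seteqP; split => x // [Fi [j js Fj]].
move: is_; rewrite (_ : i = j) ?js//.
by apply: (triv i j x); rewrite ?mem_head// inE js orbT.
Qed.

Lemma prob_union_seq_le (I : eqType) (s : seq I) (F : I -> set X) :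
  (forall i, measurable (F i)) ->
  measurable [set x | exists2 i, i \in s & F i x] /\
  prob [set x | exists2 i, i \in s & F i x] <= \sum_(i <- s) prob (F i).
Proof.
move=> mF; elim: s => [|i s [mU PU]] /=.
  rewrite big_nil (_ : [set _ | _] = set0); last first.
    by apply/seteqP; split => x // [].
  by rewrite prob_set0.
have -> : [set x | exists2 j, j \in i :: s & F j x] =
    F i `|` [set x | exists2 j, j \in s & F j x].
  apply/seteqP; split => x /=.
    by move=> [j]; rewrite inE => /orP[/eqP->|js] Fj; [left|right; exists j].
  case=> [Fi|[j js Fj]]; first by exists i; rewrite ?mem_head.
  by exists j => //; rewrite inE js orbT.
split; first exact: measurableU.
by rewrite big_cons (le_trans (probU_le _ _))// lerD2l.
Qed.

Lemma prob_decreasing (F : nat -> set X) : (forall n, measurable (F n)) ->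
  (forall i j, (i <= j)%N -> F j `<=` F i) -> m.-negligible (\bigcap_n F n) ->
  forall e, 0 < e -> exists n, prob (F n) < e.
Proof.
move=> mF dF F0 e e0.
have mcap : measurable (\bigcap_n F n) by exact: bigcapT_measurable.
have F00 : m (\bigcap_n F n) = 0%E by exact/(negligibleP m mcap).
have cv : (m \o F) x @[x --> \oo] --> m (\bigcap_n F n).
  apply: nonincreasing_cvg_mu => //; first exact: le_lt_trans (probability_le1 m (mF 0%N)) (ltry 1).
  by move=> i j ij; apply/subsetPset/dF.
rewrite F00 in cv.
have cv' : prob (F n) @[n --> \oo] --> (0 : R) by exact: (fine_cvg cv).
have /cvgrPdist_lt/(_ e e0)[n _ nP] := cv'.
exists n; have := nP n (leqnn n); rewrite /= sub0r normrN.
by rewrite ger0_norm//; apply: fine_ge0.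
Qed.

(** The cells are added one at a time along an enumeration; continuity from above removes what
    remains of [A], so no infinite sum is formed. *)
Lemma prob_le_partition (I : Type) (J : set I) (F : I -> set X) A B (c : R) :
  countable J -> (forall i, J i -> measurable (F i)) ->
  (forall i j x, J i -> J j -> F i x -> F j x -> i = j) ->
  measurable A -> measurable B -> m.-negligible (A `\` \bigcup_(i in J) F i) ->
  (forall i, J i -> prob (A `&` F i) <= c * prob (B `&` F i)) ->
  0 <= c -> prob A <= c * prob B.
Proof.
move=> /countable_injP[f finj] mF triv mA mB AF le_F c0.
pose G n := [set x | exists i, [/\ J i, (f i < n)%N & F i x]].
have GS n : G n.+1 = G n \/ exists2 i, J i & G n.+1 = G n `|` F i /\ G n `&` F i = set0.
  have [[i [Ji fi]]|no] := pselect (exists i, J i /\ f i = n).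
    right; exists i => //; split; apply/seteqP; split => x //.
    - move=> [j [Jj]]; rewrite ltnS leq_eqVlt => /orP[/eqP fj|fj] Fj.
        by right; rewrite (_ : i = j)//; apply: finj; rewrite ?inE// fi fj.
      by left; exists j.
    - case=> [[j [Jj fj Fj]]|Fi]; first by exists j; split => //; apply: ltnW.
      by exists i; rewrite fi.
    - move=> [[j [Jj fj Fj]] Fi]; move: fj; rewrite (triv j i x)// fi ltnn//.
  left; apply/seteqP; split => x [j [Jj fj Fj]]; exists j; split => //.
    move: fj; rewrite ltnS leq_eqVlt => /orP[/eqP fj|//].
    by exfalso; apply: no; exists j.
  exact: ltnW.
have mG n : measurable (G n).
  elim: n => [|n IH].
    by rewrite (_ : G 0 = set0)//; apply/seteqP; split => x // [i []].
  by case: (GS n) => [->//|[i Ji [-> _]]]; apply: measurableU => //; apply: mF.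
have le_G n : prob (A `&` G n) <= c * prob (B `&` G n).
  elim: n => [|n IH].
    rewrite (_ : G 0 = set0) ?setI0 ?prob_set0 ?mulr0//.
    by apply/seteqP; split => x // [i []].
  case: (GS n) => [->//|[i Ji [-> GF]]].
  have mFi := mF i Ji.
  rewrite !setIUr !probU ?mulrDr; do ?exact: measurableI.
  - by apply: lerD => //; apply: le_F.
  - by rewrite setIACA setIid GF setI0.
  - by rewrite setIACA setIid GF setI0.
apply/ler_addgt0Pr => e e0.
have [|||n nP] := @prob_decreasing (fun n => A `\` G n) _ _ _ e e0.
- by move=> n; apply: measurableD.
- move=> i j ij x [Ax nG]; split=> // -[k [Jk fk Fk]]; apply: nG.
  by exists k; split=> //; apply: leq_trans fk _.
- apply: negligibleS AF => x capx; have [Ax _] := capx 0%N Logic.I.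
  split=> // -[i Ji Fi]; have [_] := capx (f i).+1 Logic.I; apply.
  by exists i.
rewrite (probDI mA (mG n)) addrC; apply: lerD; last exact: ltW.
apply: le_trans (le_G n) _; rewrite ler_wpM2l//; apply: prob_mono => //.
exact: measurableI.
Qed.

End RealProbability.

(** What [theta] with [alpha] and the induced map with its partition have in common. Letters are
    disjoint exactly, not only mod null sets, so that a point determines the word of given length
    whose cylinder contains it. *)
Record markov_system {d : measure_display} {X : measurableType d} {R : realType}
    (m : probability X R) (th : X -> X) (al : set (set X)) : Prop := MarkovSystem {
  ms_countable : countable al ;
  ms_letter : forall a, al a -> measurable a ;
  ms_disjoint : forall a b x, al a -> al b -> a x -> b x -> a = b ;
  ms_cover : m.-negligible (~` \bigcup_(a in al) a) ;
  ms_measurable : measurable_fun setT th ;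
  ms_image : forall a A, al a -> measurable A -> A `<=` a -> measurable (th @` A) ;
  ms_null : forall a A, al a -> measurable A -> A `<=` a -> m A = 0%E ->
    m (th @` A) = 0%E
}.

Section MarkovSystem.
Context {d : measure_display} {X : measurableType d} {R : realType}.
Variables (m : probability X R) (th : X -> X) (al : set (set X)).
Implicit Types (A B N : set X) (a b : set X) (v w : seq (set X)).
Hypothesis MS : markov_system m th al.

Let al_measurable := ms_letter MS.
Let al_disjoint := ms_disjoint MS.
Let th_measurable := ms_measurable MS.
Let th_image := ms_image MS.
Let th_null := ms_null MS.

Definition word_in w := forall a, a \in w -> al a.

Lemma word_in_cons a w : word_in (a :: w) -> al a /\ word_in w.
Proof.
move=> h; split; first by apply: h; rewrite mem_head.
by move=> b bw; apply: h; rewrite inE bw orbT.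
Qed.

Lemma word_in_cat v w : word_in (v ++ w) <-> word_in v /\ word_in w.
Proof.
split=> [h|[hv hw] a]; last by rewrite mem_cat => /orP[/hv|/hw].
by split=> a aw; apply: h; rewrite mem_cat aw ?orbT.
Qed.

Lemma iter_measurable n A : measurable A -> measurable (iter n th @^-1` A).
Proof.
elim: n A => // n IH A mA.
rewrite (_ : _ @^-1` _ = iter n th @^-1` (th @^-1` A))//; apply: IH.
by rewrite -[_ @^-1` _]setTI; apply: th_measurable.
Qed.

Lemma cylinder_nil : cylinder th [::] = setT.
Proof. by apply/seteqP; split. Qed.

Lemma cylinder_cons a w : cylinder th (a :: w) = a `&` th @^-1` cylinder th w.
Proof.
apply/seteqP; split=> x /=.
  move=> h; split; first exact: (h 0%N).
  by move=> k kw; have := h k.+1 kw; rewrite iterSr.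
by move=> [ax h] [//|k] kw; rewrite iterSr; apply: h.
Qed.

Lemma cylinder_cat v w :
  cylinder th (v ++ w) = cylinder th v `&` iter (size v) th @^-1` cylinder th w.
Proof.
elim: v => [|a v IH]; first by rewrite cylinder_nil setTI.
rewrite /= !cylinder_cons IH -setIA; congr (_ `&` _).
by apply/seteqP; split=> x /=; rewrite -iterSr.
Qed.

Lemma cylinder_measurable w : word_in w -> measurable (cylinder th w).
Proof.
elim: w => [|a w IH]; first by rewrite cylinder_nil.
move=> /word_in_cons[aa /IH mw]; rewrite cylinder_cons.
by apply: measurableI; [exact: al_measurable|exact: (@iter_measurable 1)].
Qed.

Lemma cylinder_disjoint v w x : word_in v -> word_in w -> size v = size w ->
  cylinder th v x -> cylinder th w x -> v = w.
Proof.
elim: v w x => [|a v IH] [|b w]// x /word_in_cons[aa hv] /word_in_cons[bb hw] [] vw.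
rewrite !cylinder_cons => -[ax vx] [bx wx].
by rewrite (al_disjoint aa bb ax bx) (IH w (th x)).
Qed.

Lemma iter_image w A : word_in w -> measurable A -> A `<=` cylinder th w ->
  measurable (iter (size w) th @` A) /\
  (m A = 0%E -> m (iter (size w) th @` A) = 0%E).
Proof.
elim: w A => [|a w IH] A.
  by move=> _ mA _ /=; rewrite (_ : [set _ | _ in _] = A)// image_id.
move=> /word_in_cons[aa ww] mA; rewrite cylinder_cons => Aaw.
have Aa : A `<=` a by move=> x /Aaw[].
have mthA := th_image aa mA Aa.
have [|m1 m2] := IH (th @` A) ww mthA.
  by move=> _ [x /Aaw[_ ?] <-].
rewrite (_ : _ @` A = iter (size w) th @` (th @` A)); last first.
  rewrite image_comp; apply/eq_imagel => x _ /=.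
  by rewrite -iterSr.
by split => // A0; apply/m2/(th_null aa).
Qed.

Lemma branch_dom_measurable w : word_in w -> measurable (branch_dom th w).
Proof. by move=> ww; apply: (iter_image ww (cylinder_measurable ww) _).1. Qed.

Lemma branch_dom_full a w A : word_in (a :: w) -> measurable A ->
  (forall k, (k < size w)%N ->
    m (nth set0 (a :: w) k.+1 `\` th @` nth set0 (a :: w) k) = 0%E) ->
  m (A `\` th @` last a w) = 0%E ->
  m.-negligible (A `\` branch_dom th (a :: w)).
Proof.
elim: w a => [|b w IH] a ww mA.
  move=> _ Alast; rewrite /branch_dom cylinder_cons cylinder_nil preimage_setT setIT/=.
  apply/negligibleP => //; apply: measurableD => //.
  have [aa _] := word_in_cons ww.
  by apply: (th_image aa) => //; apply: al_measurable.
move=> trans Alast; have [aa wbw] := word_in_cons ww.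
have ma := al_measurable aa; have mta := th_image aa ma (@subset_refl _ _).
have mbw := cylinder_measurable wbw.
have h1 : m.-negligible (A `\` branch_dom th (b :: w)).
  by apply: IH => // k kw; apply: (trans k.+1).
pose Bd := cylinder th (b :: w) `\` th @` a.
have mBd : measurable Bd by exact: measurableD.
have Bd0 : m Bd = 0%E.
  apply: (subset_measure0 mBd _ _ (trans 0%N isT)) => /=.
    by apply: measurableD => //; apply: al_measurable; apply: wbw; rewrite mem_head.
  by move=> x []; rewrite cylinder_cons => -[bx _] nth; split.
have [mi i0] := iter_image wbw mBd (@subDsetl _ _ _).
have h2 : m.-negligible (iter (size (b :: w)) th @` Bd).
  by apply/negligibleP => //; apply: i0.
apply: negligibleS (negligibleU h1 h2) => x [Ax nx].
have [[y ybw yx]|nbr] := pselect (branch_dom th (b :: w) x); last by left.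
right; exists y => //; split=> // -[z az zy]; apply: nx.
exists z; last by rewrite iterSr zy.
by rewrite cylinder_cons; split => //; rewrite /= zy.
Qed.

(** * Comparing measures through a Jacobian of bounded distortion *)

Section JacobianComparison.
Variables (w : seq (set X)) (phi : X -> R) (A N : set X) (E : R).
Hypotheses (w_in : word_in w) (phiP : is_jacobian m th w phi) (mA : measurable A).
Hypotheses (A_dom : m.-negligible (A `\` branch_dom th w)) (N0 : m.-negligible N).
Hypothesis phi_dist : forall x y, (A `&` branch_dom th w `\` N) x ->
  (A `&` branch_dom th w `\` N) y -> `|ln (phi x) - ln (phi y)| <= E.

Let P := branch_dom th w.
Let pull B := cylinder th w `&` iter (size w) th @^-1` B.
Let mP : measurable P. Proof. exact: branch_dom_measurable. Qed.
Let mpull B : measurable B -> measurable (pull B).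
Proof.
move=> mB; apply: measurableI; first exact: cylinder_measurable.
exact: iter_measurable.
Qed.

Let jac B : measurable B -> B `<=` P -> m (pull B) = (\int[m]_(y in B) (phi y)%:E)%E.
Proof. by case: phiP => _ _; apply. Qed.

Let mphi B : measurable B -> B `<=` P -> measurable_fun B (EFin \o phi).
Proof.
move=> mB BP; apply/measurable_EFinP; case: phiP => mf _ _.
exact: measurable_funS mf.
Qed.

Let pull_null B : measurable B -> B `<=` P -> m B = 0%E -> m (pull B) = 0%E.
Proof. by move=> mB BP B0; rewrite jac// null_set_integral//; exact: mphi. Qed.

(* [phi] is only nonnegative and [ln 0 = 0], so that the bound on [ln phi] says
   nothing on its zero set, which has to be removed by nonsingularity. *)
Let Z := P `&` phi @^-1` [set 0].

Let mZ : measurable Z.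
Proof. by case: phiP => mf _ _; apply: mf. Qed.

Let Z0 : m Z = 0%E.
Proof.
have mpZ := mpull mZ.
have h : m (pull Z) = 0%E.
  rewrite jac//; last by move=> x [].
  by rewrite (eq_integral (cst 0%E)) ?integral0// => x; rewrite inE => -[_ ->].
have sub : pull Z `<=` cylinder th w by move=> x [].
have [_ /(_ h)] := iter_image w_in mpZ sub.
rewrite (_ : _ @` _ = Z)//; apply/seteqP; split=> [_ [x [_ Zx] <-]//|y [[x cx <-] Zy]].
by exists x => //; split => //; split => //; exists x.
Qed.

(** The constant [c] is the value of [phi] at one good point: by the distortion bound [phi] equals
    it up to [expR E] almost everywhere on [A]. *)
Lemma jacobian_pivot : prob m A != 0 -> exists2 c : R, 0 < c &
  forall B, measurable B -> B `<=` A ->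
    prob m (pull B) <= expR E * c * prob m B /\
    c * prob m B <= expR E * prob m (pull B).
Proof.
move=> A0; have [N' [mN' N'0 NN']] := N0.
pose G := A `&` P `\` (Z `|` N').
have mAP : measurable (A `&` P) by exact: measurableI.
have mZN : measurable (Z `|` N') by exact: measurableU.
have mG : measurable G by exact: measurableD.
have ZN0 : m.-negligible (Z `|` N').
  by apply: negligibleU; apply/negligibleP.
have AG0 : m.-negligible (A `\` G).
  apply: negligibleS (negligibleU A_dom ZN0) => x [Ax nG].
  have [Px|nP] := pselect (P x); last by left.
  by right; apply: contrapT => nZN; apply: nG.
have [y Gy] : G !=set0.
  apply/set0P/eqP => G0; move/eqP: A0; apply; apply/prob0P => //.
  by rewrite G0 setD0 in AG0.
have phi_gt0 x : G x -> 0 < phi x.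
  move=> [[Ax Px] nZN]; rewrite lt_def; case: phiP => _ /(_ x Px) -> _; rewrite andbT.
  by apply/eqP => px0; apply: nZN; left.
have phi_le x x' : G x -> G x' -> phi x <= expR E * phi x'.
  move=> Gx Gx'; rewrite -[phi x]lnK ?posrE ?phi_gt0//.
  rewrite -[phi x' in leRHS]lnK ?posrE ?phi_gt0// -expRD ler_expR -lerBlDr.
  apply: le_trans (ler_norm _) _; apply: phi_dist.
    by case: Gx => AP nZN; split=> // Nx; apply: nZN; right; apply: NN'.
  by case: Gx' => AP nZN; split=> // Nx; apply: nZN; right; apply: NN'.
exists (phi y); first exact: phi_gt0.
move=> B mB BA.
pose B' := B `&` G.
have mB' : measurable B' by exact: measurableI.
have B'P : B' `<=` P by move=> x [_ [[]]].
have BB'0 : m.-negligible (B `\` B').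
  by apply: negligibleS AG0 => x [Bx nB']; split; [exact: BA|move=> Gx; apply: nB'].
have PB : prob m B = prob m B'.
  apply/eqP; rewrite eq_le; apply/andP; split; first exact: prob_le_ae.
  by apply: prob_mono => // x [].
have mBB' : measurable (B `\` B') by exact: measurableD.
have mD : measurable ((B `\` B') `&` P) by exact: measurableI.
have Ppull : prob m (pull B) = prob m (pull B').
  apply/eqP; rewrite eq_le; apply/andP; split; last first.
    apply: prob_mono; [exact: mpull|exact: mpull|].
    by move=> x [cx [Bx _]].
  apply: prob_le_ae; [exact: mpull|exact: mpull|].
  have h0 : m.-negligible (pull ((B `\` B') `&` P)).
    apply/negligibleP; first exact: mpull.
    apply: pull_null => //.
    by apply/(negligibleP m mD); apply: negligibleS BB'0 => x [].
  apply: negligibleS h0 => x [[cx Bx] nx]; split=> //; split; last by exists x.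
  by split=> // B'x; apply: nx.
have PI : (prob m (pull B'))%:E = (\int[m]_(y in B') (phi y)%:E)%E.
  by rewrite -probE ?jac//; apply: mpull.
have phi0 x : B' x -> (0 <= (phi x)%:E)%E.
  by move=> [_ Gx]; rewrite lee_fin ltW// phi_gt0.
rewrite PB Ppull; split; rewrite -lee_fin.
  rewrite PI EFinM -probE// -integral_cst//; apply: ge0_le_integral => //.
  - exact: mphi.
  - by move=> x [_ Gx]; rewrite lee_fin phi_le.
rewrite EFinM -probE// -integral_cst// EFinM PI -ge0_integralZl//; last exact: mphi.
apply: ge0_le_integral => //.
- by move=> x B'x; rewrite lee_fin ltW// phi_gt0.
- by apply: measurable_funeM; exact: mphi.
- by move=> x [_ Gx]; rewrite -EFinM lee_fin phi_le.
Qed.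

(** The unknown pivot cancels between the bounds for [A] and for [B], at the price of two factors
    [expR E]. *)
Lemma jacobian_comparison B : measurable B -> B `<=` A ->
  prob m (pull B) * prob m A <= expR (2 * E) * (prob m (pull A) * prob m B) /\
  prob m (pull A) * prob m B <= expR (2 * E) * (prob m (pull B) * prob m A).
Proof.
move=> mB BA; have [A0|A0] := eqVneq (prob m A) 0.
  have B0 : prob m B = 0.
    by apply/eqP; rewrite eq_le prob_ge0 -A0 prob_mono.
  by rewrite A0 B0 !mulr0; split.
have [c c0 cP] := jacobian_pivot A0.
have [a1 a2] := cP A mA (@subset_refl _ _); have [b1 b2] := cP B mB BA.
have pA := prob_ge0 m A; have pB := prob_ge0 m B.
have -> : expR (2 * E) = expR E * expR E by rewrite -expRD; congr expR; ring.
split.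
  apply: le_trans (ler_wpM2r pA b1) _.
  rewrite [leLHS](_ : _ = expR E * prob m B * (c * prob m A)); last by ring.
  rewrite [leRHS](_ : _ = expR E * prob m B * (expR E * prob m (pull A))); last by ring.
  by rewrite ler_wpM2l// mulr_ge0// expR_ge0.
apply: le_trans (ler_wpM2r pB a1) _.
rewrite [leLHS](_ : _ = expR E * prob m A * (c * prob m B)); last by ring.
rewrite [leRHS](_ : _ = expR E * prob m A * (expR E * prob m (pull B))); last by ring.
by rewrite ler_wpM2l// mulr_ge0// expR_ge0.
Qed.

End JacobianComparison.

End MarkovSystem.

(** * Full-branched systems *)

Section Cocycles.
Context {d : measure_display} {X : measurableType d} {V : countType}.
Variables (th : X -> X) (k : X -> V -> V).
Hypothesis th_measurable : measurable_fun setT th.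
Hypothesis k_measurable : forall g h, measurable [set x | k x g = h].

Lemma cocycle_iterD i j x g : cocycle_iter th k (i + j) x g =
  cocycle_iter th k j (iter i th x) (cocycle_iter th k i x g).
Proof.
elim: j => [|j IH]; first by rewrite addn0.
by rewrite addnS /= IH addnC iterD.
Qed.

Lemma cocycle_measurable n g h : measurable [set x | cocycle_iter th k n x g = h].
Proof.
elim: n h => [|n IH] h.
  have [->|/eqP gh] := eqVneq g h.
    by rewrite (_ : [set _ | _] = setT)//; apply/seteqP; split.
  by rewrite (_ : [set _ | _] = set0)//; apply/seteqP; split.
rewrite (_ : [set _ | _] = \bigcup_(l in [set: V])
   ([set x | cocycle_iter th k n x g = l] `&` iter n th @^-1` [set x | k x l = h])).
  apply: countable_bigcupT_measurable; first exact: countableP.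
  move=> l; apply: measurableI => //.
  elim: n {IH} => [|n IHn]; first by rewrite (_ : _ @^-1` _ = [set x | k x l = h]).
  rewrite (_ : iter n.+1 th @^-1` _ = th @^-1` (iter n th @^-1` [set x | k x l = h])).
    by rewrite -[_ @^-1` _]setTI; apply: th_measurable.
  by apply/seteqP; split => x /=; rewrite -iterS iterSr.
apply/seteqP; split => x /=.
  by move=> e; exists (cocycle_iter th k n x g).
by move=> [l _ [<- e]].
Qed.

End Cocycles.

Definition birkhoff (X : Type) (th : X -> X) (t : X -> nat) n x : nat :=
  \sum_(i < n) t (iter i th x).

Section FullSystem.
Context {d : measure_display} {X : measurableType d} {R : realType}.
Variables (m : probability X R) (th : X -> X) (al : set (set X)) (C r : R) (D : set X).
Hypothesis MS : markov_system m th al.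
Hypothesis al_gt0 : forall a, al a -> (0 < m a)%E.
Hypothesis al_full : forall a, al a -> m (~` (th @` a)) = 0%E.
Hypotheses (C_gt0 : 0 < C) (r01 : 0 < r < 1) (D_full : m.-negligible (~` D)).
Hypothesis bounded_distortion : forall w, finite_words m th al w ->
  distortion_le m th w D C (dist_r th al r).

(** Points of a cylinder of length [i] are at distance at most [r ^+ i]; the factor 2 is that of
    [jacobian_comparison]. *)
Definition dfactor (i : nat) : R := expR (2 * (C * r ^+ i)).

Lemma dfactor_ge1 i : 1 <= dfactor i.
Proof.
case/andP: r01 => r0 _.
rewrite -expR0 ler_expR !mulr_ge0//; [exact: ltW|exact/exprn_ge0/ltW].
Qed.

Lemma dfactor_small x : 0 < x -> exists2 l, (0 < l)%N & dfactor l <= 1 + x.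
Proof.
move=> x0; case/andP: r01 => r0 r1.
have lnx : 0 < ln (1 + x) by rewrite ln_gt0// ltrDl.
have lC : 0 < ln (1 + x) / (2 * C) by rewrite divr_gt0// mulr_gt0.
have r01' : 0 <= r < 1 by rewrite (ltW r0).
have [n nP] := exists_expr_lt r01' lC.
exists n.+1 => //; rewrite -[leRHS]lnK; last by rewrite posrE; lra.
rewrite ler_expR mulrA mulrC -ler_pdivlMr; last by rewrite mulr_gt0.
by rewrite ltW// nP.
Qed.

Lemma dist_r_le v x y : word_in al v -> cylinder th v x -> cylinder th v y ->
  dist_r th al r x y <= r ^+ size v.
Proof.
move=> vv vx vy; case/andP: r01 => r0 r1; rewrite /dist_r; case: pselect => [e|_]; last first.
  by rewrite exprn_ge0// ltW.
case: ex_minnP => i /asboolP ni _; apply: ler_wiXn2l; [exact: ltW|exact: ltW|].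
rewrite leqNgt; apply/negP => iv; apply: ni; exists (nth set0 v i).
  by apply: vv; rewrite mem_nth.
by split; [apply: vx|apply: vy].
Qed.

Lemma finite_words_full w : w != [::] -> word_in al w -> finite_words m th al w.
Proof.
move=> w0 ww; exists (size w) => //; split=> //.
- by rewrite lt0n size_eq0.
- by move=> i iw; apply: ww; rewrite mem_nth.
move=> i iw; have ai : al (nth set0 w i) by apply: ww; rewrite mem_nth// ltnW.
have ai1 : al (nth set0 w i.+1) by apply: ww; rewrite mem_nth.
have mi : measurable (th @` nth set0 w i).
  by apply: (ms_image MS ai) => //; apply: (ms_letter MS).
have mi1 := ms_letter MS ai1.
apply: (@subset_measure0 _ _ _ m _ (~` (th @` nth set0 w i))) => //.
- exact: measurableD.
- exact: measurableC.
exact: al_full.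
Qed.

Lemma full_branch w A : w != [::] -> word_in al w -> measurable A ->
  m.-negligible (A `\` branch_dom th w).
Proof.
case: w => // a w _ ww mA.
have aw b : b \in a :: w -> measurable (th @` b) /\ m (~` (th @` b)) = 0%E.
  move=> /ww bb; split; last exact: al_full.
  by apply: (ms_image MS bb) => //; apply: (ms_letter MS).
have null B b : b \in a :: w -> measurable B -> m (B `\` th @` b) = 0%E.
  move=> /aw[mb b0] mB; apply: (@subset_measure0 _ _ _ m _ (~` (th @` b))) => //.
    exact: measurableD.
  exact: measurableC.
apply: (branch_dom_full MS) => //.
  move=> i iw; apply: null; first by rewrite mem_nth// ltnW.
  by apply/(ms_letter MS)/ww; rewrite mem_nth.
by apply: null => //; rewrite mem_last.
Qed.

(** On the cylinder of [v] the Jacobian of the branch [a] is constant up to the distortion, so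
    pulling back by this branch nearly preserves proportions inside that cylinder. *)
Lemma quasi_bernoulli_set a v B : word_in al a -> word_in al v -> measurable B ->
  B `<=` cylinder th v ->
  let P := cylinder th a `&` iter (size a) th @^-1` B in
  prob m P * prob m (cylinder th v) <=
    dfactor (size v) * (prob m (cylinder th (a ++ v)) * prob m B) /\
  prob m (cylinder th (a ++ v)) * prob m B <=
    dfactor (size v) * (prob m P * prob m (cylinder th v)).
Proof.
(* The distortion bound concerns nonempty words; for the empty word both claims reduce to [dfactor]
   being at least 1. *)
move=> aa vv mB Bv /=; have [->|a0] := eqVneq a [::].
  rewrite cylinder_nil setTI cat0s (_ : _ @^-1` B = B)//.
  rewrite [prob m B * _]mulrC; split;
  by rewrite ler_peMl ?mulr_ge0 ?prob_ge0 ?dfactor_ge1.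
have [phi [phiP [N N0 phi_dist]]] := bounded_distortion (finite_words_full a0 aa).
have mv := cylinder_measurable MS vv.
rewrite cylinder_cat.
apply: (jacobian_comparison MS aa phiP mv _ (N := N `|` ~` D)) => //.
- exact: full_branch.
- exact: negligibleU.
move=> x y [[vx bx] nx] [[vy by_] ny]; apply: le_trans (phi_dist x y _ _) _.
- split; last by move=> Nx; apply: nx; left.
  by split => //; apply: contrapT => nD; apply: nx; right.
- split; last by move=> Nx; apply: ny; left.
  by split => //; apply: contrapT => nD; apply: ny; right.
by rewrite ler_wpM2l ?(ltW C_gt0)//; apply: dist_r_le.
Qed.

Lemma quasi_bernoulli_event a B : word_in al a -> measurable B ->
  prob m (cylinder th a `&` iter (size a) th @^-1` B) <=
    dfactor 0 * (prob m (cylinder th a) * prob m B).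
Proof.
move=> aa mB; have nn : word_in al [::] by [].
have := (@quasi_bernoulli_set a [::] B aa nn mB _).1.
by rewrite cylinder_nil prob_setT mulr1 cats0; apply.
Qed.

(** The measure is not assumed invariant under [th]; inside each letter the distortion bound makes
    the preimage of a null set null. *)
Lemma preimage_null E n : measurable E -> m E = 0%E -> m (iter n th @^-1` E) = 0%E.
Proof.
move=> mE E0; elim: n => // n IH.
rewrite (_ : iter n.+1 th @^-1` E = th @^-1` (iter n th @^-1` E)); last first.
  by apply/seteqP; split=> x /=; rewrite -iterS iterSr.
have mF := iter_measurable MS n mE.
move: (iter n th @^-1` E) mF IH => F mF F0 {E mE E0 n}.
have mpF : measurable (th @^-1` F) := iter_measurable MS 1 mF.
have PF : prob m F = 0 by rewrite /prob F0.
rewrite probE//; congr EFin; apply/eqP; rewrite eq_le prob_ge0 andbT.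
rewrite -(mul0r (prob m F)).
apply: (prob_le_partition (ms_countable MS) (F := id)) => //.
- exact: ms_letter MS.
- exact: ms_disjoint MS.
- by apply: negligibleS (ms_cover MS) => x [].
move=> a aa; have aw : word_in al [:: a] by move=> b; rewrite inE => /eqP->.
have := quasi_bernoulli_event aw mF.
rewrite PF !mulr0 mul0r cylinder_cons cylinder_nil preimage_setT setIT/=.
by rewrite setIC.
Qed.

(** * Masses of cylinders and exhaustion by finite alphabets *)

Section Letters.
Local Notation B := (set_type al).
Implicit Types (w z : seq B) (L : seq B) (b : B).

Definition cyl w : set X := cylinder th (map val w).

Definition mass w : R := prob m (cyl w).

Lemma word_in_letters w : word_in al (map val w).
Proof. by move=> a /mapP[b _ ->]; apply: set_valP. Qed.
Local Hint Resolve word_in_letters : core.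

Lemma cyl_measurable w : measurable (cyl w).
Proof. exact: (cylinder_measurable MS). Qed.
Local Hint Resolve cyl_measurable : core.

Lemma cyl_disjoint w z x : size w = size z -> cyl w x -> cyl z x -> w = z.
Proof.
move=> wz wx zx; apply: (inj_map val_inj).
by apply: (cylinder_disjoint MS (x := x)) => //; rewrite !size_map.
Qed.

Lemma mass_nil : mass [::] = 1.
Proof. by rewrite /mass /cyl cylinder_nil prob_setT. Qed.

Lemma mass_quasi u v w :
  mass (u ++ v ++ w) * mass v <= dfactor (size v) * (mass (u ++ v) * mass (v ++ w)).
Proof.
have sub : cyl (v ++ w) `<=` cylinder th (map val v).
  by rewrite /cyl map_cat cylinder_cat; apply: subIsetl.
have [+ _] := quasi_bernoulli_set (@word_in_letters u) (@word_in_letters v)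
  (cyl_measurable (v ++ w)) sub.
by rewrite /mass {1}/cyl -cylinder_cat -!map_cat size_map.
Qed.

Lemma mass_quasi' v w : mass v * mass w <= dfactor 0 * mass (v ++ w).
Proof.
have nn : word_in al [::] by [].
have := (@quasi_bernoulli_set (map val v) [::] (cyl w) _ nn (cyl_measurable w) _).2.
rewrite cats0 cylinder_nil prob_setT mulr1 /mass /cyl map_cat cylinder_cat.
by apply.
Qed.

Lemma dfactor_gt0 i : 0 < dfactor i.
Proof. exact: lt_le_trans ltr01 (dfactor_ge1 i). Qed.

Lemma mass_gt0 w : 0 < mass w.
Proof.
elim: w => [|b w IH]; first by rewrite mass_nil.
rewrite -(pmulr_rgt0 _ (dfactor_gt0 0)); apply: lt_le_trans (mass_quasi' [:: b] w).
rewrite mulr_gt0// -lte_fin -probE//.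
rewrite /cyl/= cylinder_cons cylinder_nil preimage_setT setIT.
exact/al_gt0/set_valP.
Qed.

Lemma cyl_rcons w b : cyl (rcons w b) = cyl w `&` iter (size w) th @^-1` val b.
Proof.
rewrite -cats1 /cyl map_cat cylinder_cat size_map/=.
by rewrite cylinder_cons cylinder_nil preimage_setT setIT.
Qed.

Lemma mass_sum_eq L w : uniq L -> \sum_(b <- L) mass (rcons w b) =
  mass w - prob m (cyl w `&` iter (size w) th @^-1`
    ~` [set x | exists2 b, b \in L & val b x]).
Proof.
move=> uL.
have [||mU PU] := @prob_bigcup_seq _ _ _ m B L (fun b => cyl (rcons w b)) uL.
- by move=> b; apply: cyl_measurable.
- move=> b b' x _ _ bx b'x.
  have := cyl_disjoint _ bx b'x; rewrite !size_rcons => /(_ erefl).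
  by move/rcons_inj => [].
have mL : measurable [set x | exists2 b : B, b \in L & val b x].
  apply: (@prob_bigcup_seq _ _ _ m B L val uL _ _).1.
    by move=> b; apply/(ms_letter MS)/set_valP.
  move=> b b' x _ _ bx b'x; apply: val_inj.
  by apply: (ms_disjoint MS) bx b'x; apply: set_valP.
set U := [set x | _] in mU PU; set U' := [set x | _].
have WU : cyl w `&` U = U.
  apply/seteqP; split=> x [] //.
  by move=> b bL bx; split; [move: bx; rewrite cyl_rcons => -[]|exists b].
have WU' : cyl w `\` U = cyl w `&` iter (size w) th @^-1` ~` U'.
  apply/seteqP; split => x [wx h]; split => //.
    by move=> [b bL bx]; apply: h; exists b => //; rewrite cyl_rcons.
  by move=> [b bL]; rewrite cyl_rcons => -[_ bx]; apply: h; exists b.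
by rewrite -PU /mass (probDI m (cyl_measurable w) mU) WU WU'; ring.
Qed.

Lemma mass_sum L w : uniq L -> \sum_(b <- L) mass (rcons w b) <= mass w.
Proof. by move=> uL; rewrite mass_sum_eq// gerBl prob_ge0. Qed.

Lemma letters_exhaust x : 0 < x ->
  exists2 L : seq B, uniq L & 1 - x <= \sum_(b <- L) mass [:: b].
Proof.
move=> x0; have /countable_injP[f finj] := ms_countable MS.
have list n : exists L : seq B, uniq L /\ forall b, (b \in L) = (f (val b) < n)%N.
  elim: n => [|n [L [uL LP]]]; first by exists [::].
  have [[b fb]|nob] := pselect (exists b : B, f (val b) = n).
    exists (b :: L); split; first by rewrite /= uL LP fb ltnn.
    move=> b'; rewrite inE LP ltnS [RHS]leq_eqVlt; congr (_ || _).
    apply/eqP/eqP => [->//|fb']; apply: val_inj; apply: finj; last by rewrite fb.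
      by rewrite inE; apply: set_valP.
    by rewrite inE; apply: set_valP.
  exists L; split => // b; rewrite LP ltnS [RHS]leq_eqVlt.
  suff -> : (f (val b) == n) = false by [].
  by apply/eqP => fb; apply: nob; exists b.
pose U n := [set y | exists2 b : B, (f (val b) < n)%N & val b y].
have UE n L : (forall b, (b \in L) = (f (val b) < n)%N) ->
    [set y | exists2 b : B, b \in L & val b y] = U n.
  by move=> LP; apply/seteqP; split => y [b bL by_]; exists b => //; rewrite ?LP// -LP.
have mU n : measurable (U n).
  have [L [uL LP]] := list n; rewrite -(UE n L LP).
  by have [] := @prob_union_seq_le _ _ _ m B L val (fun b => ms_letter MS (set_valP b)).
have [|||n nP] := @prob_decreasing _ _ _ m (fun n => ~` U n) _ _ _ x x0.
- by move=> n; apply: measurableC.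
- move=> i j ij y nU [b bi by_]; apply: nU; exists b => //; exact: leq_trans ij.
- apply: negligibleS (ms_cover MS) => y capy [a aa ay].
  have [] := capy (f a).+1 Logic.I.
  by exists (SigSub (mem_set aa)).
have [L [uL LP]] := list n; exists L => //.
have := mass_sum_eq [::] uL; rewrite mass_nil (UE n L LP) => ->.
rewrite lerD2l lerN2; apply/ltW; apply: le_lt_trans nP.
by rewrite /cyl cylinder_nil setTI; apply: lexx.
Qed.

Lemma mass_sum_ge L w x : uniq L -> 1 - x <= \sum_(b <- L) mass [:: b] ->
  mass w * (1 - dfactor 0 * x) <= \sum_(b <- L) mass (rcons w b).
Proof.
move=> uL; have := mass_sum_eq [::] uL; rewrite mass_nil => -> Lx.
rewrite mass_sum_eq//.
set U := [set x | _] in Lx *.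
have mU : measurable U.
  by have [] := @prob_union_seq_le _ _ _ m B L val (fun b => ms_letter MS (set_valP b)).
have mUC : measurable (~` U) by exact: measurableC.
have UCx : prob m (~` U) <= x.
  by move: Lx; rewrite /cyl cylinder_nil setTI lerD2l lerN2.
have := quasi_bernoulli_event (@word_in_letters w) mUC.
rewrite size_map -/(cyl w) -/(mass w) => h.
rewrite mulrBr mulr1 lerD2l lerN2 mulrCA; apply: le_trans h _.
by rewrite ler_wpM2l ?(ltW (dfactor_gt0 _))// ler_wpM2l// ltW// mass_gt0.
Qed.

Lemma mass_words_ge L n w x : uniq L -> 0 <= dfactor 0 * x <= 1 ->
  1 - x <= \sum_(b <- L) mass [:: b] ->
  mass w * (1 - dfactor 0 * x) ^+ n <= \sum_(z <- words_over L n) mass (w ++ z).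
Proof.
move=> uL /andP[x0 x1] Lx; elim: n w => [|n IH] w.
  by rewrite expr0 mulr1 big_seq1 cats0.
rewrite sum_words_overS exprS mulrA.
apply: (@le_trans _ _ (\sum_(b <- L) mass (rcons w b) * (1 - dfactor 0 * x) ^+ n)).
  rewrite -mulr_suml ler_wpM2r ?exprn_ge0 ?subr_ge0//; exact: mass_sum_ge.
by apply: ler_sum => b _; under eq_bigr do rewrite -cat_rcons; apply: IH.
Qed.

Lemma words_exhaust n x : 0 < x ->
  exists2 L : seq B, uniq L & 1 - x <= \sum_(z <- words_over L n) mass z.
Proof.
move=> x0.
(* Each letter loses at most the fraction [y] of the mass, hence [n] letters at most [n * y <= x] by
   Bernoulli's inequality; the minimum keeps [1 - y] nonnegative. *)
pose y := Num.min 1 x / n.+1%:R.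
have min0 : 0 < Num.min 1 x by rewrite lt_min ltr01.
have y0 : 0 < y by rewrite divr_gt0.
have y1 : y <= 1 by rewrite ler_pdivrMr// mul1r ge_min ler1n.
have ny : n%:R * y <= x.
  rewrite /y mulrCA -[leRHS]mulr1 ler_pM// ?divr_ge0 ?ge_min ?lexx ?orbT// ?(ltW min0)//.
  by rewrite ler_pdivrMr// mul1r ler_nat.
have D0 := dfactor_gt0 0.
have [L uL Ly] := letters_exhaust (divr_gt0 y0 D0).
exists L => //.
have Dy : dfactor 0 * (y / dfactor 0) = y by rewrite mulrC divfK// gt_eqF.
have := @mass_words_ge L n [::] (y / dfactor 0) uL; rewrite Dy mass_nil mul1r.
move=> /(_ _ Ly) h; apply: le_trans (h _); last by rewrite (ltW y0).
have bern i : 1 - i%:R * y <= (1 - y) ^+ i.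
  elim: i => [|i IH]; first by rewrite mul0r subr0 expr0.
  rewrite exprS; apply: le_trans (ler_wpM2l _ IH); last by rewrite subr_ge0.
  have : 0 <= i%:R * y * y by rewrite !mulr_ge0// ltW.
  rewrite mulrS; lra.
by apply: le_trans (bern n); rewrite lerD2l lerN2.
Qed.

(** The passage between finite sums over words and the measure of events decided by [n] letters; the
    error is the mass not covered by words over [L]. *)
Lemma word_event_bounds A (P : pred (seq B)) n L : uniq L -> measurable A ->
  (forall z x, size z = n -> cyl z x -> A x <-> P z) ->
  let s := \sum_(z <- words_over L n) mass z * (P z)%:R in
  s <= prob m A <= s + (1 - \sum_(z <- words_over L n) mass z).
Proof.
move=> uL mA AP /=.
pose F z := if P z then cyl z else set0.
have mF z : measurable (F z) by rewrite /F; case: ifP.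
have uW := words_over_uniq n uL.
have disj z z' x : z \in words_over L n -> z' \in words_over L n ->
    cyl z x -> cyl z' x -> z = z'.
  rewrite !mem_words_over => /andP[/eqP sz _] /andP[/eqP sz' _].
  by apply: cyl_disjoint; rewrite sz sz'.
have [mU PU] := prob_bigcup_seq m uW cyl_measurable disj.
have [|mV PV] := @prob_bigcup_seq _ _ _ m _ (words_over L n) F uW mF.
  move=> z z' x zL z'L; rewrite /F; case: ifP => // _; case: ifP => // _.
  exact: disj.
have -> : \sum_(z <- words_over L n) mass z * (P z)%:R =
    \sum_(z <- words_over L n) prob m (F z).
  apply: eq_bigr => z _; rewrite /F; case: ifP => _; first by rewrite mulr1.
  by rewrite mulr0 prob_set0.
rewrite -PU -PV; apply/andP; split.
  apply: prob_mono => // x [z]; rewrite mem_words_over /F => /andP[/eqP sz _].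
  by case: ifP => // Pz zx; apply/(AP z x sz zx).
rewrite -prob_setC//; apply: le_trans (probU_le m mV (measurableC mU)).
apply: prob_mono => //; first by apply: measurableU => //; apply: measurableC.
move=> x Ax; have [[z zL zx]|nU] := pselect ([set x | exists2 z, z \in words_over L n & cyl z x] x).
  left; exists z => //; rewrite /F; move: (zL); rewrite mem_words_over => /andP[/eqP sz _].
  by rewrite (proj1 (AP z x sz zx) Ax).
by right.
Qed.

Lemma cyl_cons b w x : cyl (b :: w) x <-> val b x /\ cyl w (th x).
Proof. by rewrite /cyl/= cylinder_cons; split=> -[]. Qed.

Lemma cocycle_word (V : countType) (k : X -> V -> V) (kl : B -> V -> V) w x g :
  (forall b y h, val b y -> k y h = kl b h) -> cyl w x ->
  cocycle_iter th k (size w) x g = word_map kl w g.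
Proof.
move=> kE; elim: w x g => //= b w IH x g /cyl_cons[bx wx].
rewrite -[LHS]/(cocycle_iter th k (1 + size w) x g) cocycle_iterD.
by rewrite (IH (th x))//= (kE b x).
Qed.

Lemma birkhoff_word (t : X -> nat) (e : B -> nat) w x :
  (forall b y, val b y -> t y = e b) -> cyl w x ->
  birkhoff th t (size w) x = word_time e w.
Proof.
move=> tE; elim: w x => [|b w IH] x; first by rewrite /birkhoff big_ord0.
move=> /cyl_cons[bx wx]; rewrite /birkhoff/= big_ord_recl (tE b)//.
rewrite /word_time/=; congr addn; rewrite -[RHS](IH (th x))//.
by apply: eq_bigr => i _; rewrite -iterSr.
Qed.

End Letters.
End FullSystem.

(** * The embedded system *)

Lemma bigcup_measurable_countable d (X : measurableType d) (I : Type) (J : set I)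
    (F : I -> set X) : countable J -> (forall i, J i -> measurable (F i)) ->
  measurable (\bigcup_(i in J) F i).
Proof.
move=> /countable_injP[f finj] mF.
pose G n := [set x | exists i, [/\ J i, f i = n & F i x]].
rewrite (_ : \bigcup_(i in J) F i = \bigcup_n G n); last first.
  apply/seteqP; split=> x [i]; first by move=> Ji Fi; exists (f i) => //; exists i.
  by move=> _ [j [Jj _ Fj]]; exists j.
apply: bigcupT_measurable => n.
have [[i [Ji fi]]|no] := pselect (exists i, J i /\ f i = n).
  rewrite (_ : G n = F i); first exact: mF.
  apply/seteqP; split=> x; last by move=> Fi; exists i.
  by move=> [j [Jj fj Fj]]; rewrite (_ : i = j)//; apply: finj; rewrite ?inE// fi fj.
rewrite (_ : G n = set0)//; apply/seteqP; split => x // [i [Ji fi _]].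
by apply: no; exists i.
Qed.

Lemma birkhoff_recr (X : Type) (th : X -> X) (t : X -> nat) n x :
  birkhoff th t n.+1 x = (birkhoff th t n x + t (iter n th x))%N.
Proof. by rewrite /birkhoff big_ord_recr. Qed.

Section Setup.
Context (d : measure_display) (X : measurableType d) (R : realType)
    (mu : probability X R) (theta : X -> X) (alpha : set (set X))
    (Omega : set X) (beta : set (seq (set X))) (eta : seq (set X) -> nat) (r : R)
    (V : countType) (E : set (V * V)) (kappa : X -> V -> V).
Let nu := cond_measure mu Omega.
Let sigma := induced_map theta beta eta.
Let bbeta := induced_partition theta beta.
Let khat := induced_cocycle theta kappa beta eta.
Let S := graph_extension sigma khat.
Let rt := return_time theta beta eta.
Hypotheses (h_markov : markov_map theta mu alpha)
    (h_embedded : embedded_gibbs_markov theta mu alpha Omega beta eta r)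
    (h_kappa : nearest_neighbour_cocycle E alpha kappa)
    (h_khat : locally_constant bbeta khat)
    (h_transitive : topologically_transitive nu bbeta S).

Lemma alpha_cover x : exists2 a, alpha a & a x.
Proof.
case: h_markov => _ [cov _ _] _; have : cover alpha id x by rewrite cov.
by move=> [a aa ax]; exists a.
Qed.

Lemma alpha_disjoint a b x : alpha a -> alpha b -> a x -> b x -> a = b.
Proof.
case: h_markov => _ [_ triv _] _ aa bb ax bx.
by apply: triv => //; exists x.
Qed.

Lemma theta_measurable : measurable_fun setT theta.
Proof.
case: h_markov => _ _ mo _ Y mY; rewrite setTI.
rewrite (_ : _ @^-1` _ = \bigcup_(a in alpha) (a `&` theta @^-1` Y)).
  apply: bigcup_measurable_countable; first exact: mo_countable mo.
  move=> a aa; apply: (mo_preimage mo aa) => //.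
  by case: (mo_partition mo) => + _ _ _; apply.
apply/seteqP; split => x; last by move=> [a _ []].
by have [a aa ax] := alpha_cover x; exists a.
Qed.

Lemma alpha_system : markov_system mu theta alpha.
Proof.
case: h_markov => _ _ mo; split.
- exact: mo_countable mo.
- by case: (mo_partition mo) => + _ _ _; apply.
- exact: alpha_disjoint.
- rewrite (_ : \bigcup_(a in alpha) a = setT) ?setCT//; first exact: negligible_set0.
  by apply/seteqP; split => // x _; have [a aa ax] := alpha_cover x; exists a.
- exact: theta_measurable.
- by move=> a A aa; apply: (mo_image mo aa).
- by move=> a A aa mA Aa A0; apply/(mo_nonsingular mo aa mA Aa).
Qed.

Let GM := eg_gibbs_markov h_embedded.
Let MO := gm_markov GM.

Lemma Omega_measurable : measurable Omega.
Proof. exact: mo_measurable MO. Qed.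

Let mO := Omega_measurable.

Let nuE A : nu A = ((fine (mu Omega))^-1%:E * mu (A `&` Omega))%E.
Proof. by []. Qed.

Lemma mu_Omega_gt0 : 0 < prob mu Omega.
Proof.
rewrite lt_def prob_ge0 andbT; apply/eqP => O0.
have : nu Omega = 1%E := mo_mass MO; rewrite nuE setIid -/(prob mu Omega) O0 invr0 mul0e.
by move=> /eqP; rewrite lt_eqF// lte_fin.
Qed.

(** [cond_measure] is a bare set function; this is the same function with the structure of a
    probability. The last [mu] is the value of [mnormalize] in the degenerate case, excluded by
    [mu_Omega_gt0]. *)
Definition nu_prob : probability X R :=
  mnormalize (mrestr mu Omega_measurable) mu.

Lemma nu_probE : cond_measure mu Omega = nu_prob.
Proof.
apply/funext => A.
have eT : mrestr mu Omega_measurable setT = mu Omega by rewrite /mrestr setTI.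
transitivity (mnormalize (mrestr mu Omega_measurable) mu A) => //.
rewrite /mnormalize /=.
have := mu_Omega_gt0; rewrite /prob => O0.
rewrite ifF.
  rewrite -[X in (fine X)^-1]/(mrestr mu Omega_measurable setT) eT.
  by rewrite /cond_measure muleC.
apply/negbTE; rewrite negb_or; apply/andP; split.
  by apply/eqP => h; move: O0; rewrite (etrans (esym eT) h) ltxx.
by apply/eqP => h; move: O0; rewrite (etrans (esym eT) h) ltxx.
Qed.

Lemma nu_prob_val A : measurable A ->
  prob nu_prob A = (prob mu Omega)^-1 * prob mu (A `&` Omega).
Proof.
move=> mA; rewrite {1}/prob -nu_probE /cond_measure fineM//.
by rewrite fin_num_measure//; apply: measurableI.
Qed.

Lemma nu_prob_le A : measurable A ->
  prob nu_prob A <= (prob mu Omega)^-1 * prob mu A.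
Proof.
move=> mA; rewrite nu_prob_val// ler_wpM2l ?invr_ge0 ?prob_ge0//.
by apply: prob_mono => //; apply: measurableI.
Qed.

Lemma nu_null A : measurable A -> mu A = 0%E -> nu_prob A = 0%E.
Proof.
move=> mA A0; rewrite probE//; congr EFin; apply/eqP.
rewrite eq_le prob_ge0 andbT; apply: le_trans (nu_prob_le mA) _.
by rewrite /prob A0 mulr0.
Qed.

Lemma nu_OmegaC : nu_prob (~` Omega) = 0%E.
Proof.
have mOC := measurableC mO.
rewrite probE//; congr EFin; rewrite nu_prob_val// setICl prob_set0 mulr0//.
Qed.

Lemma prob_nu_Omega A : measurable A -> prob nu_prob (Omega `&` A) = prob nu_prob A.
Proof.
move=> mA; rewrite !nu_prob_val//; last exact: measurableI.
by rewrite (setIC Omega A) -setIA setIid.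
Qed.

Lemma cylinder_prefix (u v : seq (set X)) x : word_in alpha u -> word_in alpha v ->
  (size u <= size v)%N -> cylinder theta u x -> cylinder theta v x ->
  cylinder theta v `<=` cylinder theta u.
Proof.
elim: u v x => [|a u IH] [|b v]// x; rewrite ?cylinder_nil//.
move=> /word_in_cons[aa uu] /word_in_cons[bb vv]; rewrite ltnS => uv.
rewrite !cylinder_cons => -[ax ux] [bx vx].
rewrite (alpha_disjoint aa bb ax bx) => y [by_ vy]; split => //.
exact: (IH v (theta x)) vy.
Qed.

Lemma beta_word_in u : beta u -> word_in alpha u.
Proof.
move=> /(eg_words h_embedded)[n _ [_ <- h _]] a au.
by rewrite -(nth_index set0 au); apply: h; rewrite index_mem.
Qed.

Lemma beta_measurable u : beta u -> measurable (cylinder theta u).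
Proof. by move=> /beta_word_in; exact: (cylinder_measurable alpha_system). Qed.

Lemma beta_gt0 u : beta u -> (0 < nu (cylinder theta u))%E.
Proof. by move=> uu; apply: (mo_positive MO); exists u. Qed.

(** Cylinders over [alpha] with a common point are nested, so for distinct words the smaller one
    would be their intersection, which is null, although it has positive mass. Disjointness mod 0 is
    thus exact. *)
Lemma beta_disjoint u v x : beta u -> beta v ->
  cylinder theta u x -> cylinder theta v x -> u = v.
Proof.
wlog uv : u v / (size u <= size v)%N.
  by move=> h uu vv ux vx; have [/h|/ltnW/h] := leqP (size u) (size v);
    [exact|move=> /(_ vv uu vx ux)].
move=> uu vv ux vx; apply: contrapT => neq.
have sub := cylinder_prefix (beta_word_in uu) (beta_word_in vv) uv ux vx.
case: (eg_partition h_embedded) => _ _ /(_ u v uu vv neq) + _.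
rewrite (setIidr sub) => v0.
by have := beta_gt0 vv; rewrite /nu nu_probE nu_null ?ltxx//; apply: beta_measurable.
Qed.

Lemma return_time_beta u x : beta u -> cylinder theta u x -> rt x = eta u.
Proof.
move=> uu ux; rewrite /rt /return_time; case: pselect => [e|]; last by case; exists u.
by case: cid2 => v vv vx /=; rewrite (beta_disjoint vv uu vx ux).
Qed.

Lemma return_time_out x : ~ (\bigcup_(b in bbeta) b) x -> rt x = 0%N.
Proof.
move=> nx; rewrite /rt /return_time; case: pselect => // -[u uu ux].
by exfalso; apply: nx; exists (cylinder theta u) => //; exists u.
Qed.

Lemma bbeta_measurable b : bbeta b -> measurable b.
Proof. by move=> [u uu <-]; apply: beta_measurable. Qed.

Lemma bbeta_disjoint a b x : bbeta a -> bbeta b -> a x -> b x -> a = b.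
Proof. by move=> [u uu <-] [v vv <-] ux vx; rewrite (beta_disjoint uu vv ux vx). Qed.

Lemma return_time_const b x y : bbeta b -> b x -> b y -> rt x = rt y.
Proof. by move=> [u uu <-] ux uy; rewrite !(return_time_beta uu). Qed.

Lemma bbeta_countable : countable bbeta.
Proof. exact: mo_countable MO. Qed.

Lemma bbeta_union_measurable : measurable (\bigcup_(b in bbeta) b).
Proof. exact: bigcup_measurable_countable bbeta_countable bbeta_measurable. Qed.

Lemma return_time_measurable n : measurable [set x | rt x = n].
Proof.
rewrite (_ : [set _ | _] =
   \bigcup_(b in [set b | bbeta b /\ forall x, b x -> rt x = n]) b `|`
   (if n == 0%N then ~` \bigcup_(b in bbeta) b else set0)).
  apply: measurableU.
    apply: bigcup_measurable_countable; last by move=> b [/bbeta_measurable].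
    by apply: sub_countable bbeta_countable; apply: subset_card_le => b [].
  by case: ifP => // _; apply/measurableC/bbeta_union_measurable.
apply/seteqP; split => x /=.
  move=> xn; have [[b bb bx]|nx] := pselect ((\bigcup_(b in bbeta) b) x).
    left; exists b => //; split => // y b_y.
    by rewrite -xn; apply: return_time_const bb _ _.
  by right; rewrite -xn return_time_out.
case=> [[b [bb h] bx]|]; first exact: h.
by case: eqP => [->|//]; apply: return_time_out.
Qed.

Lemma sigma_measurable : measurable_fun setT sigma.
Proof.
move=> _ Y mY; rewrite setTI.
rewrite (_ : _ @^-1` _ = \bigcup_n ([set x | rt x = n] `&` iter n theta @^-1` Y)).
  apply: bigcupT_measurable => n; apply: measurableI.
    exact: return_time_measurable.
  exact: (iter_measurable alpha_system).
apply/seteqP; split => x; first by move=> Yx; exists (rt x).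
by move=> [n _ [/= <-]].
Qed.

Lemma beta_system : markov_system nu_prob sigma bbeta.
Proof.
have MO' : markov_on Omega sigma nu_prob bbeta by rewrite -nu_probE.
split.
- exact: bbeta_countable.
- exact: bbeta_measurable.
- exact: bbeta_disjoint.
- have mU := bbeta_union_measurable.
  have [_ _ _ h] := mo_partition MO'.
  have h1 : nu_prob.-negligible (Omega `\` \bigcup_(b in bbeta) b).
    by apply/negligibleP => //; apply: measurableD.
  have h2 : nu_prob.-negligible (~` Omega).
    by apply/negligibleP; [exact: measurableC|exact: nu_OmegaC].
  apply: negligibleS (negligibleU h1 h2) => x nx.
  by have [Ox|nO] := pselect (Omega x); [left|right].
- exact: sigma_measurable.
- by move=> a A aa; apply: (mo_image MO' aa).
- by move=> a A aa mA Aa A0; apply/(mo_nonsingular MO' aa mA Aa).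
Qed.

Lemma bbeta_gt0 b : bbeta b -> (0 < nu_prob b)%E.
Proof. by rewrite -nu_probE; apply: (mo_positive MO). Qed.

Lemma bbeta_full b : bbeta b -> nu_prob (~` (sigma @` b)) = 0%E.
Proof.
move=> bb; have [_ +] := gm_full GM bb; rewrite nu_probE => h.
have mb : measurable (sigma @` b).
  by apply: (ms_image beta_system bb) => //; apply: bbeta_measurable.
have mOs : measurable (Omega `\` sigma @` b) by exact: measurableD.
have mOC := measurableC mO.
apply: (@null_subset _ _ _ nu_prob _ (Omega `\` sigma @` b `|` ~` Omega)).
- exact: measurableC.
- by apply: negligibleU; apply/negligibleP => //; apply: nu_OmegaC.
- by move=> x nx; have [Ox|nO] := pselect (Omega x); [left|right].
Qed.

Lemma r_bounds : 0 < r < 1. Proof. exact: gm_r GM. Qed.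

Lemma sigma_distortion : exists2 C : R, 0 < C & forall w,
  finite_words nu_prob sigma bbeta w ->
  distortion_le nu_prob sigma w Omega C (dist_r sigma bbeta r).
Proof. by rewrite -nu_probE; exact: gm_distortion GM. Qed.

Lemma kappa_measurable g h : measurable [set x | kappa x g = h].
Proof.
rewrite (_ : [set _ | _] =
    \bigcup_(a in [set a | alpha a /\ forall x, a x -> kappa x g = h]) a).
  apply: bigcup_measurable_countable.
    apply: sub_countable (ms_countable alpha_system).
    by apply: subset_card_le => b [].
  by move=> b [bb _]; apply: ms_letter alpha_system _ bb.
apply/seteqP; split => x /=; last by move=> [a [_ ah] ax]; apply: ah.
move=> xh; have [a aa ax] := alpha_cover x; exists a => //; split=> // y ay.
by rewrite -xh; apply: (nn_locally_constant h_kappa aa).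
Qed.

Lemma kappa_iter_measurable n g h :
  measurable [set x | cocycle_iter theta kappa n x g = h].
Proof. exact: (cocycle_measurable theta_measurable kappa_measurable). Qed.

Lemma kappa_iter_inj n x : injective (cocycle_iter theta kappa n x).
Proof.
elim: n => [//|n IH] g h /= /(bij_inj (nn_bijective h_kappa _)); exact: IH.
Qed.

Lemma khat_inj x : injective (khat x).
Proof. exact: kappa_iter_inj. Qed.

Lemma khat_measurable g h : measurable [set x | khat x g = h].
Proof.
rewrite (_ : [set _ | _] = \bigcup_n
    ([set x | rt x = n] `&` [set x | cocycle_iter theta kappa n x g = h])).
  apply: bigcupT_measurable => n; apply: measurableI.
    exact: return_time_measurable.
  exact: kappa_iter_measurable.
apply/seteqP; split => x; first by move=> Yx; exists (rt x).
by move=> [n _ [/= <-]].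
Qed.

Lemma sigma_iter n x : iter n sigma x = iter (birkhoff sigma rt n x) theta x.
Proof.
elim: n => [|n IH]; first by rewrite /birkhoff big_ord0.
by rewrite birkhoff_recr addnC iterD -IH.
Qed.

Lemma khat_iter n x g : cocycle_iter sigma khat n x g =
  cocycle_iter theta kappa (birkhoff sigma rt n x) x g.
Proof.
elim: n => [|n IH]; first by rewrite /birkhoff big_ord0.
by rewrite birkhoff_recr cocycle_iterD -sigma_iter /= IH.
Qed.

Lemma extension_iter n x g :
  iter n S (x, g) = (iter n sigma x, cocycle_iter sigma khat n x g).
Proof. by elim: n => // n IH; rewrite !iterS IH. Qed.

Lemma letter_point (b : set_type bbeta) : exists x, val b x.
Proof.
have bb : bbeta (val b) by exact: set_valP.
have [|/set0P[x bx]] := eqVneq (val b) set0; last by exists x.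
by move=> b0; have := bbeta_gt0 bb; rewrite b0 measure0 ltxx.
Qed.

Definition letter_map (b : set_type bbeta) : V -> V :=
  khat (projT1 (cid (letter_point b))).

Definition letter_time (b : set_type bbeta) : nat :=
  rt (projT1 (cid (letter_point b))).

Lemma letter_mapE b x g : val b x -> khat x g = letter_map b g.
Proof.
move=> bx; rewrite /letter_map; case: cid => y b_y /=.
exact: (h_khat (set_valP b)).
Qed.

Lemma letter_timeE b x : val b x -> rt x = letter_time b.
Proof.
move=> bx; rewrite /letter_time; case: cid => y b_y /=.
exact: return_time_const (set_valP b) _ _.
Qed.

Lemma letter_map_inj b : injective (letter_map b).
Proof. exact: khat_inj. Qed.

(** Outside all letters the return time is 0 and the cocycle is the identity; such steps add no
    letter, so the word need not have length [n]. *)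
Lemma khat_iter_word n x g : exists w, cocycle_iter sigma khat n x g = word_map letter_map w g.
Proof.
elim: n => [|n [w IH]]; first by exists [::].
have [[b bb bx]|nx] := pselect ((\bigcup_(b in bbeta) b) (iter n sigma x)).
  exists (rcons w (SigSub (mem_set bb))).
  rewrite -cats1 word_map_cat -IH /=; exact: letter_mapE.
by exists w; rewrite -IH /= /khat /induced_cocycle -/rt return_time_out.
Qed.

Lemma letter_exists : inhabited (set_type bbeta).
Proof.
apply: contrapT => no.
have : prob nu_prob setT = 0.
  apply/prob0P => //; apply: negligibleS (ms_cover beta_system) => x _ [b bb _].
  by apply: no; exact: (inhabits (SigSub (mem_set bb))).
by rewrite prob_setT => /eqP; rewrite oner_eq0.
Qed.

Lemma transitive_nonempty a b g h : bbeta a -> bbeta b ->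
  exists n x, (0 < n)%N /\ cocycle_iter sigma khat n x g = h.
Proof.
move=> aa bb; have [n n0 pos] := h_transitive g h aa bb.
apply: contrapT => no; move: pos; rewrite /prod_counting esum1 ?ltxx// => l _.
rewrite (_ : [set x | _] = set0).
  by rewrite /nu nu_probE measure0.
apply/seteqP; split => // y [[[x g'] [_ /= ->]]].
by rewrite extension_iter => -[_ e] [_ /= lh]; apply: no; exists n, x; rewrite e.
Qed.

Lemma transitive_word g h : exists w, word_map letter_map w g = h.
Proof.
have [b] := letter_exists.
have [n [x [_ <-]]] := transitive_nonempty g h (set_valP b) (set_valP b).
by have [w ->] := khat_iter_word n x g; exists w.
Qed.

(* A letter with return time 0 is fixed pointwise by [sigma], hence it is all of
   [Omega] mod 0 by fullness, and [khat] is the identity. *)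
Lemma letter_time_gt0 (g h : V) (b : set_type bbeta) : g <> h -> (0 < letter_time b)%N.
Proof.
move=> gh; rewrite lt0n; apply/eqP => b0; apply: gh.
have bb : bbeta (val b) := set_valP b.
have mb := bbeta_measurable bb.
have sb : sigma @` val b = val b.
  apply/seteqP; split => [_ [x bx <-]|x bx]; last exists x => //;
  by rewrite /sigma /induced_map -/rt (letter_timeE bx) b0.
have := bbeta_full bb; rewrite sb => bC.
have uniqb b' : bbeta b' -> b' = val b.
  move=> bb'; apply: contrapT => neq.
  have mb' := bbeta_measurable bb'.
  have := bbeta_gt0 bb'; rewrite (_ : nu_prob b' = 0%E) ?ltxx//.
  apply: (@subset_measure0 _ _ _ nu_prob _ (~` val b)) => //; first exact: measurableC.
  by move=> x b'x bx; apply: neq; apply: bbeta_disjoint bb' bb b'x bx.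
have rt0 x : rt x = 0%N.
  have [[b' bb' bx]|] := pselect ((\bigcup_(b in bbeta) b) x); last exact: return_time_out.
  by rewrite (uniqb b' bb') in bx; rewrite (letter_timeE bx).
have [n [x [_ <-]]] := transitive_nonempty g h bb bb.
elim: n => // n IH /=; rewrite -IH /khat /induced_cocycle -/rt rt0 //.
Qed.

Let C0 : R := s2val (cid2 sigma_distortion).
Let C0_gt0 : 0 < C0 := s2valP (cid2 sigma_distortion).
Let C0_dist : forall w, finite_words nu_prob sigma bbeta w ->
  distortion_le nu_prob sigma w Omega C0 (dist_r sigma bbeta r) :=
  s2valP' (cid2 sigma_distortion).

Let OmegaC0 : nu_prob.-negligible (~` Omega).
Proof. by apply/negligibleP; [exact: measurableC|exact: nu_OmegaC]. Qed.

Local Notation B := (set_type bbeta).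
Local Notation ms := (@mass d X R nu_prob sigma bbeta).
Local Notation cy := (@cyl d X sigma bbeta).
Local Notation Dist := (dfactor C0 r).

Let quasi := mass_quasi beta_system bbeta_full C0_gt0 r_bounds OmegaC0 C0_dist.
Let quasi' := mass_quasi' beta_system bbeta_full C0_gt0 r_bounds OmegaC0 C0_dist.
Let ms_gt0 := mass_gt0 beta_system bbeta_gt0 bbeta_full C0_gt0 r_bounds OmegaC0 C0_dist.
Let ms_sum := mass_sum beta_system.
Let exhaust := words_exhaust beta_system bbeta_gt0 bbeta_full C0_gt0 r_bounds OmegaC0 C0_dist.
Let null_pre := preimage_null beta_system bbeta_full C0_gt0 r_bounds OmegaC0 C0_dist.

(** * Return probabilities of the induced extension *)

Definition return_prob n (g h : V) : R :=
  prob nu_prob [set x | cocycle_iter sigma khat n x g = h].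

Lemma return_event_measurable n g h :
  measurable [set x | cocycle_iter sigma khat n x g = h].
Proof. exact: (cocycle_measurable sigma_measurable khat_measurable). Qed.

Definition word_return (L : seq B) n (g h : V) : R :=
  \sum_(z <- words_over L n) ms z * (word_map letter_map z g == h)%:R.

Lemma return_prob_bounds L n g h : uniq L ->
  word_return L n g h <= return_prob n g h <=
  word_return L n g h + (1 - \sum_(z <- words_over L n) ms z).
Proof.
move=> uL; apply: (word_event_bounds beta_system
  (P := fun z => word_map letter_map z g == h) uL (return_event_measurable n g h)).
move=> z x <- zx /=; rewrite (cocycle_word (kl := letter_map) g _ zx).
  by split => [->|/eqP].
by move=> b y h' b_y; exact: letter_mapE.
Qed.

Lemma word_return_ge0 L n g h : 0 <= word_return L n g h.
Proof. by apply: sumr_ge0 => z _; rewrite mulr_ge0 ?(ltW (ms_gt0 _)). Qed.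

Lemma word_return_le1 L n g h : uniq L -> word_return L n g h <= 1.
Proof.
move=> uL; have := sum_words_le ms_sum n [::] uL; rewrite mass_nil; apply: le_trans.
apply: ler_sum => z _; rewrite ler_piMr ?(ltW (ms_gt0 _))//; by case: (_ == _).
Qed.

(** For given [z] at most one midpoint [k] contributes, namely the image of [g] under [z]. *)
Lemma word_return_super L n n' g h (K : seq V) : uniq K ->
  \sum_(k <- K) word_return L n g k * word_return L n' k h <=
  Dist 0 * word_return L (n + n') g h.
Proof.
move=> uK.
apply: (@le_trans _ _ (\sum_(z <- words_over L n) \sum_(z' <- words_over L n')
   (ms z * ms z') * (word_map letter_map (z ++ z') g == h)%:R)).
  under eq_bigr do rewrite /word_return big_distrlr/=.
  rewrite exchange_big/=; apply: ler_sum => z _.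
  rewrite exchange_big/=; apply: ler_sum => z' _.
  under eq_bigr do rewrite mulrACA.
  rewrite -mulr_sumr ler_wpM2l ?mulr_ge0 ?(ltW (ms_gt0 _))//.
  rewrite word_map_cat; set a := word_map _ z g.
  have [aK|aK] := boolP (a \in K).
    rewrite (perm_big _ (perm_to_rem aK)) big_cons/= eqxx mul1r big_seq big1 ?addr0//.
    move=> k; rewrite mem_rem_uniq// inE => /andP[ka _].
    by rewrite eq_sym (negbTE ka) mul0r.
  rewrite big_seq big1// => k kK; have [e|] := eqVneq a k; last by rewrite mul0r.
  by rewrite e kK in aK.
rewrite /word_return sum_words_overD mulr_sumr; apply: ler_sum => z _.
rewrite mulr_sumr; apply: ler_sum => z' _; rewrite mulrA ler_wpM2r//; exact: quasi'.
Qed.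

Lemma exhaust_two n n' (x : R) : 0 < x -> exists2 L : seq B, uniq L &
  1 - \sum_(z <- words_over L n) ms z <= x /\
  1 - \sum_(z <- words_over L n') ms z <= x.
Proof.
move=> x0.
have [L1 uL1 h1] := exhaust n x0; have [L2 uL2 h2] := exhaust n' x0.
exists (undup (L1 ++ L2)); first exact: undup_uniq.
have mono (L : seq B) i : uniq L -> {subset L <= undup (L1 ++ L2)} ->
    1 - x <= \sum_(z <- words_over L i) ms z ->
    1 - \sum_(z <- words_over (undup (L1 ++ L2)) i) ms z <= x.
  move=> uL sub h; rewrite lerBlDr addrC -lerBlDr; apply: le_trans h _.
  apply: ler_sum_subset; first exact: words_over_uniq.
    exact: words_over_subset.
  by move=> z; exact/ltW/ms_gt0.
split; [apply: (mono L1)|apply: (mono L2)] => // b bL;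
by rewrite mem_undup !mem_cat bL ?orbT.
Qed.

Lemma return_prob_super n n' g h (K : seq V) : uniq K ->
  \sum_(k <- K) return_prob n g k * return_prob n' k h <=
  Dist 0 * return_prob (n + n') g h.
Proof.
move=> uK; apply/ler_addgt0Pr => e e0.
pose q : R := (size K)%:R.
have q0 : 0 <= q by exact: ler0n.
(* Truncating to words over [L] costs at most [2 * x + x ^+ 2 <= 3 * x] at each of the [q]
   midpoints. *)
pose x := Num.min 1 (e / (3 * q + 1)).
have q1 : 0 < 3 * q + 1 by lra.
have x0 : 0 < x by rewrite lt_min ltr01 divr_gt0.
have x1 : x <= 1 by rewrite ge_min lexx.
have qx : q * (3 * x) <= e.
  have : x * (3 * q + 1) <= e by rewrite -ler_pdivlMr// ge_min lexx orbT.
  nra.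
have [L uL [h1 h2]] := exhaust_two n n' x0.
apply: (@le_trans _ _ (\sum_(k <- K)
    (word_return L n g k * word_return L n' k h + 3 * x))).
  apply: ler_sum => k _.
  have /andP[_ b1] := return_prob_bounds n g k uL.
  have /andP[_ b2] := return_prob_bounds n' k h uL.
  have s0 := word_return_ge0 L n g k; have s1 := word_return_le1 n g k uL.
  have t0 := word_return_ge0 L n' k h; have t1 := word_return_le1 n' k h uL.
  apply: (@le_trans _ _ ((word_return L n g k + x) * (word_return L n' k h + x))).
    apply: ler_pM; [exact: prob_ge0|exact: prob_ge0| |].
      by apply: le_trans b1 _; rewrite lerD2l.
    by apply: le_trans b2 _; rewrite lerD2l.
  nra.
rewrite big_split/= sumr_const_seq_nat -/q; apply: lerD => //.
apply: le_trans (word_return_super L n n' g h uK) _.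
rewrite ler_wpM2l//; first exact/ltW/dfactor_gt0/r_bounds.
by have /andP[] := return_prob_bounds (n + n') g h uL.
Qed.

Lemma return_prob0 g h : return_prob 0 g h = (g == h)%:R.
Proof.
rewrite /return_prob; have [->|/eqP gh] := eqVneq g h.
  by rewrite (_ : [set _ | _] = setT) ?prob_setT//; apply/seteqP; split.
by rewrite (_ : [set _ | _] = set0) ?prob_set0//; apply/seteqP; split.
Qed.

Lemma return_prob_trans g h : exists n, 0 < return_prob n g h.
Proof.
have [w wgh] := transitive_word g h; exists (size w).
apply: lt_le_trans (ms_gt0 w) _; apply: prob_mono.
- exact: cyl_measurable beta_system _.
- exact: return_event_measurable.
move=> x wx /=; rewrite (cocycle_word (kl := letter_map) g _ wx)//.
by move=> b y h' b_y; exact: letter_mapE.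
Qed.

(** Return times are unbounded, but finitely many words carry all but [x] of the mass; off a small
    set, [n] steps of [sigma] take at most [M] steps of [theta]. *)
Lemma bounded_return_time n (x : R) : 0 < x -> exists M N,
  [/\ measurable N, prob nu_prob N <= x & forall y, ~ N y ->
    exists w, [/\ size w = n, cy w y & (word_time letter_time w <= M)%N]].
Proof.
move=> x0; have [L uL hL] := exhaust n x0.
have mU := @prob_bigcup_seq _ _ _ nu_prob _ (words_over L n) cy (words_over_uniq n uL)
  (cyl_measurable beta_system) _.
have {mU}[|mU PU] := mU.
  move=> z z' y; rewrite !mem_words_over => /andP[/eqP sz _] /andP[/eqP sz' _].
  by apply: (cyl_disjoint beta_system); rewrite sz sz'.
exists (\max_(z <- words_over L n) word_time letter_time z)%N.
exists (~` [set y | exists2 z, z \in words_over L n & cy z y]); split.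
- exact: measurableC.
- by rewrite prob_setC// PU lerBlDr addrC -lerBlDr.
move=> y /contrapT[z zL zy]; exists z; split=> //.
  by move: zL; rewrite mem_words_over => /andP[/eqP].
exact: (leq_bigmax_seq (F := fun z => word_time letter_time z)).
Qed.

(** * Invariance and escape from finite sets of vertices *)

Hypothesis h_invariant : invariant_measure mu theta.

Lemma prob_invariant j A : measurable A ->
  prob mu (iter j theta @^-1` A) = prob mu A.
Proof.
elim: j A => // j IH A mA.
have mtA : measurable (theta @^-1` A) := iter_measurable alpha_system 1 mA.
rewrite (_ : iter j.+1 theta @^-1` A = iter j theta @^-1` (theta @^-1` A))//.
by rewrite IH// /prob h_invariant.
Qed.

Lemma escape_measurable (K : seq V) h : measurable [set x | kappa x h \notin K].
Proof.
have [mU _] := prob_union_seq_le mu K (kappa_measurable h).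
rewrite (_ : [set _ | _] = ~` [set x | exists2 k, k \in K & kappa x h = k]).
  exact: measurableC.
apply/seteqP; split => x /=; first by move=> nK [k kK e]; rewrite e kK in nK.
by move=> nK; apply/negP => kK; apply: nK; exists (kappa x h).
Qed.

(** All crossings out of [K] at time [j], not only first exits: the event then depends on the start
    only through the position at time [j]. *)
Definition flux_event (K : seq V) j g : set X :=
  [set x | cocycle_iter theta kappa j x g \in K /\
           cocycle_iter theta kappa j.+1 x g \notin K].

Lemma flux_eventE (K : seq V) j g : flux_event K j g =
  [set x | exists2 h, h \in K & ([set x | cocycle_iter theta kappa j x g = h] `&`
     iter j theta @^-1` [set x | kappa x h \notin K]) x].
Proof.
apply/seteqP; split => x; last by move=> [h hK [/= e nK]]; split; rewrite /= e.
by move=> [h1 h2]; exists (cocycle_iter theta kappa j x g).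
Qed.

Let flux_piece_measurable (K : seq V) j g h :
  measurable ([set x | cocycle_iter theta kappa j x g = h] `&`
     iter j theta @^-1` [set x | kappa x h \notin K]).
Proof.
apply: measurableI; first exact: kappa_iter_measurable.
exact: (iter_measurable alpha_system j (escape_measurable K h)).
Qed.

Lemma flux_event_measurable (K : seq V) j g : measurable (flux_event K j g).
Proof.
rewrite flux_eventE.
by have [] := prob_union_seq_le mu K (flux_piece_measurable K j g).
Qed.

(* The maps [kappa_x^j] are injective and [mu] is invariant, so that at each
   time the mass leaving [K] is at most the mass leaving [K] at time 0. *)
Lemma flux_le (K : seq V) j : uniq K ->
  \sum_(g <- K) prob mu (flux_event K j g) <=
  \sum_(h <- K) prob mu [set x | kappa x h \notin K].
Proof.
move=> uK.
apply: (@le_trans _ _ (\sum_(g <- K) \sum_(h <- K)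
   prob mu ([set x | cocycle_iter theta kappa j x g = h] `&`
     iter j theta @^-1` [set x | kappa x h \notin K]))).
  apply: ler_sum => g _; rewrite flux_eventE.
  by have [] := prob_union_seq_le mu K (flux_piece_measurable K j g).
rewrite exchange_big/=; apply: ler_sum => h _.
have mF := escape_measurable K h.
have mFj := iter_measurable alpha_system j mF.
have [|mU <-] := @prob_bigcup_seq _ _ _ mu _ K _ uK (fun g => flux_piece_measurable K j g h).
  by move=> g g' x _ _ [/= e _] [/= e' _]; apply: (@kappa_iter_inj j x); rewrite e e'.
rewrite -(prob_invariant j mF); apply: prob_mono => //.
by move=> x [g _ []].
Qed.

(** The [eps]-boundary ignores edges of small weight. With [eps] below the masses of finitely many
    letters carrying mass [1 - x / 2], a letter of this list leading out of [K] gives an edge of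
    weight above [eps]; from a vertex off the boundary only the other letters leave [K]. *)
Lemma small_escape : mu_amenable E mu kappa -> forall (o : V) (x : R), 0 < x ->
  exists K : seq V, [/\ uniq K, K != [::] &
   \sum_(h <- K) prob mu [set y | kappa y h \notin K] <= x * (size K)%:R].
Proof.
move=> am o x x0; have x20 : 0 < x / 2 by rewrite divr_gt0.
have [L uL hL] := letters_exhaust alpha_system x20.
have [eps eps0 epsL] : exists2 eps : R, 0 < eps &
    forall a, a \in L -> (eps%:E < mu (val a))%E.
  elim: L {uL hL} => [|a L [eps eps0 IH]]; first by exists 1.
  have a0 : 0 < prob mu (val a).
    rewrite -lte_fin -probE; last by apply: (ms_letter alpha_system); exact: set_valP.
    by case: h_markov => _ _ mo; apply: (mo_positive mo); exact: set_valP.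
  exists (Num.min eps (prob mu (val a) / 2)); first by rewrite lt_min eps0 divr_gt0.
  move=> b; rewrite inE => /orP[/eqP->|/IH]; last first.
    by apply: le_lt_trans; rewrite lee_fin ge_min lexx.
  rewrite probE; last by apply: (ms_letter alpha_system); exact: set_valP.
  rewrite lte_fin; apply: (@le_lt_trans _ _ (prob mu (val a) / 2)).
    by rewrite ge_min lexx orbT.
  by rewrite ltr_pdivrMr// ltr_pMr// ltr1n.
have [K K0 bdK] := mu_amenable_small o am eps0 x20.
exists (enum_fset K); split; first exact: fset_uniq.
  by rewrite -size_eq0 -lt0n.
set F := eps_boundary E mu kappa eps K in bdK.
(* One half of [x] pays for the boundary vertices, the other for the letters outside the list. *)
apply: (@le_trans _ _ (\sum_(h <- K) ((h \in F)%:R * 1 + x / 2))).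
  apply: ler_sum_seq => h hK; have mF := escape_measurable (enum_fset K) h.
  have [hF|hF] := boolP (h \in F).
    apply: le_trans (prob_le1 mu mF) _; rewrite !mul1r; lra.
  rewrite mul0r add0r.
  have := mass_sum_eq alpha_system [::] uL; rewrite mass_nil => sE.
  have mL : measurable [set y | exists2 b : set_type alpha, b \in L & val b y].
    by have [] := @prob_union_seq_le _ _ _ mu _ L val
      (fun b => ms_letter alpha_system (set_valP b)).
  apply: (@le_trans _ _ (prob mu (~` [set y | exists2 b : set_type alpha, b \in L & val b y]))).
    apply: prob_mono => //; first exact: measurableC.
    move=> y /= nK [b bL b_y]; move/negP: hF; apply.
    rewrite !inE hK /=; apply/asboolP; exists (h, kappa y h); split => //.
      exact: (nn_edge h_kappa).
    apply: lt_le_trans (epsL b bL) _; rewrite /edge_weight/=.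
    have bb : alpha (val b) := set_valP b.
    rewrite !probE; [|exact: kappa_measurable|exact: (ms_letter alpha_system bb)].
    rewrite lee_fin; apply: prob_mono; [exact: (ms_letter alpha_system bb)| |].
      exact: kappa_measurable.
    by move=> z bz /=; apply: (nn_locally_constant h_kappa bb).
  by move: hL; rewrite sE /cyl cylinder_nil setTI lerD2l lerN2.
rewrite big_split/= sum_mem_subset ?fset_uniq//; last first.
  by move=> v; rewrite !inE => /andP[].
rewrite !sumr_const_seq_nat mulr1.
have -> : x * (size K)%:R = x / 2 * (size K)%:R + (size K)%:R * (x / 2) by field.
by rewrite lerD2r.
Qed.

Lemma folner_return : mu_amenable E mu kappa -> forall (o : V) n,
  exists K : seq V, [/\ uniq K, K != [::] &
    (size K)%:R / 2 <= \sum_(g <- K) \sum_(h <- K) return_prob n g h].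
Proof.
move=> am o n.
have [M [N [mN Nle NP]]] := bounded_return_time n (ltac:(lra) : 0 < 4^-1 :> R).
have O0 := mu_Omega_gt0.
have M10 : 0 < M.+1%:R :> R by rewrite ltr0n.
(* Of the permitted escape 1/2 per vertex, 1/4 goes to long return times; this [x] bounds by 1/4 the
   crossings at [M] times after division by [prob mu Omega]. *)
pose x := prob mu Omega / (4 * M.+1%:R).
have x0 : 0 < x by rewrite divr_gt0// mulr_gt0.
have [K [uK K0 escK]] := small_escape am o x0.
exists K; split => //.
pose esc g := [set y | cocycle_iter sigma khat n y g \notin K].
pose inK g := [set y | exists2 h, h \in K & cocycle_iter sigma khat n y g = h].
have inKP g : measurable (inK g) /\ prob nu_prob (inK g) = \sum_(h <- K) return_prob n g h.
  apply: prob_bigcup_seq => //; first by move=> h; apply: return_event_measurable.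
  by move=> h h' y _ _ /= -> ->.
have escE g : esc g = ~` inK g.
  apply/seteqP; split => y; first by move=> nK [h hK e]; rewrite /esc/= e hK in nK.
  by move=> nK; apply/negP => kK; apply: nK; exists (cocycle_iter sigma khat n y g).
have esc_le g : g \in K -> prob nu_prob (esc g) <=
    4^-1 + (prob mu Omega)^-1 * \sum_(j <- iota 0 M) prob mu (flux_event K j g).
  move=> gK.
  have [mU PU] := prob_union_seq_le mu (iota 0 M) (fun j => flux_event_measurable K j g).
  have mesc : measurable (esc g) by rewrite escE; apply: measurableC; case: (inKP g).
  apply: (@le_trans _ _ (prob nu_prob (N `|`
      [set y | exists2 j, j \in iota 0 M & flux_event K j g y]))).
    apply: prob_mono => //; first exact: measurableU.
    move=> y; rewrite /esc/= => nK; have [|nN] := pselect (N y); first by left.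
    right; have [w [sw wy wM]] := NP y nN.
    have bk : birkhoff sigma rt n y = word_time letter_time w.
      rewrite -sw; apply: birkhoff_word wy => b z bz; exact: letter_timeE.
    move: nK; rewrite khat_iter bk => nK; apply: contrapT => no.
    (* Without a crossing before time [M] the walk started in [K] stays there up to time [M], hence
       up to the [n]-th return. *)
    have : forall j, (j <= M)%N -> cocycle_iter theta kappa j y g \in K.
      elim=> [//|j IH] jM; apply: contrapT => nj; apply: no.
      exists j; first by rewrite mem_iota.
      by split; [exact/IH/ltnW|exact/negP].
    by move=> /(_ _ wM) h; rewrite h in nK.
  apply: le_trans (probU_le nu_prob mN mU) _; apply: lerD => //.
  apply: le_trans (nu_prob_le mU) _.
  by rewrite ler_wpM2l// invr_ge0 ltW.
have key : \sum_(g <- K) prob nu_prob (esc g) <= (size K)%:R / 2.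
  apply: le_trans (ler_sum_seq esc_le) _.
  rewrite big_split/= sumr_const_seq_nat -mulr_sumr exchange_big/=.
  apply: (@le_trans _ _ ((size K)%:R * 4^-1 + (prob mu Omega)^-1 *
      \sum_(j <- iota 0 M) x * (size K)%:R)).
    rewrite lerD2l ler_wpM2l ?invr_ge0 ?(ltW O0)//; apply: ler_sum => j _.
    exact: le_trans (flux_le j uK) escK.
  rewrite sumr_const_seq_nat size_iota.
  have -> : (size K)%:R / 2 = (size K)%:R * 4^-1 + (size K)%:R * 4^-1 :> R by field.
  rewrite lerD2l.
  rewrite [leLHS](_ : _ = (size K)%:R * 4^-1 * (M%:R / M.+1%:R)); last first.
    by rewrite /x; field; rewrite gt_eqF ?gt_eqF.
  by rewrite ler_piMr ?mulr_ge0// ler_pdivrMr// mul1r ler_nat.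
have eqK : \sum_(g <- K) \sum_(h <- K) return_prob n g h =
    (size K)%:R - \sum_(g <- K) prob nu_prob (esc g).
  rewrite -[(size K)%:R]mulr1 -sumr_const_seq_nat -sumrB; apply: eq_bigr => g _.
  have [mI <-] := inKP g; rewrite escE prob_setC//; ring.
rewrite eqK lerBrDr; lra.
Qed.

Definition return_event (o : V) n : set X := Omega `&` (iter n theta @^-1` Omega) `&`
  [set x | cocycle_iter theta kappa n x o = o].

Let theta_iter_measurable n A : measurable A -> measurable (iter n theta @^-1` A).
Proof. exact: (iter_measurable alpha_system). Qed.

Lemma return_event_meas o n : measurable (return_event o n).
Proof.
apply: measurableI; last exact: kappa_iter_measurable.
by apply: measurableI => //; apply: theta_iter_measurable.
Qed.

(* Poincare recurrence: under such a decay the points of [Omega] that do not come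
   back at the times [m1, ..., k m1] have mass at least [mu Omega / 2], while their
   preimages under [theta^(i m1)], [i < k], are disjoint. *)
Lemma no_decay_of_returns (rho c : R) : 0 < rho < 1 -> 0 <= c ->
  ~ forall n, prob mu (Omega `&` iter n theta @^-1` Omega) <= c * rho ^+ n.
Proof.
move=> /andP[rho0 rho1] c0 decay; have O0 := mu_Omega_gt0.
have r1 : 0 < 1 - rho by lra.
have c1 : 0 < 2 * (c + 1) by lra.
have rr : 0 <= rho < 1 by rewrite ltW.
have [m0 m0P] := exists_expr_lt rr (divr_gt0 (mulr_gt0 O0 r1) c1).
pose m1 := m0.+1.
have m1P : c * (rho ^+ m1 / (1 - rho)) <= prob mu Omega / 2.
  have := m0P m1 (leqnSn m0); rewrite ltr_pdivlMr// => h.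
  rewrite mulrA ler_pdivrMr//.
  have : 0 <= rho ^+ m1 by rewrite exprn_ge0// ltW.
  lra.
pose k := Num.bound (2 / prob mu Omega).
have kP : 2 / prob mu Omega < k%:R by apply: archi_boundP; rewrite divr_ge0// ltW.
pose A m := Omega `&` iter m theta @^-1` Omega.
have mA m : measurable (A m) by apply: measurableI => //; apply: theta_iter_measurable.
pose ix := index_iota m1 (k * m1).+1.
have [mU PU] := prob_union_seq_le mu ix mA.
set U := [set x | _] in mU PU.
have Ule : prob mu U <= prob mu Omega / 2.
  apply: le_trans PU (le_trans _ m1P).
  apply: (@le_trans _ _ (\sum_(m1 <= m < (k * m1).+1) c * rho ^+ m)).
    by apply: ler_sum => m _; apply: decay.
  by rewrite -mulr_sumr ler_wpM2l// geometric_sum_le// rho0.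
have mO' : measurable (Omega `\` U) by exact: measurableD.
have O'ge : prob mu Omega / 2 <= prob mu (Omega `\` U).
  have : prob mu (Omega `&` U) <= prob mu U.
    by apply: prob_mono => //; apply: measurableI.
  have := probDI mu mO mU; lra.
pose F i := iter (i * m1) theta @^-1` (Omega `\` U).
have mF i : measurable (F i) by exact: theta_iter_measurable.
have FlF i j x : (i < j)%N -> (j < k)%N -> F i x -> F j x -> False.
  move=> ij jk [Oi nU] [Oj _]; apply: nU.
  have sz : ((j - i) * m1 + i * m1 = j * m1)%N by rewrite -mulnDl subnK// ltnW.
  exists ((j - i) * m1)%N; last by split => //=; rewrite -iterD sz.
  rewrite mem_index_iota ltnS leq_pmull ?subn_gt0//=.
  by rewrite leq_mul2r (leq_trans (leq_subr _ _) (ltnW jk)) orbT.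
have [|mV PV] := @prob_bigcup_seq _ _ _ mu _ (iota 0 k) F (iota_uniq 0 k) mF.
  move=> i j x; rewrite !mem_iota !add0n => /andP[_ ik] /andP[_ jk] Fi Fj.
  have [ij|ji|//] := ltngtP i j; exfalso; [exact: FlF ij jk Fi Fj|exact: FlF ji ik Fj Fi].
have := prob_le1 mu mV; rewrite PV.
under eq_bigr do rewrite /F prob_invariant//.
rewrite sumr_const_seq_nat size_iota leNgt => /negP; apply.
apply: (@lt_le_trans _ _ (k%:R * (prob mu Omega / 2))).
  move: kP; rewrite ltr_pdivrMr// => kP.
  by rewrite mulrA ltr_pdivlMr// mul1r.
by rewrite ler_wpM2l.
Qed.

Lemma word_time_ge_size (w : seq B) : (forall b, (0 < letter_time b)%N) ->
  (size w <= word_time letter_time w)%N.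
Proof.
move=> t0; elim: w => //= b w IH; rewrite /word_time/= -add1n.
exact: leq_add.
Qed.

(** As return times are positive, a return of [S] at time [n] is a return of [T] at some time
    [m >= n], and the decay is summed over [m]. The cut-off [M] only makes the union finite. *)
Lemma return_prob_decay (rho c : R) o : (forall b, (0 < letter_time b)%N) ->
  0 < rho < 1 -> 0 <= c -> (forall n, prob mu (return_event o n) <= c * rho ^+ n) ->
  exists c', forall n, return_prob n o o <= c' * rho ^+ n.
Proof.
move=> t0 rho01 c0 decay; have O0 := mu_Omega_gt0.
exists ((prob mu Omega)^-1 * (c / (1 - rho))) => n.
apply/ler_addgt0Pr => e e0.
have [M [N [mN Nle NP]]] := bounded_return_time n e0.
have [mU PU] := prob_union_seq_le mu (index_iota n M.+1) (return_event_meas o).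
set U := [set x | _] in mU PU.
have mOC := measurableC mO.
pose Z := ~` Omega `|` iter n sigma @^-1` ~` Omega.
have msO : measurable (iter n sigma @^-1` ~` Omega) := iter_measurable beta_system n mOC.
have mZ : measurable Z by exact: measurableU.
have Z0 : prob nu_prob Z = 0.
  apply/prob0P => //; apply: negligibleU => //.
  by apply/negligibleP => //; apply: null_pre => //; apply: nu_OmegaC.
have mNZ : measurable (N `|` Z) by exact: measurableU.
apply: (@le_trans _ _ (prob nu_prob ((N `|` Z) `|` U))).
  apply: prob_mono; [exact: return_event_measurable|exact: measurableU|].
  move=> y /= yo; have [|nN] := pselect (N y); first by left; left.
  have [|nZ] := pselect (Z y); first by left; right.
  right; have [w [sw wy wM]] := NP y nN.
  have bk : birkhoff sigma rt n y = word_time letter_time w.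
    rewrite -sw; apply: birkhoff_word wy => b z bz; exact: letter_timeE.
  exists (word_time letter_time w).
    by rewrite mem_index_iota ltnS wM andbT -sw word_time_ge_size.
  rewrite -bk; split; last by rewrite /= -khat_iter.
  split; first by apply: contrapT => nO; apply: nZ; left.
  by rewrite /= -sigma_iter; apply: contrapT => nO; apply: nZ; right.
apply: le_trans (probU_le nu_prob mNZ mU) _.
rewrite addrC; apply: lerD; last first.
  by apply: le_trans (probU_le nu_prob mN mZ) _; rewrite Z0 addr0.
apply: le_trans (nu_prob_le mU) _; rewrite -mulrA ler_wpM2l ?invr_ge0 ?(ltW O0)//.
apply: le_trans PU _.
apply: (@le_trans _ _ (\sum_(n <= m < M.+1) c * rho ^+ m)).
  by apply: ler_sum => m _; apply: decay.
rewrite -mulr_sumr mulrAC -mulrA ler_wpM2l//; exact: geometric_sum_le.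
Qed.

Lemma amenable_return_rate (o : V) : mu_amenable E mu kappa ->
  symmetric_extension Omega sigma nu khat -> return_rate theta mu kappa Omega o = 1%E.
Proof.
move=> am [C [N [C_gt0 C_root N_small sym]]].
apply/eqP; rewrite eq_le; apply/andP; split.
  apply: (@limn_esup_root_le R (fun n => prob mu (return_event o n)) 1 0).
  - by move=> n; apply: prob_ge0.
  - exact: ler01.
  - by move=> n _; rewrite expr1n; apply/prob_le1/return_event_meas.
rewrite leNgt; apply/negP => lt1.
have [|rho [c [rho0 rho1 c0 decay]]] :=
    @limn_esup_root_decay R (fun n => prob mu (return_event o n)) _ lt1.
  by move=> n; rewrite prob_ge0 prob_le1//; apply: return_event_meas.
have rho01 : 0 < rho < 1 by rewrite rho0.
(* Positivity of return times needs a second vertex. With one vertex the cocycle condition is void,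
   and decay contradicts recurrence. *)
have [[g go]|triv] := pselect (exists g, g <> o); last first.
  have allo g : g = o by apply: contrapT => ng; apply: triv; exists g.
  apply: (no_decay_of_returns rho01 c0) => n; apply: le_trans (decay n).
  apply: prob_mono; [| exact: return_event_meas|by move=> x Ax; split => //; exact: allo].
  by apply: measurableI => //; apply: theta_iter_measurable.
have [c' c'P] := return_prob_decay (fun b => letter_time_gt0 b go) rho01 c0 decay.
apply: (@no_exponential_decay R V return_prob (Dist 0) C N o rho c') => //.
- by move=> *; apply: prob_ge0.
- exact/dfactor_gt0/r_bounds.
- exact: return_prob0.
- exact: return_prob_super.
- move=> n g1 g2 n0; have := sym g1 g2 n n0.
  have nuP k h1 h2 : nu (Omega `&` [set x | cocycle_iter sigma khat k x h1 = h2]) =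
      (return_prob k h1 h2)%:E.
    have mQ := return_event_measurable k h1 h2.
    rewrite /nu nu_probE probE; last exact: measurableI.
    by rewrite prob_nu_Omega.
  rewrite nuP; under eq_bigr do rewrite nuP.
  by rewrite sumEFin -EFinM lee_fin.
- exact: return_prob_trans.
- exact: folner_return.
Qed.

(** * Expansion from finite covering and uniform loops *)

Section NonAmenable.
Hypothesis h_loops : uniform_loops bbeta khat.
Hypothesis h_covers : finitely_covers theta alpha kappa nu sigma bbeta khat.

Lemma letters_of_word w : word_in bbeta w -> exists z : seq B, map val z = w.
Proof.
elim: w => [|a w IH]; first by exists [::].
move=> /word_in_cons[aa /IH[z <-]].
by exists (SigSub (mem_set aa) :: z).
Qed.

Lemma cover_words : exists Z : seq (seq B), forall v g, alpha v -> exists z h,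
  [/\ z \in Z, word_cocycle theta kappa [:: v] g h & word_map letter_map z g = h].
Proof.
have [K [finK KW cov]] := h_covers.
have /finite_seqP[s sK] := finK.
have conv (s' : seq (seq (set X))) : (forall w, w \in s' -> word_in bbeta w) ->
    exists Z : seq (seq B), forall w, w \in s' -> exists2 z, z \in Z & map val z = w.
  elim: s' => [|w s' IH] h; first by exists [::].
  have [|Z ZP] := IH; first by move=> w' w's; apply: h; rewrite inE w's orbT.
  have [|z zw] := @letters_of_word w; first by apply: h; rewrite mem_head.
  exists (z :: Z) => w'; rewrite inE => /orP[/eqP->|/ZP[z' z'Z e]].
    by exists z => //; rewrite mem_head.
  by exists z' => //; rewrite inE z'Z orbT.
have [|Z ZP] := conv s.
  move=> w ws; have : K w by rewrite sK.
  move=> /KW[n _ [_ <- h _]] a aw.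
  by rewrite -(nth_index set0 aw); apply: h; rewrite index_mem.
exists Z => v g vv; have [w [h [Kw wc wc']]] := cov v g vv.
have [z zZ zw] : exists2 z, z \in Z & map val z = w.
  by apply: ZP; rewrite sK in Kw.
exists z, h; split => //; case: wc' => x; rewrite -zw => zx <-.
by rewrite size_map (cocycle_word (kl := letter_map) g _ zx)// => b y h' b_y; exact: letter_mapE.
Qed.

Lemma loop_letters : exists L : seq B, forall g, exists2 b, b \in L & letter_map b g = g.
Proof.
have [J [finJ Jb loop]] := h_loops.
have /finite_seqP[s sJ] := finJ.
have conv (s' : seq X) : (forall x, x \in s' -> (\bigcup_(a in bbeta) a) x) ->
    exists L : seq B, forall x, x \in s' -> exists2 b, b \in L & val b x.
  elim: s' => [|x s' IH] h; first by exists [::].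
  have [|L LP] := IH; first by move=> w' w's; apply: h; rewrite inE w's orbT.
  have [|a aa ax] := h x; first by rewrite mem_head.
  exists (SigSub (mem_set aa) :: L) => y; rewrite inE => /orP[/eqP->|/LP[b bL b_y]].
    by exists (SigSub (mem_set aa)) => //; rewrite mem_head.
  by exists b => //; rewrite inE bL orbT.
have [|L LP] := conv s; first by move=> x xs; apply: Jb; rewrite sJ.
exists L => g; have [x Jx xg] := loop g.
have [b bL bx] : exists2 b, b \in L & val b x by apply: LP; rewrite sJ in Jx.
by exists b => //; rewrite -(letter_mapE g bx).
Qed.

Lemma word_map_nseq (b : B) n g : letter_map b g = g ->
  word_map letter_map (nseq n b) g = g.
Proof. by move=> bg; elim: n => //= n IH; rewrite bg. Qed.

(** At a boundary vertex [g] with an edge to [h] outside [K], the word repeating a loop at [g] stays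
    in [K], while a covering word leads to [h] and is padded by a loop at [h]. Loops thus provide
    both the word that stays and the common length [N]. *)
Lemma expansion_of_cover (eps delta : R) : 0 < eps ->
  (forall K : {fset V}, (0 < #|` K|)%N ->
    delta * (#|` K|)%:R <= (#|` eps_boundary E mu kappa eps K|)%:R) ->
  exists L N, uniq L /\ forall K, uniq K -> delta * (size K)%:R <=
    (size (split_vertices (words_over L N) (word_map letter_map) K))%:R.
Proof.
move=> eps0 iso; have [Z ZP] := cover_words; have [L1 L1P] := loop_letters.
pose L := undup (flatten Z ++ L1).
pose N := (\max_(z <- Z) size z)%N.
exists L, N; split; first exact: undup_uniq.
move=> K uK; have [->|K0] := eqVneq K [::]; first by rewrite mulr0.
pose K' : {fset V} := [fset x in K]%fset.
have KK' x : (x \in K') = (x \in K) by rewrite inE.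
have sK : #|` K'| = size K.
  by rewrite card_fseq undup_id.
have := iso K'; rewrite sK lt0n size_eq0 K0 => /(_ isT)/le_trans; apply.
rewrite ler_nat; apply: uniq_leq_size; first exact: fset_uniq.
move=> g; rewrite !inE => /andP[gK /asboolP[[g' h] [/= _ -> hK pe]]].
rewrite mem_filter gK andbT.
have [l1 l1L l1g] := L1P g; have [l2 l2L l2h] := L1P h.
apply/andP; split; apply/hasP.
  exists (nseq N l1); last by rewrite word_map_nseq.
  by rewrite mem_words_over size_nseq eqxx all_nseq /= mem_undup mem_cat l1L !orbT.
have [x xgh] : exists x, kappa x g = h.
  apply: contrapT => no; move: pe; rewrite /edge_weight/= (_ : [set _ | _] = set0).
    by rewrite measure0 lte_fin ltNge (ltW eps0).
  by apply/seteqP; split => // y yh; apply: no; exists y.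
have [a aa ax] := alpha_cover x.
have [z [h' [zZ [y ya /= yh] zg]]] := ZP a g aa.
have eh : h' = h.
  rewrite -yh -xgh; apply: (nn_locally_constant h_kappa aa) => //.
  exact: (ya 0%N).
have sz : (size z <= N)%N by apply: (leq_bigmax_seq (F := size)).
exists (z ++ nseq (N - size z) l2); last first.
  by rewrite word_map_cat zg eh word_map_nseq// -KK'.
rewrite mem_words_over size_cat size_nseq subnKC// eqxx all_cat all_nseq /=.
rewrite mem_undup mem_cat l2L !orbT andbT; apply/allP => b bz.
rewrite /= mem_undup mem_cat; apply/orP; left; apply/flattenP; by exists z.
Qed.

End NonAmenable.

(** * Exponential tails and decay for the induced extension *)

Section TimeTails.
Hypothesis h_tails : exponential_tails theta mu Omega beta eta.

Lemma letter_mass_time (L : seq B) n : uniq L ->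
  \sum_(b <- L) (letter_time b == n)%:R * ms [:: b] <=
  (prob mu Omega)^-1 * prob mu (Omega `&` [set x | rt x = n]).
Proof.
move=> uL; have mrt := return_time_measurable n.
rewrite (bigID (fun b => letter_time b == n))/= [X in _ + X]big1 ?addr0; last first.
  by move=> b /negbTE->; rewrite mul0r.
rewrite (eq_bigr (fun b => ms [:: b])); last by move=> b ->; rewrite mul1r.
rewrite -big_filter.
have [|mU <-] := @prob_bigcup_seq _ _ _ nu_prob _ [seq b <- L | letter_time b == n]
   (fun b => cy [:: b]) (filter_uniq _ uL) (fun b => cyl_measurable beta_system _).
  by move=> b b' x _ _ bx b'x; have [] := cyl_disjoint
    beta_system (erefl : size [:: b] = size [:: b']) bx b'x.
apply: (@le_trans _ _ (prob nu_prob [set x | rt x = n])).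
  apply: prob_mono => // x [b]; rewrite mem_filter => /andP[/eqP <- _] /cyl_cons[bx _].
  exact: letter_timeE.
by rewrite nu_prob_val// setIC.
Qed.

Lemma time_tail (x : R) : 0 < x -> exists2 s : R, 1 < s &
  forall L : seq B, uniq L -> \sum_(b <- L) ms [:: b] * (s ^+ letter_time b - 1) <= x.
Proof.
move=> x0; have O0 := mu_Omega_gt0.
have mrt n : measurable (Omega `&` [set x | rt x = n]).
  by apply: measurableI => //; apply: return_time_measurable.
have [|rho [c [rho0 rho1 c0 decay]]] :=
    @limn_esup_root_decay R (fun n => prob mu (Omega `&` [set x | rt x = n])) _ h_tails.
  by move=> n; rewrite prob_ge0 prob_le1.
have rho01 : 0 < rho < 1 by rewrite rho0.
have r1 : 0 < 1 - rho by lra.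
(* For [s = 1 + t] with [t <= (1 - rho) / 2] one has [1 - rho * s >= (1 - rho) / 2], so that
   [sum_expr_gap_le] gives at most [t * K]. *)
pose K := (prob mu Omega)^-1 * c * (2 / (1 - rho) ^+ 2).
have K0 : 0 <= K by rewrite !mulr_ge0 ?invr_ge0 ?exprn_ge0// ltW.
pose t := Num.min ((1 - rho) / 2) (x / (K + 1)).
have K1 : 0 < K + 1 by lra.
have t0 : 0 < t by rewrite lt_min !divr_gt0.
have t1 : t <= (1 - rho) / 2 by rewrite ge_min lexx.
have tK : t * (K + 1) <= x by rewrite -ler_pdivlMr// ge_min lexx orbT.
exists (1 + t); first by rewrite ltrDl.
move=> L uL.
pose Q := (\max_(b <- L) letter_time b).+1.
have s1 : 1 <= 1 + t by rewrite lerDl ltW.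
have rs : rho * (1 + t) <= (1 + rho) / 2 by nra.
have rs1 : rho * (1 + t) < 1 by lra.
apply: (@le_trans _ _ (\sum_(0 <= n < Q) ((1 + t) ^+ n - 1) *
    \sum_(b <- L) (letter_time b == n)%:R * ms [:: b])).
  under [leRHS]eq_bigr do rewrite mulr_sumr.
  rewrite exchange_big/=; apply: ler_sum_seq => b bL.
  have bQ : letter_time b \in index_iota 0 Q.
    by rewrite mem_index_iota ltnS; apply: (leq_bigmax_seq (F := letter_time)).
  rewrite (perm_big _ (perm_to_rem bQ)) big_cons/= eqxx mul1r mulrC lerDl.
  apply: sumr_ge0 => n _; rewrite !mulr_ge0 ?(ltW (ms_gt0 _))//.
  by rewrite subr_ge0 exprn_ege1.
apply: (@le_trans _ _ ((prob mu Omega)^-1 * c *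
    \sum_(0 <= n < Q) ((1 + t) ^+ n - 1) * rho ^+ n)).
  rewrite mulr_sumr; apply: ler_sum => n _; rewrite mulrCA ler_wpM2l//.
    by rewrite subr_ge0 exprn_ege1.
  apply: le_trans (letter_mass_time n uL) _.
  by rewrite -mulrA ler_wpM2l ?invr_ge0 ?(ltW O0).
have Oc : 0 <= (prob mu Omega)^-1 * c by rewrite mulr_ge0// invr_ge0 ltW.
apply: le_trans (ler_wpM2l Oc (sum_expr_gap_le Q rho01 s1 rs1)) _.
apply: (@le_trans _ _ (t * K)); last first.
  by apply: le_trans tK; rewrite ler_wpM2l ?(ltW t0)// lerDl.
rewrite (_ : t * K = (prob mu Omega)^-1 * c * (t * (2 / (1 - rho) ^+ 2))); last first.
  by rewrite /K; ring.
rewrite ler_wpM2l//.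
have r2 : 0 < 1 - rho * (1 + t) by lra.
rewrite ler_pdivrMr ?mulr_gt0//.
rewrite [leRHS](_ : _ = t * (2 * (1 - rho * (1 + t)) / (1 - rho))); last first.
  by field; rewrite gt_eqF.
rewrite addrC addKr ler_wpM2l ?(ltW t0)// ler_pdivlMr//; nra.
Qed.

Lemma birkhoff_measurable n t : measurable [set x | birkhoff sigma rt n x = t].
Proof.
elim: n t => [|n IH] t.
  have [t0|t0] := eqVneq t 0%N.
    rewrite (_ : [set _ | _] = setT)//; apply/seteqP; split=> // x _ /=.
    by rewrite /birkhoff big_ord0.
  rewrite (_ : [set _ | _] = set0)//; apply/seteqP; split=> // x /=.
  by rewrite /birkhoff big_ord0 => e; rewrite -e eqxx in t0.
rewrite (_ : [set _ | _] = \bigcup_(i in [set i | (i <= t)%N])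
  ([set x | birkhoff sigma rt n x = i] `&`
   iter n sigma @^-1` [set x | rt x = t - i]%N)).
  apply: bigcup_measurable_countable; first exact: countableP.
  move=> i _; apply: measurableI => //.
  exact: (iter_measurable beta_system n (return_time_measurable _)).
apply/seteqP; split => x /=; rewrite birkhoff_recr.
  move=> <-; exists (birkhoff sigma rt n x); first by rewrite /= leq_addr.
  by split => //=; rewrite addKn.
by move=> [i /= it [-> ->]]; rewrite subnKC.
Qed.

Definition timed_return n t g h : set X := [set x | birkhoff sigma rt n x = t] `&`
  [set x | cocycle_iter sigma khat n x g = h].

Lemma timed_return_measurable n t g h : measurable (timed_return n t g h).
Proof.
by apply: measurableI; [exact: birkhoff_measurable|exact: return_event_measurable].
Qed.

(** Recording the total time [t] turns the bounded weighted sum into decay [s ^- t], uniformly in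
    the number [n] of returns; this is the form that survives the passage to [theta]-time. *)
Lemma timed_return_decay (o : V) (L0 : seq B) N (delta : R) : uniq L0 -> 0 < delta ->
  (forall K, uniq K -> delta * (size K)%:R <=
    (size (split_vertices (words_over L0 N) (word_map letter_map) K))%:R) ->
  exists s c : R, 1 < s /\ forall n t g h,
    prob nu_prob (timed_return n t g h) * s ^+ t <= c.
Proof.
move=> uL0 delta0 expansion.
have Dist_small := dfactor_small C0_gt0 r_bounds.
have Dist_ge1 := dfactor_ge1 C0_gt0 r_bounds.
have Dist_gt0 i : 0 < Dist i := lt_le_trans ltr01 (Dist_ge1 i).
have [s [c [s1 bound]]] := weighted_return_bounded letter_map_inj ms_gt0 (mass_nil _ _ _)
  (Dist_ge1 0%N) Dist_gt0 ms_sum quasi quasi' o uL0 delta0 expansion Dist_small exhaust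
  time_tail.
exists s, c; split => // n t g h.
have st : 0 < s ^+ t by rewrite exprn_gt0// (lt_trans ltr01).
apply/ler_addgt0Pr => x x0.
(* The uncovered mass will be multiplied by [s ^+ t], hence the precision [x / s ^+ t]. *)
have [L uL hL] := exhaust n (divr_gt0 x0 st).
pose P z := (word_time letter_time z == t) && (word_map letter_map z g == h).
have := @word_event_bounds _ _ _ _ _ _ beta_system _ P n L uL (timed_return_measurable n t g h) _.
move=> /(_ _)/andP[|_ le_P].
  move=> z y <- zy; rewrite /timed_return /P/=.
  rewrite (birkhoff_word (e := letter_time) _ zy); last by move=> b b_ ?; exact: letter_timeE.
  rewrite (cocycle_word (kl := letter_map) g _ zy); last by move=> b b_ ? ?; exact: letter_mapE.
  by split=> [[-> ->]|/andP[/eqP -> /eqP ->]]; rewrite ?eqxx.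
rewrite -ler_pdivlMr//; apply: le_trans le_P _; rewrite mulrDl lerD//; last first.
  by rewrite lerBlDr addrC -lerBlDr.
rewrite ler_pdivlMr//; apply: le_trans (bound L n h g uL).
rewrite /weighted_return mulr_suml; apply: ler_sum => z _; rewrite /P cat0s.
case: (word_time letter_time z =P t) => [->|_] /=; first by rewrite mulrAC.
rewrite mulr0 mul0r !mulr_ge0 ?(ltW (ms_gt0 _))// exprn_ge0//.
by rewrite ltW// (lt_trans ltr01).
Qed.

End TimeTails.

(** * From the induced extension back to the original one *)

Lemma theta_image_measurable l A : measurable A -> measurable (iter l theta @` A).
Proof.
elim: l A => [|l IH] A mA; first by rewrite image_id.
rewrite (_ : _ @` A = iter l theta @` (theta @` A)); last first.
  by rewrite image_comp; apply/eq_imagel => x _ /=; rewrite -iterSr.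
apply: IH; rewrite (_ : theta @` A = \bigcup_(a in alpha) (theta @` (A `&` a))).
  apply: bigcup_measurable_countable; first exact: ms_countable alpha_system.
  move=> a aa; apply: (ms_image alpha_system aa); last by move=> x [].
  by apply: measurableI => //; exact: ms_letter alpha_system _ aa.
apply/seteqP; split => y; last by move=> [a _ [x [Ax _] <-]]; exists x.
by move=> [x Ax <-]; have [a aa ax] := alpha_cover x; exists a => //; exists x.
Qed.

Lemma Omega_letters : exists s : seq (set X),
  (forall a, a \in s -> alpha a /\ a `<=` Omega) /\
  forall x, Omega x -> exists2 a, a \in s & a x.
Proof.
have [A0 [finA A0a OA]] := eg_union h_embedded.
have /finite_seqP[s sA] := finA; exists s; split.
  move=> a; have -> : (a \in s) = (a \in A0) :> Prop.
    by rewrite sA; apply/propext; split; rewrite inE.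
  rewrite inE => A0A; split; first exact: A0a.
  by rewrite OA => x ax; exists a.
by rewrite OA sA => x [a /= aA ax]; exists a.
Qed.

Lemma positive_min (s : seq (set X)) : (forall a, a \in s -> 0 < prob mu a) ->
  exists2 p0, 0 < p0 & forall a, a \in s -> p0 <= prob mu a.
Proof.
elim: s => [|a s IH] h; first by exists 1.
have [|p0 p00 IHp] := IH; first by move=> b bs; apply: h; rewrite inE bs orbT.
exists (Num.min p0 (prob mu a)); first by rewrite lt_min p00 h// mem_head.
move=> b; rewrite inE => /orP[/eqP->|/IHp]; first by rewrite ge_min lexx orbT.
by apply: le_trans; rewrite ge_min lexx.
Qed.

Section Excursions.
Hypothesis h_adequate : adequate theta mu alpha Omega beta eta r.
Hypothesis letter_time_pos : forall b, (0 < letter_time b)%N.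
Variable o : V.

(** The function [etad] comes without measurability, so the points with more than [M] steps to go
    are described by forward images, which are measurable. These sets decrease to the empty set,
    since [etad] is finite at each point. *)
Lemma excursion_bound (p0 : R) : 0 < p0 -> exists (N0 G : set X) (M q : nat),
  [/\ measurable N0, mu N0 = 0%E, measurable G, prob mu (~` G) <= p0 &
   forall y, G y -> Omega y ->
     (forall l x, Omega x -> ~ N0 x -> (l < rt x)%N -> iter l theta x = y ->
        (rt x <= l + M)%N) /\
     (forall j, (j <= M)%N -> (choice.pickle (cocycle_iter theta kappa j y o) <= q)%N)].
Proof.
move=> p00; have p02 : 0 < p0 / 2 by rewrite divr_gt0.
have [etad [N0 [mN0 N00 NP]]] := ad_return h_adequate.
pose long M := [set y | Omega y /\ exists l x,
  [/\ Omega x, ~ N0 x, (l + M < rt x)%N & iter l theta x = y]].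
have longE M : long M = Omega `&` \bigcup_l (iter l theta @`
    ((Omega `&` [set x | (l + M < rt x)%N]) `\` N0)).
  apply/seteqP; split => y [Oy].
    move=> [l [x [Ox Nx lx xy]]]; split => //; exists l => //.
    by exists x; [split; [split; [exact: Ox|exact: lx]|exact: Nx]|exact: xy].
  by move=> [l _ [x [[Ox lx] Nx] xy]]; split; [exact: Oy|exists l, x; split].
have mlong M : measurable (long M).
  rewrite longE; apply: measurableI => //; apply: bigcupT_measurable => l.
  apply: theta_image_measurable; apply: measurableD => //; apply: measurableI => //.
  rewrite (_ : [set _ | _] = \bigcup_(i in [set i | (l + M < i)%N]) [set x | rt x = i]).
    apply: bigcup_measurable_countable; first exact: countableP.
    by move=> i _; apply: return_time_measurable.
  apply/seteqP; split => x /=; first by move=> h; exists (rt x).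
  by move=> [i /= h ->].
have [||M Mle] := @prob_decreasing _ _ _ mu long mlong _ _ _ p02.
- move=> i j ij y [Oy [l [x [Ox Nx lx e]]]]; split => //; exists l, x; split => //.
  by apply: leq_ltn_trans lx; rewrite leq_add2l.
- apply: negligibleS (@negligible_set0 _ _ _ mu) => y capy.
  have [Oy [l [x [Ox Nx lx e]]]] := capy (etad y) Logic.I.
  have P : Omega x -> forall l, (l < rt x)%N -> Omega (iter l theta x) ->
      (rt x - l <= etad (iter l theta x))%N.
    by apply: contrapT => nP; apply: Nx; apply: NP.
  have := P Ox l; rewrite e => /(_ (leq_ltn_trans (leq_addr _ _) lx) Oy).
  by rewrite leq_subLR leqNgt lx.
(* The cocycle over the remaining [M] steps may take infinitely many values; finitely many codes
   suffice up to small mass. *)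
pose big q := [set y | exists2 j, j \in iota 0 M.+1 &
  (q < choice.pickle (cocycle_iter theta kappa j y o))%N].
have mbig q : measurable (big q).
  have [|mU _] := @prob_union_seq_le _ _ _ mu _ (iota 0 M.+1)
    (fun j => [set y | (q < choice.pickle (cocycle_iter theta kappa j y o))%N]) => //.
  move=> j; rewrite (_ : [set _ | _] = \bigcup_(v in [set v | (q < choice.pickle v)%N])
     [set y | cocycle_iter theta kappa j y o = v]).
    apply: bigcup_measurable_countable; first exact: countableP.
    by move=> v _; apply: kappa_iter_measurable.
  apply/seteqP; split => y /=; first by move=> h; exists (cocycle_iter theta kappa j y o).
  by move=> [v /= qv ->].
have [||q qle] := @prob_decreasing _ _ _ mu big mbig _ _ _ p02.
- by move=> i j ij y [k kM jk]; exists k => //; apply: leq_ltn_trans jk.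
- apply: negligibleS (@negligible_set0 _ _ _ mu) => y capy.
  pose q0 := (\max_(j <- iota 0 M.+1) choice.pickle (cocycle_iter theta kappa j y o))%N.
  have [j jM] := capy q0 Logic.I; rewrite ltnNge => /negP; apply.
  exact: (leq_bigmax_seq (F := fun j => choice.pickle (cocycle_iter theta kappa j y o))).
exists N0, (~` (long M `|` big q)), M, q.
have mlb : measurable (long M `|` big q) by exact: measurableU.
split => //; first exact: measurableC.
  rewrite setCK; apply: le_trans (probU_le mu (mlong M) (mbig q)) _.
  by rewrite (splitr p0) lerD// ltW.
move=> y ny Oy; split => [l x Ox Nx lx e|j jM].
  by rewrite leqNgt; apply/negP => h; apply: ny; left; split => //; exists l, x.
rewrite leqNgt; apply/negP => h; apply: ny; right; exists j => //.
by rewrite mem_iota.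
Qed.

Lemma birkhoff_ge x n : (forall i, (\bigcup_(b in bbeta) b) (iter i sigma x)) ->
  (n <= birkhoff sigma rt n x)%N.
Proof.
move=> h; elim: n => [//|n IH]; rewrite birkhoff_recr -addn1.
apply: leq_add => //; have [b bb bx] := h n.
by rewrite (@letter_timeE (SigSub (mem_set bb)) _ bx).
Qed.

(* A point of [Omega] that [theta^m] brings back into [Omega] in the middle of a
   [sigma]-excursion with at most [M] steps to go reaches its next [sigma]-time at
   some [m + j], [j <= M], with the cocycle in the finite set [pickle v <= q]. *)
Lemma return_event_good_le (N0 G : set X) (M q m : nat) :
  measurable N0 -> mu N0 = 0%E -> measurable G ->
  (forall y, G y -> Omega y ->
     (forall l x, Omega x -> ~ N0 x -> (l < rt x)%N -> iter l theta x = y ->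
        (rt x <= l + M)%N) /\
     (forall j, (j <= M)%N -> (choice.pickle (cocycle_iter theta kappa j y o) <= q)%N)) ->
  prob mu (return_event o m `&` iter m theta @^-1` G) <=
  prob mu Omega * \sum_(n <- iota 0 m.+2) \sum_(j <- iota 0 M.+1)
    \sum_(h <- pmap choice.unpickle (iota 0 q.+1)) prob nu_prob (timed_return n (m + j) o h).
Proof.
move=> mN0 N00 mG GP; have O0 := mu_Omega_gt0.
have mA : measurable (return_event o m `&` iter m theta @^-1` G).
  by apply: measurableI; [exact: return_event_meas|exact: theta_iter_measurable].
have -> : prob mu (return_event o m `&` iter m theta @^-1` G) =
    prob mu Omega * prob nu_prob (return_event o m `&` iter m theta @^-1` G).
  rewrite nu_prob_val// mulrA mulfV ?gt_eqF// mul1r; congr prob.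
  by apply/esym/setIidl => x [[[]]].
rewrite ler_wpM2l ?prob_ge0//.
pose bad := N0 `|` ~` Omega `|` ~` \bigcup_(b in bbeta) b.
have mbU := bbeta_union_measurable.
have mbad : measurable bad.
  by apply: measurableU; [apply: measurableU => //; exact: measurableC|exact: measurableC].
have bad0 : nu_prob bad = 0%E.
  apply: (@null_subset _ _ _ nu_prob bad bad mbad) => //.
  apply: negligibleU (ms_cover beta_system); apply: negligibleU => //.
  by apply/negligibleP => //; apply: nu_null.
pose Z := \bigcup_n iter n sigma @^-1` bad.
have mZn n : measurable (iter n sigma @^-1` bad) := iter_measurable beta_system n mbad.
have mZ : measurable Z by exact: bigcupT_measurable.
have Z0 : prob nu_prob Z = 0.
  apply/prob0P => //; apply: negligible_bigcup => n.
  by apply/negligibleP => //; apply: null_pre.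
pose ix := [seq (p, h) | p <- [seq (n, j) | n <- iota 0 m.+2, j <- iota 0 M.+1],
  h <- pmap (@choice.unpickle V) (iota 0 q.+1)].
have [mU PU] := @prob_union_seq_le _ _ _ nu_prob _ ix
  (fun p => timed_return p.1.1 (m + p.1.2) o p.2)
  (fun p => timed_return_measurable _ _ _ _).
rewrite /ix big_allpairs big_allpairs in PU.
apply: le_trans PU; set U := [set x | _] in mU *.
apply: (@le_trans _ _ (prob nu_prob (Z `|` U))); last first.
  by apply: le_trans (probU_le nu_prob mZ mU) _; rewrite Z0 add0r.
apply: prob_mono => //; first exact: measurableU.
move=> x [[[Ox Omx] xo] Gx]; have [|nZ] := pselect (Z x); first by left.
right.
have good n : [/\ ~ N0 (iter n sigma x), Omega (iter n sigma x) &
    (\bigcup_(b in bbeta) b) (iter n sigma x)].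
  split; [move=> h|apply: contrapT => h|apply: contrapT => h]; apply: nZ; exists n => //.
  - by left; left.
  - by left; right.
  - by right.
have inb i : (\bigcup_(b in bbeta) b) (iter i sigma x) by case: (good i).
(* [n] numbers the excursion that contains the time [m]. It is at most [m] because every excursion
   takes at least one step. *)
have [n mn nmin] : exists2 n, (m < birkhoff sigma rt n.+1 x)%N &
    forall i, (m < birkhoff sigma rt i.+1 x)%N -> (n <= i)%N.
  have ex : exists n, (m < birkhoff sigma rt n.+1 x)%N.
    by exists m; apply: birkhoff_ge.
  by exists (ex_minn ex); case: ex_minnP.
have nm : (birkhoff sigma rt n x <= m)%N.
  case: n mn nmin => [|n] mn nmin; first by rewrite /birkhoff big_ord0.
  by rewrite leqNgt; apply/negP => /nmin; rewrite ltnn.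
have n_le_m : (n <= m)%N := leq_trans (birkhoff_ge n inb) nm.
pose x' := iter n sigma x; pose l := (m - birkhoff sigma rt n x)%N.
have lx' : (l < rt x')%N by rewrite ltn_subLR// -birkhoff_recr.
have lxy : iter l theta x' = iter m theta x.
  by rewrite /x' sigma_iter -iterD subnK.
have [nN Ox' _] := good n.
have [short pick] := GP _ Gx Omx.
have rtl := short l x' Ox' nN lx' lxy.
pose j := (rt x' - l)%N.
have jM : (j <= M)%N by rewrite leq_subLR.
have bk : birkhoff sigma rt n.+1 x = (m + j)%N.
  rewrite birkhoff_recr -/x' /j addnBA; last exact: ltnW.
  by rewrite -(subnKC nm) -/l -addnA [(l + rt x')%N]addnC addnA addnK.
pose h := cocycle_iter theta kappa j (iter m theta x) o.
exists ((n.+1, j), h).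
  apply/allpairsP; exists ((n.+1, j), h); split; [|rewrite [_.2]/=|by []].
    by apply/allpairsP; exists (n.+1, j); split; rewrite ?mem_iota.
  rewrite mem_pmap; apply/mapP; exists (choice.pickle h); last by rewrite choice.pickleK.
  by rewrite mem_iota/= ltnS; apply: pick.
have xh : cocycle_iter sigma khat n.+1 x o = h.
  by rewrite khat_iter bk cocycle_iterD xo.
by split; [exact: bk|exact: xh].
Qed.

End Excursions.

Lemma alpha_words_countable : countable [set u | word_in alpha u].
Proof.
have /countable_injP[f finj] := ms_countable alpha_system.
apply/countable_injP; exists (fun u => choice.pickle (map f u)).
move=> u v; rewrite !inE /= => uu vv /(pcan_inj choice.pickleK).
elim: u v uu vv => [|a u IH] [|b v]// /word_in_cons[aa uu] /word_in_cons[bb vv] [].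
move=> fab fuv; rewrite (finj a b (mem_set aa) (mem_set bb) fab).
by congr cons; apply: IH.
Qed.

Lemma itinerary n x : exists u, [/\ word_in alpha u, size u = n & cylinder theta u x].
Proof.
elim: n x => [|n IH] x; first by exists [::]; rewrite cylinder_nil.
have [a aa ax] := alpha_cover x; have [u [uu su ux]] := IH (theta x).
exists (a :: u); split; rewrite ?cylinder_cons//=; last by rewrite su.
by move=> b; rewrite inE => /orP[/eqP->|/uu].
Qed.

Lemma kappa_iter_const w x y g n : word_in alpha w -> (n <= size w)%N ->
  cylinder theta w x -> cylinder theta w y ->
  cocycle_iter theta kappa n x g = cocycle_iter theta kappa n y g.
Proof.
move=> ww nw wx wy; elim: n nw => // n IH nw /=; rewrite IH ?(ltnW nw)//.
have an : alpha (nth set0 w n) by apply: ww; rewrite mem_nth.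
by apply: (nn_locally_constant h_kappa an); [exact: wx|exact: wy].
Qed.

(** The Markov alternative leaves only the case of a null intersection, and then the cylinder lies
    in the preimage of a null set, which invariance makes null. *)
Lemma transition_null u k : word_in alpha u -> (k.+1 < size u)%N ->
  prob mu (cylinder theta u) != 0 ->
  mu (nth set0 u k.+1 `\` theta @` nth set0 u k) = 0%E.
Proof.
move=> uu ku u0; case: h_markov => _ _ mo.
have a1 : alpha (nth set0 u k.+1) by apply: uu; rewrite mem_nth.
have a0 : alpha (nth set0 u k) by apply: uu; rewrite mem_nth// ltnW.
have m1 := ms_letter alpha_system a1.
have m0 : measurable (theta @` nth set0 u k).
  by apply: (ms_image alpha_system a0) => //; apply: ms_letter alpha_system _ a0.
have [null|] := mo_markov mo a1 a0; last by rewrite setDE.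
exfalso; move/eqP: u0; apply; apply/eqP; rewrite eq_le prob_ge0 andbT.
have mI := measurableI _ _ m1 m0.
rewrite -[leRHS]/(fine 0%E) -null -/(prob mu _) -(prob_invariant k.+1 mI).
apply: prob_mono; [exact: (cylinder_measurable alpha_system)|exact: theta_iter_measurable|].
move=> x ux; split; first exact: ux.
by exists (iter k theta x) => //; apply: ux; apply: ltnW.
Qed.

(** A cylinder of positive mass that meets the return event lies in it and ends in a letter [a]
    inside [Omega], of which [G] takes at least half. Distortion along the first [m] letters
    transports this proportion back to time 0. *)
Lemma return_event_distortion (o : V) (s : seq (set X)) (C : nat -> R) (p0 : R)
    (G : set X) m :
  (forall a, a \in s -> alpha a /\ a `<=` Omega) ->
  (forall x, Omega x -> exists2 a, a \in s & a x) ->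
  (forall n w a, words mu theta alpha n w -> alpha a ->
      cylinder theta (rcons w a) !=set0 ->
      cylinder theta w `<=` Omega -> a `<=` Omega ->
      distortion_le mu theta w a (C n) (dist_r sigma bbeta r)) ->
  0 < p0 -> (forall a, a \in s -> p0 <= prob mu a) ->
  measurable G -> prob mu (~` G) <= p0 / 2 -> (0 < m)%N ->
  prob mu (return_event o m) <=
  2 * expR (2 * `|C m|) * prob mu (return_event o m `&` iter m theta @^-1` G).
Proof.
move=> sO Os dist p00 p0s mG Gp0 m0.
have mA := return_event_meas o m.
have mGm := theta_iter_measurable m mG.
set A := return_event o m in mA *.
have K0 : 0 <= 2 * expR (2 * `|C m|) by rewrite mulr_ge0// expR_ge0.
(* The first [m] letters decide the cocycle at time [m]; the last one locates the end point in
   [Omega]. *)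
apply: (@prob_le_partition _ _ _ mu _ [set u | word_in alpha u /\ size u = m.+1]
   (cylinder theta)) => //.
- apply: sub_countable alpha_words_countable.
  by apply: subset_card_le => u [].
- by move=> u [uu _]; apply: (cylinder_measurable alpha_system).
- move=> u v x [uu su] [vv sv]; apply: (cylinder_disjoint alpha_system) => //.
  by rewrite su sv.
- exact: measurableI.
- apply: negligibleS (@negligible_set0 _ _ _ mu) => x [_ nx]; apply: nx.
  by have [u [uu su ux]] := itinerary m.+1 x; exists u.
move=> u [uu su].
have mu_ := cylinder_measurable alpha_system uu.
have [u0|u0] := eqVneq (prob mu (cylinder theta u)) 0.
  apply: (@le_trans _ _ (prob mu (cylinder theta u))).
    by apply: prob_mono => //; apply: measurableI.
  by rewrite u0 mulr_ge0// prob_ge0.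
have [[x0 [[[Ox0 Omx0] xo] ux0]]|no] := pselect (exists x, A x /\ cylinder theta u x); last first.
  rewrite (_ : A `&` cylinder theta u = set0) ?prob_set0 ?mulr_ge0 ?prob_ge0//.
  by apply/seteqP; split => // x [Ax ux]; apply: no; exists x.
case/lastP: u uu su mu_ u0 ux0 => // w a uu; rewrite size_rcons => -[sw] mu_ u0 ux0.
have [ww aw] : word_in alpha w /\ word_in alpha [:: a].
  by apply/word_in_cat; rewrite cats1.
have aa : alpha a by apply: aw; rewrite mem_head.
have ma := ms_letter alpha_system aa.
have cylE : cylinder theta (rcons w a) = cylinder theta w `&` iter (size w) theta @^-1` a.
  by rewrite -cats1 cylinder_cat cylinder_cons cylinder_nil preimage_setT setIT.
have ux0' := ux0; rewrite cylE sw in ux0'; case: ux0' => wx0 ax0.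
have [a' a's a'x] := Os _ Omx0.
have ea : a = a' := alpha_disjoint aa (sO a' a's).1 ax0 a'x.
have aO : a `<=` Omega by rewrite ea; exact: (sO a' a's).2.
have pa : p0 <= prob mu a by rewrite ea; apply: p0s.
case: w ww sw wx0 uu cylE mu_ u0 ux0 => [|b w] ww sw wx0 uu cylE mu_ u0 ux0.
  by rewrite -sw in m0.
have [bb _] := word_in_cons ww.
have bx0 : b x0 by exact: (wx0 0%N).
have [b' b's b'x] := Os _ Ox0.
have bO : b `<=` Omega.
  by rewrite (alpha_disjoint bb (sO b' b's).1 bx0 b'x); exact: (sO b' b's).2.
have wO : cylinder theta (b :: w) `<=` Omega by move=> x wx; apply: bO; exact: (wx 0%N).
have trans k : (k < size w)%N ->
    mu (nth set0 (b :: w) k.+1 `\` theta @` nth set0 (b :: w) k) = 0%E.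
  move=> kw; have kw1 : (k < size (b :: w))%N by rewrite /= ltnS ltnW.
  have kw2 : (k.+1 < size (b :: w))%N by [].
  have kw3 : (k.+1 < size (rcons (b :: w) a))%N by rewrite size_rcons ltnS ltnW.
  by have := transition_null uu kw3 u0; rewrite !nth_rcons kw1 kw2.
have last0 : mu (a `\` theta @` last b w) = 0%E.
  have kw3 : ((size w).+1 < size (rcons (b :: w) a))%N by rewrite size_rcons.
  have := transition_null uu kw3 u0; rewrite !nth_rcons /= ltnn eqxx ltnSn.
  by rewrite (_ : nth set0 (b :: w) (size w) = last b w)//; apply: (nth_last set0 (b :: w)).
have wW : words mu theta alpha m (b :: w).
  split => //; first by move=> k km; apply: ww; rewrite mem_nth// sw.
  by move=> k km; apply: trans; rewrite -sw in km.
have [phi [phiP [N N0 Ndist]]] : distortion_le mu theta (b :: w) a (C m) (dist_r sigma bbeta r).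
  by apply: dist => //; exists x0.
have Adom : mu.-negligible (a `\` branch_dom theta (b :: w)).
  exact: (branch_dom_full alpha_system).
have maG : measurable (a `&` G) by exact: measurableI.
have [|_ cmp] := @jacobian_comparison _ _ _ _ _ _ alpha_system (b :: w) phi a N
  `|C m| ww phiP ma Adom N0 _ (a `&` G) maG (@subIsetl _ _ _).
  move=> x y hx hy; apply: le_trans (Ndist x y hx hy) _.
  (* Only the bound by 1 of the metric is used here; the absolute value covers a negative [C m]. *)
  have d1 : 0 <= dist_r sigma bbeta r x y <= 1.
    case/andP: r_bounds => r0 r1; rewrite /dist_r.
    case: pselect => [e|_]; last by rewrite lexx ler01.
    by rewrite exprn_ge0 ?(ltW r0)//= exprn_ile1// ltW.
  case/andP: d1 => d0 d1.
  apply: le_trans (ler_norm _) _; rewrite normrM (ger0_norm d0).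
  by rewrite ler_piMr.
have aG2 : prob mu a / 2 <= prob mu (a `&` G).
  have := probDI mu ma mG.
  have : prob mu (a `\` G) <= prob mu (~` G).
    by apply: prob_mono; [exact: measurableD|exact: measurableC|move=> x []].
  lra.
have uA : cylinder theta (rcons (b :: w) a) `<=` A.
  move=> x ux; have := ux; rewrite cylE => -[wx ax]; split; last first.
    apply: etrans xo; rewrite -sw; exact: (kappa_iter_const o ww (leqnn _) wx wx0).
  by split; [exact: wO|apply: aO; rewrite -sw].
rewrite (setIidr uA) setIAC (setIidr uA) cylE sw -setIA -preimage_setI.
rewrite sw in cmp.
set PG := prob mu (_ `&` _ @^-1` (a `&` G)) in cmp *.
set Pa := prob mu (_ `&` _ @^-1` a) in cmp *.
have a0 : 0 < prob mu a by exact: lt_le_trans pa.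
have e0 : 0 < expR (2 * `|C m|) by exact: expR_gt0.
have Pa0 : 0 <= Pa by exact: prob_ge0.
rewrite -(ler_pM2r a0).
apply: (@le_trans _ _ (2 * (Pa * prob mu (a `&` G)))); first nra.
apply: le_trans (ler_wpM2l _ cmp) _ => //.
by rewrite !mulrA.
Qed.

Lemma return_rate_one_amenable (o : V) : uniform_loops bbeta khat ->
  finitely_covers theta alpha kappa nu sigma bbeta khat ->
  adequate theta mu alpha Omega beta eta r ->
  exponential_tails theta mu Omega beta eta ->
  return_rate theta mu kappa Omega o = 1%E -> mu_amenable E mu kappa.
Proof.
move=> loops covers ad tails rate1; apply: contrapT => nam.
have [eps [delta [eps0 delta0 iso]]] : exists eps delta : R, [/\ 0 < eps, 0 < delta &
    forall K : {fset V}, (0 < #|` K|)%N ->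
    delta * (#|` K|)%:R <= (#|` eps_boundary E mu kappa eps K|)%:R].
  apply: contrapT => no; apply: nam; apply: (mu_amenable_of_small o) => eps delta eps0 delta0.
  apply: contrapT => noK; apply: no; exists eps, delta; split => // K K0.
  rewrite leNgt; apply/negP => lt; apply: noK; exists K => //; exact: ltW.
(* A graph with one vertex cannot expand: no edge leaves that vertex. *)
have [g go] : exists g, g <> o.
  apply: contrapT => no.
  have allo g : g = o by apply: contrapT => ng; apply: no; exists g.
  have := iso [fset o]%fset; rewrite cardfs1 mulr1 => /(_ isT).
  rewrite (_ : eps_boundary _ _ _ _ _ = fset0) ?cardfs0 ?leNgt ?delta0//.
  apply/fsetP => v; rewrite !inE; apply/negbTE/negP => /andP[_ /asboolP[e [_ _ + _]]].
  by rewrite (allo e.2) inE eqxx.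
have time_pos b := letter_time_gt0 b go.
have [L0 [N [uL0 expansion]]] := expansion_of_cover loops covers eps0 iso.
have [s [c [s1 decay]]] := timed_return_decay tails o uL0 delta0 expansion.
have s0 : 0 < s by exact: lt_trans ltr01 s1.
have [sl [slO Osl]] := Omega_letters.
have [|p0 p00 p0sl] := @positive_min sl.
  move=> a /slO[aa _]; rewrite -lte_fin -probE; last exact: ms_letter alpha_system _ aa.
  by case: h_markov => _ _ mo; apply: (mo_positive mo aa).
have [N0 [G [M [q [mN0 N00 mG Gp0 GP]]]]] :=
  excursion_bound ad o (divr_gt0 p00 (ltr0n R 2)).
have [C Ccvg Cdist] := ad_distortion ad.
have c0 : 0 <= c.
  by apply: le_trans (decay 0%N 0%N o o); rewrite mulr_ge0 ?prob_ge0// exprn_ge0// ltW.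
pose H : seq V := pmap choice.unpickle (iota 0 q.+1).
pose K2 := 2 * (prob mu Omega * ((size (iota 0 M.+1))%:R * ((size H)%:R * c))).
have K20 : 0 <= K2 by rewrite !mulr_ge0 ?prob_ge0.
have ret_le m : (0 < m)%N -> prob mu (return_event o m) <=
    K2 * (m.+2%:R * (expR (2 * `|C m|) / s ^+ m)).
  move=> m0; have sm : 0 < s ^+ m by rewrite exprn_gt0.
  apply: le_trans (return_event_distortion o slO Osl Cdist p00 p0sl mG Gp0 m0) _.
  have e0 : 0 <= 2 * expR (2 * `|C m|) by rewrite mulr_ge0// expR_ge0.
  apply: le_trans (ler_wpM2l e0 (return_event_good_le time_pos m mN0 N00 mG GP)) _.
  apply: (@le_trans _ _ (2 * expR (2 * `|C m|) * (prob mu Omega *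
     (m.+2%:R * ((size (iota 0 M.+1))%:R * ((size H)%:R * (c / s ^+ m))))))).
    rewrite ler_wpM2l// ler_wpM2l ?prob_ge0//.
    rewrite -[m.+2 in leRHS](size_iota 0) -!sumr_const_seq_nat.
    apply: ler_sum => n _; apply: ler_sum => j _; apply: ler_sum => h _.
    rewrite ler_pdivlMr//; apply: le_trans (decay n (m + j)%N o h).
    by rewrite ler_wpM2l ?prob_ge0// ler_weXn2l ?leq_addr// ltW.
  rewrite /K2 le_eqVlt; apply/orP; left; apply/eqP.
  by move: (size (iota 0 M.+1))%:R (size H)%:R m.+2%:R (expR _) => *; ring.
(* [y] is the inverse square root of [s]: eventually [C m] is at most [ln s / 4 * m] in absolute
   value, so distortion uses up half of the exponential decay. *)
pose y := expR (- (ln s / 2)).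
have lns : 0 < ln s by rewrite ln_gt0.
have y0 : 0 < y by exact: expR_gt0.
have y1 : y < 1 by rewrite expR_lt1 oppr_lt0 divr_gt0.
(* The room between [y] and [y'] absorbs the constant and the linear factor from the number of
   possible excursions. *)
pose y' := (1 + y) / 2.
have y'0 : 0 < y' by rewrite /y'; lra.
have y'1 : y' < 1 by rewrite /y'; lra.
have yy' : 0 <= y / y' < 1.
  by rewrite divr_ge0 ?(ltW y0) ?(ltW y'0)//= ltr_pdivrMr// mul1r /y'; lra.
(* The 3 comes from [m.+2 <= 3 * m]; the 1 avoids dividing by 0. *)
have K21 : 0 < 1 / (3 * K2 + 1) by rewrite divr_gt0//; lra.
have [n1 n1P] := natrM_expr_lt yy' K21.
have tau0 : 0 < ln s / 4 by rewrite divr_gt0.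
have /cvgrPdist_lt/(_ _ tau0)[n2 _ n2P] := Ccvg.
have : (return_rate theta mu kappa Omega o <= y'%:E)%E.
  apply: (@limn_esup_root_le R (fun n => prob mu (return_event o n)) y' (n1 + n2).+1).
  - by move=> n; apply: prob_ge0.
  - exact: ltW.
  move=> m nm.
  have m0 : (0 < m)%N by exact: leq_ltn_trans nm.
  have m0R : 0 < m%:R :> R by rewrite ltr0n.
  have n1m : (n1 <= m)%N by apply: leq_trans (ltnW nm); rewrite leq_addr.
  have n2m : (n2 <= m)%N by apply: leq_trans (ltnW nm); rewrite leq_addl.
  have Cm : `|C m| <= ln s / 4 * m%:R.
    have := n2P m n2m; rewrite /= sub0r normrN normrM normfV (ger0_norm (ltW m0R)).
    by rewrite ltr_pdivrMr// => /ltW.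
  apply: le_trans (ret_le m m0) _.
  have ym : expR (2 * `|C m|) / s ^+ m <= y ^+ m.
    have sE : s = expR (ln s) by rewrite lnK ?posrE.
    rewrite ler_pdivrMr ?exprn_gt0// [s in leRHS]sE /y -!expRM_natl -expRD ler_expR.
    apply: (@le_trans _ _ (2 * (ln s / 4 * m%:R))); first by rewrite ler_wpM2l.
    lra.
  apply: (@le_trans _ _ (K2 * (m.+2%:R * y ^+ m))).
    by rewrite ler_wpM2l// ler_wpM2l.
  have := n1P m n1m; rewrite expr_div_n ltr_pdivlMr; last by lra.
  have y'm : 0 < y' ^+ m by rewrite exprn_gt0.
  rewrite [ltLHS](_ : _ = m%:R * y ^+ m * (3 * K2 + 1) / y' ^+ m); last first.
    by move: (m%:R) (y ^+ m) (y' ^+ m) => *; ring.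
  rewrite ltr_pdivrMr// mul1r => h.
  have m3 : m.+2%:R <= 3 * m%:R :> R.
    by rewrite -natrM ler_nat -addn2 (mulSn 2) leq_add2l leq_pmulr.
  have ym0 : 0 <= y ^+ m by rewrite exprn_ge0// ltW.
  apply: (@le_trans _ _ (K2 * (3 * m%:R * y ^+ m))).
    by rewrite ler_wpM2l// ler_wpM2r.
  apply: le_trans _ (ltW h).
  have : 0 <= m%:R * y ^+ m by rewrite mulr_ge0// ltW.
  nra.
by rewrite rate1 lee_fin leNgt y'1.
Qed.

End Setup.

Theorem theorem4p5 (d : measure_display) (X : measurableType d) (R : realType)
    (mu : probability X R) (theta : X -> X) (alpha : set (set X))
    (Omega : set X) (beta : set (seq (set X))) (eta : seq (set X) -> nat) (r : R)
    (V : countType) (E : set (V * V)) (kappa : X -> V -> V) (o : V)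
    (nu := cond_measure mu Omega)
    (sigma := induced_map theta beta eta)
    (bbeta := induced_partition theta beta)
    (khat := induced_cocycle theta kappa beta eta)
    (T := graph_extension theta kappa)
    (S := graph_extension sigma khat)
    (h_markov : markov_map theta mu alpha)
    (h_invariant : invariant_measure mu theta)
    (h_embedded : embedded_gibbs_markov theta mu alpha Omega beta eta r)
    (h_kappa : nearest_neighbour_cocycle E alpha kappa)
    (h_khat : locally_constant bbeta khat)
    (h_transitive : topologically_transitive nu bbeta S)
    (h_loops : uniform_loops bbeta khat) :
  (mu_amenable E mu kappa -> symmetric_extension Omega sigma nu khat ->
     return_rate theta mu kappa Omega o = 1%E)
  /\
  (topologically_transitive mu alpha T ->
     finitely_covers theta alpha kappa nu sigma bbeta khat ->
     adequate theta mu alpha Omega beta eta r ->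
     exponential_tails theta mu Omega beta eta ->
     return_rate theta mu kappa Omega o = 1%E ->
     mu_amenable E mu kappa).
Proof.
split=> [am sym|_ covers ad tails rate1].
  exact: (amenable_return_rate h_markov h_embedded h_kappa h_khat h_transitive
    h_invariant o am sym).
exact: (return_rate_one_amenable h_markov h_embedded h_kappa h_khat h_transitive
  h_invariant h_loops covers ad tails rate1).
Qed.
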